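(* Every symmetrically complete ordered abelian group is divisible and isomorphic to a Hahn product. Every symmetrically complete ordered field is real closed and isomorphic to a power series field with residue field $\mathbb{R}$ and divisible value group.
   Context: Ordered means linearly ordered; isomorphisms are isomorphisms of ordered groups, resp. ordered fields. A cut in a linearly ordered set $I$ is a pair $(D,E)$ of nonempty subsets with $I=D\cup E$ and $d<e$ for all $d\in D$, $e\in E$. Its cofinality is $(\kappa,\lambda)$ with $\kappa=\mathrm{cf}(D)$ the cofinality of $D$ and $\lambda=\mathrm{ci}(E)$ the coinitiality of $E$ (cofinality under the reversed ordering); these equal $1$ when $D$ has a maximum, resp. $E$ has a minimum. An ordered abelian group or field is symmetrically complete if every cut in its underlying linearly ordered set satisfies $\kappa\ne\lambda$. Hahn product: given a linearly ordered index set $I$ and archimedean ordered abelian groups $C_\gamma$, $\gamma\in I$, it is the subgroup of $\prod_{\gamma\in I}C_\gamma$ of all $c=(c_\gamma)_{\gamma\in I}$ whose support $\{\gamma\mid c_\gamma\ne0\}$ is a wellordered subset of $I$, ordered lexicographically: for $c\ne0$ with $\gamma_0$ the minimal element of its support, $c>0$ iff $c_{\gamma_0}>0$. Power series field with residue field $\mathbb{R}$ and value group an ordered abelian group $\Gamma$: the field $\mathbb{R}((\Gamma))$ of all formal sums $\sum_{\gamma\in\Gamma}r_\gamma t^\gamma$, $r_\gamma\in\mathbb{R}$, with wellordered support, with the usual addition and multiplication, ordered by the sign of the coefficient at the minimal element of the support. *)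

(* Defs.v *)
From HB Require Import structures.
From mathcomp Require Import all_boot all_order all_algebra.
From mathcomp Require Import all_classical wochoice reals.

Set Implicit Arguments.
Unset Strict Implicit.
Unset Printing Implicit Defensive.

Import Order.TTheory GRing.Theory Num.Theory.

Local Open Scope classical_set_scope.
Local Open Scope ring_scope.

Section Cuts.
Context {d : Order.disp_t} {T : orderType d}.
Implicit Types (r : rel T) (D E S : set T).

Definition is_cut D E :=
  [/\ D !=set0, E !=set0, D `|` E = setT &
      forall x y, D x -> E y -> (x < y)%O].

Definition cofinal_in r D S :=
  S `<=` D /\ forall x, D x -> exists2 s, S s & r x s.

(* S witnesses the cofinality of (D, r): the cardinality of S is the least
   cardinality of an r-cofinal subset of D.  Such an S always exists, since
   cardinals are well ordered. *)
Definition attains_cofinality r D S :=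
  cofinal_in r D S /\ forall S', cofinal_in r D S' -> (S #<= S')%card.

End Cuts.

Definition symmetrically_complete d (T : orderType d) :=
  forall D E : set T, is_cut D E ->
  forall S S' : set T,
    attains_cofinality <=%O D S -> attains_cofinality >=%O E S' ->
    (S #!= S')%card.

(* MathComp's porderZmodType relates neither the order to the addition nor any
   two elements to each other.  Totality is an axiom here, rather than inherited
   from Order.Total, because the latter would require missing joins with the
   existing numeric hierarchy; the orderType instance is declared just below. *)
HB.mixin Record POrderedZmodule_isOrdered G of Num.POrderedZmodule G := {
  ordered_lerD2r : forall z x y : G, x <= y -> x + z <= y + z;
  ordered_le_total : total (<=%O : rel G)
}.

#[short(type="orderedZmodType")]
HB.structure Definition OrderedZmodule :=
  { G of POrderedZmodule_isOrdered G & Num.POrderedZmodule G }.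

HB.instance Definition _ (G : orderedZmodType) :=
  Order.POrder_isTotal.Build ring_display (OrderedZmodule.sort G)
    (@ordered_le_total G).

HB.instance Definition _ (R : realFieldType) :=
  POrderedZmodule_isOrdered.Build (Num.RealField.sort R)
    (fun z x y (xy : x <= y) => lerD xy (lexx z)) (@le_total _ R).

Definition divisible (G : zmodType) :=
  forall n (x : G), (0 < n)%N -> exists y : G, y *+ n = x.

Definition archimedean (G : orderedZmodType) :=
  forall x y : G, 0 < x -> exists n, y <= x *+ n.

Section OrderedZmoduleTheory.
Variable G : orderedZmodType.
Implicit Types x y z t : G.

Lemma oler_D2r z x y : (x + z <= y + z) = (x <= y).
Proof.
apply/idP/idP => [/(ordered_lerD2r (- z))|]; last exact: ordered_lerD2r.
by rewrite !addrK.
Qed.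

Lemma oltr_D2r z x y : (x + z < y + z) = (x < y).
Proof. by rewrite !lt_neqAle oler_D2r (inj_eq (addIr z)). Qed.

Lemma osubr_gt0 x y : (0 < y - x) = (x < y).
Proof. by rewrite -(oltr_D2r x 0) add0r subrK. Qed.

Lemma oaddr_gt0 x y : 0 < x -> 0 < y -> 0 < x + y.
Proof. by move=> x0 y0; rewrite (lt_trans y0)// -{1}[y]add0r oltr_D2r. Qed.

Lemma oler_D x y z t : x <= z -> y <= t -> x + y <= z + t.
Proof.
move=> xz yt; apply: (le_trans (ordered_lerD2r y _ _ xz)).
by rewrite ![z + _]addrC oler_D2r.
Qed.

Lemma oler_B2l z x y : (z - x <= z - y) = (y <= x).
Proof.
rewrite -(oler_D2r (x + y - z) (z - x)) -(oler_D2r 0 y x) !addr0.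
congr (_ <= _).
  by rewrite -(addrA x) (addrA (z - x)) subrK addrC subrK.
by rewrite [x + y]addrC -(addrA y) (addrA (z - y)) subrK addrC subrK.
Qed.

End OrderedZmoduleTheory.

Section WellOrderedSubsets.
Context {d : Order.disp_t} {I : orderType d}.

Lemma wo_chainP (P : {pred I}) :
  wo_chain <=%O P <->
  forall A : set I, (forall x, A x -> x \in P) -> A !=set0 ->
    exists2 m, A m & forall x, A x -> (m <= x)%O.
Proof.
split=> [Pwo A AP [x Ax]|Pwo].
  have [||m [[/asboolP Am mA] _]] := Pwo [pred x | `[< A x >]].
  - by move=> y /asboolP/AP.
  - by exists x; apply/asboolP.
  by exists m => // y Ay; apply: mA; apply/asboolP.
apply: antisymmetric_wo_chain => [x y _ _|A AP [x Ax]]; first exact: le_anti.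
have [||m Am mA] := Pwo [set x | x \in A]; first by move=> y /= /AP.
  by exists x.
by exists m.
Qed.

Lemma wo_chain_sub (P Q : {pred I}) :
  {subset P <= Q} -> wo_chain <=%O Q -> wo_chain <=%O P.
Proof.
by move=> PQ /wo_chainP Qwo; apply/wo_chainP => A AP; apply: Qwo => x /AP/PQ.
Qed.

Lemma wo_chain0 : wo_chain <=%O (pred0 : {pred I}).
Proof. by apply/wo_chainP => A A0 [x /A0]; rewrite inE. Qed.

Lemma wo_chain1 (i : I) : wo_chain <=%O (pred1 i : {pred I}).
Proof.
apply/wo_chainP => A A1 [x Ax]; exists x => // y Ay.
by move: (A1 _ Ax) (A1 _ Ay); rewrite !inE => /eqP-> /eqP->.
Qed.

Lemma wo_chainU (P Q : {pred I}) :
  wo_chain <=%O P -> wo_chain <=%O Q -> wo_chain <=%O [predU P & Q].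
Proof.
move=> /wo_chainP Pwo /wo_chainP Qwo; apply/wo_chainP => A APQ A0.
have [|AP0] := pselect ((A `&` [set x | x \in P]) !=set0); last first.
  apply: Qwo => // x Ax; have := APQ _ Ax; rewrite inE => /orP[Px|//].
  by case: AP0; exists x.
move=> /Pwo[x []//|p [Ap _] pP].
have [|AQ0] := pselect ((A `&` [set x | x \in Q]) !=set0); last first.
  exists p => // x Ax; apply: pP; split=> //.
  have := APQ _ Ax; rewrite inE => /orP[//|Qx].
  by case: AQ0; exists x.
move=> /Qwo[x []//|q [Aq _] qQ].
exists (Order.min p q) => [|x Ax]; first by case: (leP p q).
rewrite ge_min; apply/orP; have := APQ _ Ax; rewrite inE => /orP[Px|Qx].
  by left; apply: pP.
by right; apply: qQ.
Qed.

Lemma wo_finite (A : set I) :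
  (forall B, B `<=` A -> B !=set0 ->
     exists2 m, B m & forall x, B x -> (m <= x)%O) ->
  (forall B, B `<=` A -> B !=set0 ->
     exists2 m, B m & forall x, B x -> (x <= m)%O) ->
  finite_set A.
Proof.
move=> Amin Amax; apply: contrapT => Ainf.
have [|M AM maxM] := Amax A (fun _ => id).
  by apply/set0P; apply/eqP => A0; apply: Ainf; rewrite A0.
pose low x := A `&` [set y | (y <= x)%O].
have [| |m [Am minf] mmin] := Amin (A `&` [set x | infinite_set (low x)]).
- by move=> x [].
- exists M; split=> //= fM; apply: Ainf; apply: sub_finite_set fM => x Ax.
  by split=> //=; apply: maxM.
apply: minf; have [S0|S0] := pselect ((A `&` [set y | (y < m)%O]) !=set0).
  have [x []//|p [Ap /= pm] maxp] := Amax _ _ S0.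
  have pfin : finite_set (low p).
    by apply: contrapT => pinf; have := mmin p (conj Ap pinf); rewrite leNgt pm.
  apply: (@sub_finite_set _ _ (low p `|` [set m])).
    move=> x [Ax /=]; rewrite le_eqVlt => /predU1P[->|xm]; [by right|left].
    by split=> //=; apply: maxp.
  by rewrite finite_setU; split.
apply: (@sub_finite_set _ _ [set m]) => // x [Ax /=].
rewrite le_eqVlt => /predU1P[//|xm].
by case: S0; exists x.
Qed.

End WellOrderedSubsets.

Section SumsOfWellOrderedSubsets.
Variable G : orderedZmodType.
Implicit Types P Q : {pred G}.

Lemma wo_finite_sum P Q (g : G) :
  wo_chain <=%O P -> wo_chain <=%O Q ->
  finite_set [set a | (a \in P) && (g - a \in Q)].
Proof.
move=> /wo_chainP Pwo /wo_chainP Qwo; apply: wo_finite => B BA [x Bx].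
  by apply: Pwo; [move=> y /BA /= /andP[]|exists x].
have [||m [a Ba <-] mmin] := Qwo [set g - a | a in B].
- by move=> _ [a /BA /= /andP[_ ?] <-].
- by exists (g - x), x.
by exists a => // y By; rewrite -(oler_B2l g); apply: mmin; exists y.
Qed.

Definition addp P Q : {pred G} :=
  [pred g | `[< exists2 a, a \in P & g - a \in Q >]].

Lemma wo_addp P Q :
  wo_chain <=%O P -> wo_chain <=%O Q -> wo_chain <=%O (addp P Q).
Proof.
move=> /wo_chainP Pwo /wo_chainP Qwo; apply/wo_chainP => X XPQ [x0 Xx0].
pose A := [set a | a \in P /\ exists2 b, b \in Q & X (a + b)].
pose ismin a b := [/\ b \in Q, X (a + b) &
  forall b', b' \in Q -> X (a + b') -> b <= b'].
have minE a : exists b, A a -> ismin a b.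
  have [Aa|] := pselect (A a); last by exists 0.
  case: (Aa) => _ [b Qb Xb].
  have [||m [Qm Xm] mmin] := Qwo [set b | b \in Q /\ X (a + b)].
  - by move=> ? [].
  - by exists b.
  by exists m => _; split=> // b' Qb' Xb'; apply: mmin.
have [m mP] := choice minE.
pose f a := a + m a.
have Af x : X x -> exists2 a, A a & f a <= x.
  move=> Xx; have /asboolP[a Pa Qa] := XPQ _ Xx.
  have Aa : A a by split=> //; exists (x - a); rewrite // addrC subrK.
  exists a => //; have [_ _ /(_ _ Qa)] := mP _ Aa.
  rewrite addrC subrK => /(_ Xx) le_m.
  by rewrite /f addrC -(subrK a x) oler_D2r.
have AP B : B `<=` A -> B !=set0 ->
    exists2 m, B m & forall x, B x -> m <= x.
  by move=> BA; apply: Pwo => x /BA[].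
pose T := A `&` [set a | forall a', A a' -> a' < a -> f a < f a'].
have [a0 Aa0 _] := Af _ Xx0.
have [|a1 Aa1 a1min] := AP A (fun _ => id); first by exists a0.
have Ta1 : T a1.
  by split=> // a' Aa'; rewrite ltNge a1min.
have [||_ [a [Aa Ta] <-] amin] := Qwo (m @` T).
- by move=> _ [a [Aa _] <-]; have [] := mP _ Aa.
- by exists (m a1), a1.
exists (f a); first by have [] := mP _ Aa.
move=> x /Af[a' Aa' /(le_trans _)]; apply; rewrite leNgt; apply/negP => fa'.
have [||a2 [Aa2 /= fa2] a2min] := AP (A `&` [set a' | f a' < f a]).
- by move=> ? [].
- by exists a'.
have Ta2 : T a2.
  split=> // a3 Aa3 a32; apply: (lt_le_trans fa2); rewrite leNgt.
  by apply/negP => fa3; have := a2min a3 (conj Aa3 fa3); rewrite leNgt a32.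
have aa2 : a <= a2.
  by rewrite leNgt; apply/negP => /(Ta _ Aa2)/(lt_trans fa2); rewrite ltxx.
have : m a <= m a2 by apply: amin; exists a2.
by move=> /(oler_D aa2); rewrite leNgt => /negP; apply.
Qed.

End SumsOfWellOrderedSubsets.

Section HahnProduct.
Context {d : Order.disp_t} {I : orderType d}.
Variable C : I -> orderedZmodType.

Record hahn := Hahn {
  hahn_val :> forall i, C i;
  hahn_wo : wo_chain <=%O (fun i => hahn_val i != 0)
}.

Arguments hahn_wo : clear implicits.

HB.instance Definition _ := gen_eqMixin hahn.
HB.instance Definition _ := gen_choiceMixin hahn.

Implicit Types x y z : hahn.

Lemma hahnP x y : (forall i, x i = y i) -> x = y.
Proof.
case: x y => [x xwo] [y ywo] /= xy.
have exy : x = y by apply: functional_extensionality_dep.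
by case: y / exy ywo {xy} => ywo; congr Hahn.
Qed.

Fact hahn_zero_wo : wo_chain <=%O (fun i => (0 : C i) != 0).
Proof. by apply: wo_chain_sub wo_chain0 => i; rewrite /in_mem /= eqxx. Qed.
Definition hahn_zero := Hahn hahn_zero_wo.

Fact hahn_opp_wo x : wo_chain <=%O (fun i => - x i != 0).
Proof.
by apply: (wo_chain_sub _ (hahn_wo x)) => i; rewrite /in_mem /= oppr_eq0.
Qed.
Definition hahn_opp x := Hahn (@hahn_opp_wo x).

Fact hahn_add_wo x y : wo_chain <=%O (fun i => x i + y i != 0).
Proof.
apply: (wo_chain_sub _ (wo_chainU (hahn_wo x) (hahn_wo y))) => i.
rewrite /in_mem /= /in_mem /= -negb_and; apply: contra.
by move=> /andP[/eqP-> /eqP->]; rewrite addr0.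
Qed.
Definition hahn_add x y := Hahn (@hahn_add_wo x y).

Fact hahn_addA : associative hahn_add.
Proof. by move=> x y z; apply: hahnP => i; rewrite /= addrA. Qed.
Fact hahn_addC : commutative hahn_add.
Proof. by move=> x y; apply: hahnP => i; rewrite /= addrC. Qed.
Fact hahn_add0 : left_id hahn_zero hahn_add.
Proof. by move=> x; apply: hahnP => i; rewrite /= add0r. Qed.
Fact hahn_addN : left_inverse hahn_zero hahn_opp hahn_add.
Proof. by move=> x; apply: hahnP => i; rewrite /= addNr. Qed.

HB.instance Definition _ :=
  GRing.isZmodule.Build hahn hahn_addA hahn_addC hahn_add0 hahn_addN.

(* Such an i is necessarily the minimum of the support of x. *)
Definition hahn_pos x :=
  exists i, 0 < x i /\ forall j, (j < i)%O -> x j = 0.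

Definition hahn_lt x y := `[< hahn_pos (y - x) >].
Definition hahn_le x y := (x == y) || hahn_lt x y.

Lemma hahn_posD x y : hahn_pos x -> hahn_pos y -> hahn_pos (x + y).
Proof.
move=> [i [xi xi0]] [j [yj yj0]].
have [ij|ji|eij] := ltgtP i j.
- exists i; split=> [|k ki]; first by rewrite /= yj0// addr0.
  by rewrite /= xi0// yj0 ?addr0// (lt_trans ki).
- exists j; split=> [|k kj]; first by rewrite /= xi0// add0r.
  by rewrite /= yj0// xi0 ?addr0// (lt_trans kj).
- case: j / eij in yj yj0 *; exists i.
  split=> [|k ki]; first exact: oaddr_gt0.
  by rewrite /= xi0// yj0 ?addr0.
Qed.

Lemma hahn_pos_total x : x != 0 -> hahn_pos x \/ hahn_pos (- x).
Proof.
move=> x0; have /wo_chainP := hahn_wo x.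
move=> /(_ [set i | x i != 0])[//||i /= xi mini].
  apply/set0P/eqP => S0; move/eqP: x0; apply; apply: hahnP => i /=.
  by apply/eqP/negPn/negP => xi; have : [set i | x i != 0] i := xi; rewrite S0.
have lt0 j : (j < i)%O -> x j = 0.
  by move=> ji; apply/eqP/negPn/negP => /mini; rewrite leNgt ji.
have := xi; rewrite neq_lt => /orP[xi0|xi0]; [right|left]; exists i.
  split=> [|j /lt0 /= ->]; last by rewrite oppr0.
  by rewrite /= -[- x i]add0r osubr_gt0.
by split.
Qed.

Fact hahn_lt_irr : irreflexive hahn_lt.
Proof.
move=> x; apply/negbTE/negP => /asboolP[i []].
by rewrite subrr ltxx.
Qed.

Fact hahn_lt_trans : transitive hahn_lt.
Proof.
move=> y x z /asboolP xy /asboolP yz; apply/asboolP.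
by rewrite -(subrK y z) -addrA; apply: hahn_posD.
Qed.

HB.instance Definition _ := Order.LtLe_isPOrder.Build ring_display hahn
  (fun _ _ => erefl : hahn_le _ _ = _) hahn_lt_irr hahn_lt_trans.

Fact hahn_le_total : total (<=%O : rel hahn).
Proof.
move=> x y; rewrite /Order.le /= /hahn_le.
have [//|xy] := eqVneq x y.
case: (@hahn_pos_total (x - y)); rewrite ?subr_eq0// ?opprB => /asboolP pos.
  by rewrite [hahn_lt y x]pos !orbT.
by rewrite [hahn_lt x y]pos.
Qed.

HB.instance Definition _ :=
  Order.POrder_isTotal.Build ring_display hahn hahn_le_total.

Fact hahn_lerD2r z x y : x <= y -> x + z <= y + z.
Proof.
rewrite /Order.le /= /hahn_le /hahn_lt => /orP[/eqP->|pos]; first by rewrite eqxx.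
by rewrite opprD addrACA subrr addr0 pos orbT.
Qed.

HB.instance Definition _ :=
  POrderedZmodule_isOrdered.Build hahn hahn_lerD2r hahn_le_total.

Lemma hahn_gt0P x : reflect (hahn_pos x) (0 < x).
Proof. by rewrite /Order.lt /= /hahn_lt subr0; apply: asboolP. Qed.

End HahnProduct.

Arguments hahn_wo {d I C} h.

Section PowerSeries.
Variables (R : realFieldType) (G : orderedZmodType).

(* The power series field R((G)), with c(g) the coefficient of t^g; addition
   and order are those of the Hahn product.  Only the commutative ring structure
   is declared: a bijective ring morphism from a field onto power_series is the
   same thing as an isomorphism of fields. *)
Definition power_series := hahn (fun _ : G => R : orderedZmodType).

HB.instance Definition _ := OrderedZmodule.on power_series.

Implicit Types c e f : power_series.

Definition supp c : {pred G} := fun g => c g != 0.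

Lemma fin_conv c e g : finite_set [set a | c a * e (g - a) != 0].
Proof.
apply: sub_finite_set (wo_finite_sum g (hahn_wo c) (hahn_wo e)) => a /=.
by rewrite mulf_eq0 negb_or.
Qed.

(* A finite sum: see fin_conv. *)
Definition ps_mul_fun c e (g : G) : R := \sum_(a \in [set: G]) c a * e (g - a).

Lemma ps_mul_fun_supp c e g : ps_mul_fun c e g != 0 -> g \in addp (supp c) (supp e).
Proof.
move=> /(@fsbigN1 _ _ _ G G _ (fun x a => c a * e (x - a)))[a _].
rewrite mulf_eq0 negb_or => /andP[ca ea].
by apply/asboolP; exists a.
Qed.

Fact ps_mul_wo c e : wo_chain <=%O (fun g => ps_mul_fun c e g != 0).
Proof.
apply: (wo_chain_sub _ (wo_addp (hahn_wo c) (hahn_wo e))) => g.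
exact: ps_mul_fun_supp.
Qed.
Definition ps_mul c e : power_series := Hahn (@ps_mul_wo c e).

Fact ps_one_wo :
  wo_chain <=%O (fun g : G => (if g == 0 then 1 else 0 : R) != 0).
Proof.
apply: (wo_chain_sub _ (@wo_chain1 _ G 0)) => g; rewrite /in_mem /=.
by case: (g =P 0); rewrite ?eqxx.
Qed.
Definition ps_one : power_series :=
  Hahn (ps_one_wo : wo_chain _ (fun g => (_ : (R : orderedZmodType)) != 0)).

Lemma subrI_bij (g : G) : bijective (fun a => g - a).
Proof. by exists (fun a => g - a) => a; rewrite subKr. Qed.

Fact ps_mulC : commutative ps_mul.
Proof.
move=> c e; apply: hahnP => g /=; rewrite /ps_mul_fun.
rewrite (reindex_fsbigT (fun a => g - a)); last exact: subrI_bij.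
by apply: eq_fsbigr => a _; rewrite subKr mulrC.
Qed.

Fact ps_mul1 : left_id ps_one ps_mul.
Proof.
move=> c; apply: hahnP => g /=; rewrite /ps_mul_fun.
rewrite -(fsbig_widen [set 0])// ?fsbig_set1 /= ?eqxx ?mul1r ?subr0//.
by move=> a [_ /= /eqP/negbTE->]; rewrite mul0r.
Qed.

Fact ps_mulDl : left_distributive ps_mul +%R.
Proof.
move=> c e f; apply: hahnP => g /=; rewrite /ps_mul_fun.
set X := [set a | c a * f (g - a) != 0] `|` [set a | e a * f (g - a) != 0].
have Xfin : finite_set X by rewrite finite_setU; split; exact: fin_conv.
have XE (h : G -> R) : (forall a, h a != 0 -> X a) ->
    \sum_(a \in [set: G]) h a = \sum_(a \in X) h a.
  move=> hX; apply/esym/fsbig_widen => // a [_ /= Xa].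
  by apply/eqP/negPn/negP => /hX.
transitivity (\sum_(a \in X) (c a * f (g - a) + e a * f (g - a))).
  rewrite XE => [|a /=]; last first.
    rewrite mulrDl /X /=; have [->|] := eqVneq (c a * f (g - a)) 0.
      by rewrite add0r; right.
    by left.
  by apply: eq_fsbigr => a _; rewrite mulrDl.
by rewrite fsbig_split//; congr (_ + _); apply/esym/XE => a ?; [left|right].
Qed.

Fact ps_mulA : associative ps_mul.
Proof.
move=> c e f; apply: hahnP => g /=; rewrite /ps_mul_fun /= /ps_mul_fun.
pose F a k := c a * (e (k - a) * f (g - k)).
pose K := [set k | (k \in addp (supp c) (supp e)) && (g - k \in supp f)].
have Kfin : finite_set K.
  by apply: wo_finite_sum (hahn_wo f); apply: wo_addp; exact: hahn_wo.
pose A := \bigcup_(k in K) [set a | c a * e (k - a) != 0].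
have Afin : finite_set A by apply: bigcup_finite => // k _; apply: fin_conv.
have F0 a k : F a k != 0 -> A a /\ K k.
  rewrite /F !mulf_eq0 !negb_or => /and3P[ca ek fk].
  have Kk : K k by apply/andP; split=> //; apply/asboolP; exists a.
  by split=> //; exists k => //=; rewrite mulf_neq0.
transitivity (\sum_(a \in [set: G]) \sum_(k \in [set: G]) F a k).
  apply: eq_fsbigr => a _; rewrite mulr_fsumr.
  rewrite (reindex_fsbigT (fun k => k - a)).
    by apply: eq_fsbigr => k _; rewrite /F opprB addrA subrK.
  by exists (fun k => k + a) => k; rewrite ?subrK ?addrK.
transitivity (\sum_(a \in A) \sum_(k \in K) F a k).
  transitivity (\sum_(a \in [set: G]) \sum_(k \in K) F a k).
    apply: eq_fsbigr => a _; apply/esym/fsbig_widen => // k [_ /= Kk].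
    by apply/eqP/negPn/negP => /F0[].
  apply/esym/fsbig_widen => // a [_ /= Aa].
  by apply: fsbig1 => k _; apply/eqP/negPn/negP => /F0[].
rewrite exchange_fsbig//.
transitivity (\sum_(k \in K) \sum_(a \in [set: G]) F a k).
  apply: eq_fsbigr => k _; apply/fsbig_widen => // a [_ /= Aa].
  by apply/eqP/negPn/negP => /F0[].
transitivity (\sum_(k \in [set: G]) \sum_(a \in [set: G]) F a k).
  apply/fsbig_widen => // k [_ /= Kk].
  by apply: fsbig1 => a _; apply/eqP/negPn/negP => /F0[].
apply: eq_fsbigr => k _; rewrite mulr_fsuml.
by apply: eq_fsbigr => a _; rewrite /F mulrA.
Qed.

Fact ps_one_neq0 : ps_one != 0.
Proof.
apply/eqP => /(congr1 (fun c : power_series => c 0)) /= /eqP.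
by rewrite eqxx oner_eq0.
Qed.

HB.instance Definition _ := GRing.Zmodule_isComNzRing.Build power_series
  ps_mulA ps_mulC ps_mul1 ps_mulDl ps_one_neq0.

End PowerSeries.

(* Main.v *)
(* Symmetric completeness forbids cuts whose two sides can be reflected into each
   other.  A nest of balls of the natural valuation with empty intersection, an
   unfilled real cut in an archimedean component, and a discrete component would
   each produce such a cut.  Hence a symmetrically complete group is spherically
   complete and its components are isomorphic to the reals, and successive
   approximation shows that it is divisible.

   To compare such a group G with the Hahn product H of copies of the reals over
   its value set, take a maximal order isomorphism P between subgroups of G and H
   extending a matching of representatives of the values.  Any y in G outside the
   domain of P determines a cut; if the values of y - a, for a in the domain, have
   no maximum, then the cut is filled in H by spherical completeness, and otherwise
   by completeness of the components.  So P is total, and also onto by symmetry.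

   For a field K, the cuts of the multiplicative group of positive elements are
   also cuts of K, so this group is divisible and contains a complement Gamma of
   the group of units.  Spherical completeness and divisibility of the value group
   imply real closedness, for K as well as for R((Gamma)).  The argument for groups
   is then repeated with isomorphisms between subrings that extend the matching of
   Gamma with the monomials: adjoining an element that realizes a given cut is
   compatible with the order because the sign of a polynomial is determined by the
   cut once its roots are matched, which is achieved by induction on the degree. *)

Require Import Defs.
From HB Require Import structures.
From mathcomp Require Import all_boot all_order all_algebra.
From mathcomp Require Import all_classical wochoice reals.
From mathcomp Require Import zify ring lra polyorder polyrcf.
From mathcomp Require Import Rstruct.

Set Implicit Arguments.
Unset Strict Implicit.
Unset Printing Implicit Defensive.

Import Order.TTheory GRing.Theory Num.Theory.

Local Open Scope classical_set_scope.
Local Open Scope ring_scope.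

(** * Ordered abelian groups and their natural valuation *)

Section SquareZeroExtension.
Variable M : zmodType.

(* The square-zero extension of the integers by M.  It turns an identity between
   Z-linear expressions in M into one between elements of a commutative ring,
   where the [ring] tactic applies. *)
Definition sqz := (int * M)%type.

HB.instance Definition _ := GRing.Zmodule.on sqz.

Definition sqz_mul (x y : sqz) : sqz := (x.1 * y.1, y.2 *~ x.1 + x.2 *~ y.1).

Fact sqz_mulA : associative sqz_mul.
Proof.
move=> [a x] [b y] [c z]; rewrite /sqz_mul /=; congr (_, _); first exact: mulrA.
by rewrite !mulrzDl -!mulrzA addrA [c * a]mulrC [b * a]mulrC.
Qed.

Fact sqz_mulC : commutative sqz_mul.
Proof.
by move=> [a x] [b y]; rewrite /sqz_mul /=; congr (_, _); rewrite 1?mulrC 1?addrC.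
Qed.

Fact sqz_mul1 : left_id (1, 0) sqz_mul.
Proof. by move=> [a x]; rewrite /sqz_mul /= mul1r mulr1z mul0rz addr0. Qed.

Fact sqz_mulDl : left_distributive sqz_mul +%R.
Proof.
move=> [a x] [b y] [c z]; rewrite /sqz_mul /=; congr (_, _); first exact: mulrDl.
by rewrite /= mulrzDr mulrzDl addrACA.
Qed.

Fact sqz_one_neq0 : (1, 0) != 0 :> sqz.
Proof. by []. Qed.

HB.instance Definition _ := GRing.Zmodule_isComNzRing.Build sqz
  sqz_mulA sqz_mulC sqz_mul1 sqz_mulDl sqz_one_neq0.

Definition sqz_in (x : M) : sqz := (0, x).

Fact sqz_in_additive : zmod_morphism sqz_in.
Proof. by move=> x y. Qed.

HB.instance Definition _ := GRing.isZmodMorphism.Build M sqz sqz_in sqz_in_additive.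

Lemma sqz_in_inj : injective sqz_in.
Proof. by move=> x y []. Qed.

End SquareZeroExtension.

Ltac abel := apply: sqz_in_inj; ring.

Section OrderedGroup.
Variable G : orderedZmodType.
Implicit Types (x y z r s : G) (n : nat).

(** Reduces an inequality to a known one with the same difference. The remaining identity is left to
    [abel]; together they do the work of linear arithmetic in an ordered group. *)
Lemma ole_by x y z t : x <= y -> y - x = t - z -> z <= t.
Proof.
by move=> xy e; rewrite -(oler_D2r (- z)) -e subrr -(oler_D2r x) add0r subrK.
Qed.

Lemma olt_by x y z t : x < y -> y - x = t - z -> z < t.
Proof. by move=> xy e; rewrite -osubr_gt0 -e osubr_gt0. Qed.

Lemma oler_wMn2r n x y : x <= y -> x *+ n <= y *+ n.
Proof.
by move=> xy; elim: n => [|n IH]; rewrite ?mulr0n// !mulrS; apply: oler_D.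
Qed.

Lemma oltr_D x y z t : x < y -> z <= t -> x + z < y + t.
Proof.
move=> xy zt; apply: (@lt_le_trans _ _ (y + z)); first by rewrite oltr_D2r.
exact: oler_D.
Qed.

Lemma oltr_wMn2r n x y : x < y -> x *+ n.+1 < y *+ n.+1.
Proof.
move=> xy; rewrite !mulrS; apply: oltr_D => //; exact/oler_wMn2r/ltW.
Qed.

Lemma oler_pMn2r n x y : (0 < n)%N -> (x *+ n <= y *+ n) = (x <= y).
Proof.
case: n => // n _; apply/idP/idP; last exact: oler_wMn2r.
by apply: contraTT; rewrite -!ltNge; apply: oltr_wMn2r.
Qed.

Lemma oltr_pMn2r n x y : (0 < n)%N -> (x *+ n < y *+ n) = (x < y).
Proof. by move=> n0; rewrite !ltNge oler_pMn2r. Qed.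

Lemma omulrn_ge0 n x : 0 <= x -> 0 <= x *+ n.
Proof. by move/(oler_wMn2r n); rewrite mul0rn. Qed.

Lemma omulrn_gt0 n x : (0 < n)%N -> 0 < x -> 0 < x *+ n.
Proof. by move=> n0 x0; rewrite -(mul0rn _ n) oltr_pMn2r. Qed.

Lemma omulrn_eq0 n x : (0 < n)%N -> (x *+ n == 0) = (x == 0).
Proof.
by move=> n0; rewrite !eq_le -{1 2}(mul0rn G n) !oler_pMn2r.
Qed.

Lemma oler_wpMn2l x m n : 0 <= x -> (m <= n)%N -> x *+ m <= x *+ n.
Proof.
move=> x0 mn; rewrite -(subnK mn) mulrnDr -{1}[x *+ m]add0r.
by rewrite oler_D2r omulrn_ge0.
Qed.

Lemma osubr_ge0 x y : (0 <= y - x) = (x <= y).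
Proof. by rewrite -(oler_D2r x 0 (y - x)) add0r subrK. Qed.

Lemma oler_N2 x y : (- x <= - y) = (y <= x).
Proof. by rewrite -[- x]sub0r -[- y]sub0r oler_B2l. Qed.

Lemma oltr_N2 x y : (- x < - y) = (y < x).
Proof. by rewrite !ltNge oler_N2. Qed.

Lemma ooppr_ge0 x : (0 <= - x) = (x <= 0).
Proof. by rewrite -{1}oppr0 oler_N2. Qed.

Lemma ooppr_gt0 x : (0 < - x) = (x < 0).
Proof. by rewrite -{1}oppr0 oltr_N2. Qed.

Lemma oler_pMz2l x (m n : int) : 0 < x -> (x *~ m <= x *~ n) = (m <= n).
Proof.
move=> x0; rewrite -osubr_ge0 -subr_ge0 -mulrzBr.
case: (n - m) => k; first by rewrite -pmulrn omulrn_ge0// ltW.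
rewrite NegzE mulrNz -pmulrn ooppr_ge0 oppr_ge0.
by rewrite (lt_geF (omulrn_gt0 _ x0)).
Qed.

Lemma oltr_pMz2l x (m n : int) : 0 < x -> (x *~ m < x *~ n) = (m < n).
Proof. by move=> x0; rewrite !ltNge oler_pMz2l. Qed.

Definition oabs x := Order.max x (- x).

Lemma oabs_ge0 x : 0 <= oabs x.
Proof.
rewrite /oabs le_max ooppr_ge0; exact: le_total.
Qed.

Lemma ler_oabs x : x <= oabs x. Proof. by rewrite le_max lexx. Qed.

Lemma lerN_oabs x : - x <= oabs x. Proof. by rewrite le_max lexx orbT. Qed.

Lemma oabs_le x y : (oabs x <= y) = (- y <= x <= y).
Proof. by rewrite ge_max andbC -(oler_N2 x (- y)) opprK. Qed.

Lemma oabsN x : oabs (- x) = oabs x.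
Proof. by rewrite /oabs opprK maxC. Qed.

Lemma ger0_oabs x : 0 <= x -> oabs x = x.
Proof.
by move=> x0; apply/max_l/(le_trans _ x0); rewrite -ooppr_ge0 opprK.
Qed.

Lemma ler0_oabs x : x <= 0 -> oabs x = - x.
Proof. by move=> x0; rewrite -oabsN ger0_oabs// ooppr_ge0. Qed.

Lemma oabs_gt0 x : (0 < oabs x) = (x != 0).
Proof.
have [x0|x0|->] := ltgtP x (0 : G); last by rewrite ger0_oabs// ltxx.
  by rewrite ler0_oabs ?ooppr_gt0// ltW.
by rewrite ger0_oabs// ltW.
Qed.

Lemma oabsD x y : oabs (x + y) <= oabs x + oabs y.
Proof.
rewrite oabs_le oler_D ?ler_oabs// andbT opprD.
by rewrite oler_D// -[leRHS]opprK oler_N2 lerN_oabs.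
Qed.

Lemma oabsMn x n : oabs (x *+ n) = oabs x *+ n.
Proof.
have [x0|x0] := leP (0 : G) x; first by rewrite !ger0_oabs// omulrn_ge0.
rewrite -oabsN -mulNrn -[oabs x]oabsN !ger0_oabs// ?omulrn_ge0// ooppr_ge0 ltW//.
Qed.

(* The valuation order: [dom x y] is v(x) >= v(y) and [ll x y] is v(x) > v(y),
   for v the natural valuation. *)
Definition dom x y := exists n, oabs x <= oabs y *+ n.
Definition ll x y := ~ dom y x.

Lemma ll_lt x y n : ll x y -> oabs x *+ n < oabs y.
Proof. by move=> xy; rewrite ltNge; apply/negP => ?; apply: xy; exists n. Qed.

Lemma llP x y : ll x y <-> forall n, oabs x *+ n < oabs y.
Proof.
split=> [xy n|xy [n]]; first exact: ll_lt.
by rewrite leNgt xy.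
Qed.

Lemma dom_ll x y : dom x y \/ ll y x.
Proof. by have [|] := pselect (dom x y); [left|right]. Qed.

Lemma dom_refl x : dom x x.
Proof. by exists 1. Qed.

Lemma dom_le x y : oabs x <= oabs y -> dom x y.
Proof. by exists 1; rewrite mulr1n. Qed.

Lemma dom_pos x y n : 0 <= x -> x <= y *+ n -> dom x y.
Proof.
move=> x0 xy; exists n; rewrite ger0_oabs//; apply: (le_trans xy).
exact/oler_wMn2r/ler_oabs.
Qed.

Lemma dom_trans y x z : dom x y -> dom y z -> dom x z.
Proof.
move=> [m xy] [n yz]; exists (n * m)%N; apply: (le_trans xy).
by rewrite mulrnA; apply: oler_wMn2r.
Qed.

Lemma dom_total x y : dom x y \/ dom y x.
Proof.
have [|/ltW] := leP (oabs x) (oabs y); first by left; apply: dom_le.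
by right; apply: dom_le.
Qed.

Lemma dom0 y : dom 0 y.
Proof. by exists 0; rewrite mulr0n /oabs oppr0 maxxx. Qed.

Lemma domN x y : dom (- x) y <-> dom x y.
Proof. by rewrite /dom oabsN. Qed.

Lemma domrN x y : dom x (- y) <-> dom x y.
Proof. by rewrite /dom oabsN. Qed.

Lemma domD x y z : dom x z -> dom y z -> dom (x + y) z.
Proof.
move=> [m xz] [n yz]; exists (m + n)%N; rewrite mulrnDr.
exact: (le_trans (oabsD _ _) (oler_D xz yz)).
Qed.

Lemma domB x y z : dom x z -> dom y z -> dom (x - y) z.
Proof. by move=> xz /domN; apply: domD. Qed.

Lemma domMn x n : dom (x *+ n) x.
Proof. by exists n; rewrite oabsMn. Qed.

Lemma dom_divn x n : (0 < n)%N -> dom x (x *+ n).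
Proof.
move=> n0; exists 1; rewrite oabsMn mulr1n -{1}[oabs x]mulr1n.
by apply: oler_wpMn2l => //; apply: oabs_ge0.
Qed.

Lemma domMz x (n : int) : dom (x *~ n) x.
Proof.
case: n => n; rewrite ?NegzE ?mulrNz -pmulrn; first exact: domMn.
by apply/domN/domMn.
Qed.

Lemma dom_llt y x z : dom x y -> ll y z -> ll x z.
Proof. by move=> xy yz zx; apply: yz; apply: dom_trans zx xy. Qed.

Lemma ll_domt y x z : ll x y -> dom y z -> ll x z.
Proof. by move=> xy yz zx; apply: xy; apply: dom_trans yz zx. Qed.

Lemma ll_dom x y : ll x y -> dom x y.
Proof. by case: (dom_total x y). Qed.

Lemma ll_trans y x z : ll x y -> ll y z -> ll x z.
Proof. by move=> /ll_dom; apply: dom_llt. Qed.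

Lemma ll_irr x : ~ ll x x.
Proof. by move=> /(_ (dom_refl x)). Qed.

Lemma ll_neq0 x y : ll x y -> y != 0.
Proof. by move=> xy; apply/eqP => y0; apply: xy; rewrite y0; apply: dom0. Qed.

Lemma ll0 y : y != 0 -> ll 0 y.
Proof.
rewrite -oabs_gt0 => y0 [n]; rewrite {2}/oabs oppr0 maxxx mul0rn leNgt.
by rewrite y0.
Qed.

Lemma dom_eq0 x : dom x 0 -> x = 0.
Proof. by move=> x0; apply/eqP/negPn/negP => /ll0; apply. Qed.

Lemma llD x y z : ll x z -> ll y z -> ll (x + y) z.
Proof.
move=> xz yz; have [xy|yx] := dom_total x y.
  by apply: (dom_llt _ yz); apply: domD => //; apply: dom_refl.
by apply: (dom_llt _ xz); apply: domD => //; apply: dom_refl.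
Qed.

Lemma llN x y : ll (- x) y <-> ll x y.
Proof. by rewrite /ll /dom oabsN. Qed.

Lemma llrN x y : ll x (- y) <-> ll x y.
Proof. by rewrite /ll /dom oabsN. Qed.

(** Otherwise [x] would be the sum of [x - y] and [y], both of strictly larger value. With [ll_domB]
    this shows that [x] and [y] have the same value. *)
Lemma dom_llB x y : ll (x - y) x -> dom x y.
Proof.
move=> xy; have [//|yx] := dom_ll x y.
by case: (@ll_irr x); rewrite -{1}(subrK y x); apply: llD.
Qed.

Lemma ll_domB x y : ll (x - y) x -> dom y x.
Proof.
move=> xy; rewrite -[y](subKr x); apply: domB; first exact: dom_refl.
exact: ll_dom.
Qed.

Lemma llr_abs x y : ll x (oabs y) <-> ll x y.
Proof. by rewrite /ll /dom [oabs (oabs y)]ger0_oabs ?oabs_ge0. Qed.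

Lemma dom_absr x y : dom x (oabs y) <-> dom x y.
Proof. by rewrite /dom [oabs (oabs y)]ger0_oabs ?oabs_ge0. Qed.

Lemma dom_abs x y : dom (oabs x) y <-> dom x y.
Proof. by rewrite /dom [oabs (oabs x)]ger0_oabs ?oabs_ge0. Qed.

(** If [|y| <= n|x|] for some [n], the bound [2n|x| <= |y|] yields [2|y| <= |y|]. *)
Lemma ll_le x y : y != 0 -> (forall n, oabs x *+ n <= oabs y) -> ll x y.
Proof.
rewrite -oabs_gt0 => y0 xy; apply/llP => n; rewrite ltNge; apply/negP => yx.
have := xy (n * 2)%N; rewrite mulrnA => /(le_trans (oler_wMn2r 2 yx)) h.
suff : oabs y <= 0 by rewrite leNgt y0.
by apply: (ole_by h); abel.
Qed.

Lemma ll_ltr x y : ll x y -> 0 <= y -> x < y.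
Proof.
move=> xy y0; apply: (le_lt_trans (ler_oabs x)).
by have := ll_lt 1 xy; rewrite mulr1n (ger0_oabs y0).
Qed.

Lemma ll_Nltr x y : ll x y -> 0 <= y -> - y < x.
Proof.
by move=> xy y0; rewrite -oltr_N2 opprK; apply: ll_ltr => //; apply/llN.
Qed.

Lemma ll_sgn x y : ll (x - y) y -> (0 < x) = (0 < y).
Proof.
move=> xy; have [y0|y0|y0] := ltgtP y (0 : G).
- apply/negbTE; rewrite -leNgt; move/llrN: xy => /ll_ltr.
  rewrite ooppr_ge0 => /(_ (ltW y0)) /ltW h.
  by apply: (ole_by h); abel.
- have := ll_Nltr xy (ltW y0) => h.
  by apply: (olt_by h); abel.
- by move: (ll_neq0 xy); rewrite y0 eqxx.
Qed.

End OrderedGroup.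

(** * Symmetrically complete orders *)

(* The partial transversals of F whose members pairwise differ at every S in F
   have a maximal element Z; the evaluation of Z at some S in F is onto, while
   it is injective at every S in F. *)
Lemma min_card_exists (T : Type) (F : set (set T)) : F !=set0 ->
  exists2 S, F S & forall S', F S' -> (S #<= S')%card.
Proof.
move=> [S0 FS0].
pose trans (Z : set (set T -> T)) :=
  (forall h S, Z h -> F S -> S (h S)) /\
  (forall h h' S, Z h -> Z h' -> F S -> h S = h' S -> h = h').
have [|Z [[Zin Zinj] Zmax]] := @Zorn_bigcup _ trans.
  move=> C Ctr Ctot; split=> [h S [Z CZ Zh] FS|h h' S [Z CZ Zh] [Z' CZ' Zh'] FS].
    by have [h1 _] := Ctr _ CZ; exact: (h1 h S Zh FS).
  have [ZZ'|Z'Z] := Ctot _ _ CZ CZ'.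
    by have [_ h1] := Ctr _ CZ'; apply: h1 FS => //; apply: ZZ'.
  by have [_ h1] := Ctr _ CZ; apply: h1 FS => //; apply: Z'Z.
(* If every evaluation missed a point, the missed points would be the values of a function that
   could be added to [Z]. *)
have [S [FS Sonto]] :
    exists S, F S /\ forall s, S s -> exists2 h, Z h & h S = s.
  apply: contrapT => Nonto.
  have miss S : F S -> exists2 s, S s & forall h, Z h -> h S <> s.
    move=> FS; apply: contrapT => Nmiss; apply: Nonto; exists S; split=> // s Ss.
    apply: contrapT => Nh; apply: Nmiss; exists s => // h Zh hs.
    by apply: Nh; exists h.
  have [s0 Ss0 _] := miss _ FS0.
  have [h0 h0P] : {h0 : set T -> T & forall S, F S ->
      S (h0 S) /\ forall h, Z h -> h S <> h0 S}.
    apply: (@choice _ _ (fun S s => F S -> S s /\ forall h, Z h -> h S <> s)) => S.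
  have [/miss[s Ss sh]|] := pselect (F S).
      by exists s.
    by exists s0.
  have NZh0 : ~ Z h0 by move=> Zh0; have [_ /(_ _ Zh0)] := h0P _ FS0.
  apply: (Zmax (Z `|` [set h0])).
    split; first by left.
    by move=> /(_ h0); apply: contra_not NZh0 => /(_ (or_intror erefl)).
  split=> [h S [Zh|->] FS|h h' S [Zh|->] [Zh'|->] FS //]; first exact: (Zin h S).
  - by have [] := h0P _ FS.
  - exact: Zinj.
  - by have [_ /(_ _ Zh)] := h0P _ FS.
  - by have [_ /(_ _ Zh')/[swap] ->] := h0P _ FS.
exists S => // S' FS'; apply: (@card_le_trans _ _ _ Z).
  apply: card_le_trans (card_image_le (fun h => h S) Z).
  by apply: subset_card_le => s /Sonto[h Zh <-]; exists h.
have Zinj' : {in Z &, injective (fun h => h S')}.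
  by move=> h h' /set_mem Zh /set_mem Zh'; apply: Zinj.
rewrite -(card_le_eql (inj_card_eq Zinj')); apply: subset_card_le.
by move=> _ [h Zh <-]; exact: (Zin h S').
Qed.

Section Nests.
Context {d : Order.disp_t} {T : orderType d}.
Implicit Types (D E B : set T).

(* f and g reflect D and E into each other through the cut (D, E), up to
   passing to elements close enough to the cut. *)
Definition mirrored D E (f g : T -> T) :=
  [/\ forall x, D x -> E (f x), forall y, E y -> D (g y),
      forall y, E y -> exists2 x0, D x0 & forall x, D x -> (x0 <= x)%O -> (f x <= y)%O &
      forall x, D x -> exists2 y0, E y0 & forall y, E y -> (y <= y0)%O -> (x <= g y)%O].

Definition mirror_free := forall D E, is_cut D E -> forall f g, ~ mirrored D E f g.

(** A reflection carries a cofinal subset of one side to a cofinal subset of the other. Cofinal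
    subsets of least cardinality on the two sides are therefore equipotent, by Cantor-Bernstein. *)
Lemma symmetrically_complete_mirror_free :
  symmetrically_complete T -> mirror_free.
Proof.
move=> symT D E DE f g [fE gD fle gle].
have [|S cofS Smin] := @min_card_exists _ [set S | cofinal_in <=%O D S].
  by exists D; split=> // x Dx; exists x.
have [|S' cofS' S'min] := @min_card_exists _ [set S | cofinal_in >=%O E S].
  by exists E; split=> [y|x Ex]; [|exists x => //; exact: lexx].
apply: (negP (symT _ _ DE _ _ (conj cofS Smin) (conj cofS' S'min))).
case: cofS cofS' => SD Scof [S'E S'cof].
apply: Cantor_Bernstein.
  apply: card_le_trans (card_image_le g S'); apply: Smin; split.
    by move=> _ [y /S'E Ey <-]; apply: gD.
  move=> x /gle[y0 Ey0 gle0]; have [y S'y y_le] := S'cof _ Ey0.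
  by exists (g y); [exists y|apply: gle0 => //; apply: S'E].
apply: card_le_trans (card_image_le f S); apply: S'min; split.
  by move=> _ [x /SD Dx <-]; apply: fE.
move=> y /fle[x0 Dx0 fle0]; have [x Sx x_le] := Scof _ Dx0.
by exists (f x); [exists x|apply: fle0 => //; apply: SD].
Qed.

(* If the intersection were empty, the elements below some B and those above
   some B would form a cut; each B contains elements of both sides, so sending
   an element that lies below B to one of B that lies above a smaller member is
   a reflection. *)
Lemma mirror_free_nest (F : set (set T)) : mirror_free -> F !=set0 ->
  (forall B x y z, F B -> B x -> B z -> (x <= y <= z)%O -> B y) ->
  (forall B C, F B -> F C -> B `<=` C \/ C `<=` B) ->
  (forall B, F B -> exists C, [/\ F C,
     exists2 x, B x & forall y, C y -> (x < y)%O &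
     exists2 x, B x & forall y, C y -> (y < x)%O]) ->
  exists z, forall B, F B -> B z.
Proof.
move=> mfT [B0 FB0] Fconv Ftot Fshrink; apply: contrapT => Nz.
pose D x := exists2 B, F B & forall y, B y -> (x < y)%O.
pose E x := exists2 B, F B & forall y, B y -> (y < x)%O.
have lower B : F B -> exists2 x, B x & D x.
  by move=> /Fshrink[C [FC [x Bx xC] _]]; exists x => //; exists C.
have upper B : F B -> exists2 x, B x & E x.
  by move=> /Fshrink[C [FC _ [x Bx xC]]]; exists x => //; exists C.
have common B C : F B -> F C -> exists2 b, B b & C b.
  move=> FB FC; have [b Bb _] := lower _ FB; have [c Cc _] := lower _ FC.
  by have [BC|CB] := Ftot _ _ FB FC; [exists b|exists c] => //; [exact: BC|exact: CB].
have DE : is_cut D E.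
  split.
  - by have [x _ Dx] := lower _ FB0; exists x.
  - by have [x _ Ex] := upper _ FB0; exists x.
  - apply/seteqP; split=> // x _; apply: contrapT => NDE; apply: Nz; exists x.
    move=> B FB; apply: contrapT => NBx; apply: NDE.
    have [NxB|xB] := pselect (forall y, B y -> (x < y)%O); first by left; exists B.
    have [NBx'|Bx] := pselect (forall y, B y -> (y < x)%O); first by right; exists B.
    move: xB Bx => /existsNP[y /not_implyP[By /negP]].
    rewrite -leNgt => yx /existsNP[z /not_implyP[Bz /negP]].
    by rewrite -leNgt => xz; case: NBx; apply: (Fconv B y x z); rewrite ?yx.
  - move=> x y [B FB xB] [C FC yC]; have [b Bb Cb] := common _ _ FB FC.
    exact: lt_trans (xB _ Bb) (yC _ Cb).
have /choice[f fP] x : exists z, D x ->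
    E z /\ exists B, [/\ F B, B z & forall y, B y -> (x < y)%O].
  have [[B FB xB]|] := pselect (D x); last by exists x.
  by have [y By Ey] := upper _ FB; exists y => _; split=> //; exists B.
have /choice[g gP] x : exists z, E x ->
    D z /\ exists B, [/\ F B, B z & forall y, B y -> (y < x)%O].
  have [[B FB xB]|] := pselect (E x); last by exists x.
  by have [y By Dy] := lower _ FB; exists y => _; split=> //; exists B.
apply: (mfT D E DE f g); split.
- by move=> x /fP[].
- by move=> x /gP[].
- move=> y [C FC Cy]; have [x0 Cx0 Dx0] := lower _ FC; exists x0 => // x Dx x0x.
  have [_ [B [FB Bfx xB]]] := fP _ Dx.
  have [b Bb Cb] := common _ _ FB FC.
  (* [x] lies in [C] and below all of [B], so [C] is not contained in [B]. Hence [f x] is in [C],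
     all of which lies below [y]. *)
  have Cx : C x by apply: (Fconv C x0 x b) => //; rewrite x0x ltW// xB.
  have [BC|CB] := Ftot _ _ FB FC; first exact/ltW/Cy/BC.
  by have := xB _ (CB _ Cx); rewrite ltxx.
- move=> x [C FC xC]; have [y0 Cy0 Ey0] := upper _ FC; exists y0 => // y Ey yy0.
  have [_ [B [FB Bgy yB]]] := gP _ Ey.
  have [b Bb Cb] := common _ _ FB FC.
  have Cy : C y by apply: (Fconv C b y y0) => //; rewrite yy0 ltW// yB.
  have [BC|CB] := Ftot _ _ FB FC; first exact/ltW/xC/BC.
  by have := yB _ (CB _ Cy); rewrite ltxx.
Qed.

End Nests.

Arguments mirror_free {d} T.

(** * Spherical completeness and complete components *)

Section Completeness.
Variable G : orderedZmodType.
Implicit Types (a b r s t x y z : G).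

(** [X a r] says that the ball with centre [a] and the value of [r] as radius belongs to a nest. The
    nests considered have no smallest ball; a smallest ball would contain its own centre as a common
    point. *)
Definition spherically_complete := forall X : G -> G -> Prop,
  (forall a r b s, X a r -> X b s -> dom r s -> dom (a - b) s) ->
  (forall a r, X a r -> exists b s, X b s /\ ll s r) ->
  exists z, forall a r, X a r -> dom (z - a) r.

(* [m k] stands for the integer part of 2^k rho, with rho a real number; the
   element z then behaves like rho a. *)
Definition binary_expansion (m : nat -> int) :=
  forall k, m k * 2 <= m k.+1 <= m k * 2 + 1.

(** The slack of one unit on either side of [[m k, m k + 1]] makes room for later intervals to lie
    strictly inside earlier ones. *)
Definition components_complete := forall a (m : nat -> int), 0 < a ->
  binary_expansion m ->
  exists z, forall k, a *~ (m k - 1) <= z *+ 2 ^ k <= a *~ (m k + 2).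

Lemma dom_convex a r x y z : dom (x - a) r -> dom (z - a) r -> x <= y <= z ->
  dom (y - a) r.
Proof.
move=> [m xr] [n zr] /andP[xy yz]; exists (m + n)%N; rewrite oabs_le.
move: xr zr; rewrite !oabs_le => /andP[xr _] /andP[_ zr].
apply/andP; split.
  apply: le_trans (_ : x - a <= _); last by rewrite oler_D2r.
  apply: le_trans xr; rewrite oler_N2 oler_wpMn2l ?leq_addr//; exact: oabs_ge0.
apply: (@le_trans _ _ (z - a)); first by rewrite oler_D2r.
by apply: (le_trans zr); rewrite oler_wpMn2l ?leq_addl//; exact: oabs_ge0.
Qed.

(** Balls are convex, and if [s] is infinitely smaller than [r], the points [b - |r|] and [b + |r|]
    lie in the ball of [a] and [r] on either side of the whole ball of [b] and [s]. *)
Lemma mirror_free_spherically_complete :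
  mirror_free G -> spherically_complete.
Proof.
move=> mfG X Xcompat Xshrink.
have [[a0 [r0 X0]]|X0] := pselect (exists a r, X a r); last first.
  by exists 0 => a r Xar; case: X0; exists a, r.
pose F B := exists a r, X a r /\ B = [set x | dom (x - a) r].
have [||||z zF] := @mirror_free_nest _ G F mfG.
- by exists [set x | dom (x - a0) r0], a0, r0.
- by move=> _ x y z [a [r [Xar ->]]] /= xr zr; apply: dom_convex.
- move=> _ _ [a [r [Xar ->]]] [b [s [Xbs ->]]] /=.
  have [rs|sr] := dom_total r s; [left|right] => x /= xa.
    rewrite -(subrK a x) -addrA; apply: domD; first exact: dom_trans xa rs.
    exact: Xcompat Xar Xbs rs.
  rewrite -(subrK b x) -addrA; apply: domD; first exact: dom_trans xa sr.
  exact: Xcompat Xbs Xar sr.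
- move=> _ [a [r [Xar ->]]]; have [b [s [Xbs sr]]] := Xshrink _ _ Xar.
  exists [set x | dom (x - b) s]; split; first by exists b, s.
    have ba : dom (b - a) r by exact: Xcompat Xbs Xar (ll_dom sr).
    exists (b - oabs r) => /=.
      by rewrite addrAC; apply: domB => //; apply/dom_abs/dom_refl.
    move=> y /= yb; have /llr_abs/ll_Nltr /(_ (oabs_ge0 _)) h := dom_llt yb sr.
    by apply: (olt_by h); abel.
  have ba : dom (b - a) r by exact: Xcompat Xbs Xar (ll_dom sr).
  exists (b + oabs r) => /=.
    by rewrite addrAC; apply: domD => //; apply/dom_abs/dom_refl.
  move=> y /= yb; have /llr_abs/ll_ltr /(_ (oabs_ge0 _)) h := dom_llt yb sr.
  by apply: (olt_by h); abel.
exists z => a r Xar; apply: (zF [set x | dom (x - a) r]).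
by exists a, r.
Qed.

(** Otherwise every [x] would satisfy [D x] or [D (a - x)], where [D] consists of the elements all
    of whose multiples are at most [a]. This is a cut, reflected into itself by [x] going to
    [a - x]. *)
Lemma mirror_free_dense a : mirror_free G -> 0 < a ->
  exists u, [/\ 0 < u, u *+ 2 <= a & dom a u].
Proof.
move=> mfG a0; apply: contrapT => Nu.
pose D x := forall n, x *+ n <= a.
have big x : ~ D x -> 0 < x /\ dom a x.
  move=> /existsNP[n /negP]; rewrite -ltNge => ax.
  have x0 : 0 < x.
    rewrite ltNge; apply/negP => /(oler_wMn2r n); rewrite mul0rn => xn0.
    by move: (lt_trans a0 (lt_le_trans ax xn0)); rewrite ltxx.
  by split=> //; apply: (@dom_pos _ _ _ n); rewrite ltW.
have D0 : D 0 by move=> n; rewrite mul0rn ltW.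
apply: (mfG D [set x | D (a - x)] _ (fun x => a - x) (fun x => a - x)).
  split; [by exists 0|by exists a; rewrite /= subrr| |].
    apply/seteqP; split=> // x _ /=; apply: contrapT => /not_orP[Dx Dax].
    have [[x0 ax] [ax0 aax]] := (big _ Dx, big _ Dax).
    have [le_x|/ltW x_le] := leP x (a - x); apply: Nu.
      exists x; split=> //; apply: (ole_by le_x); abel.
    by exists (a - x); split=> //; apply: (ole_by x_le); abel.
  move=> x y Dx /= Dy; rewrite ltNge; apply/negP => yx.
  (* From [3x <= a], [3(a - y) <= a] and [y <= x] follows [3a <= 2a]. *)
  have := oler_D (oler_D (Dx 3) (Dy 3)) (oler_wMn2r 3 yx) => h.
  suff : a <= 0 by rewrite leNgt a0.
  by apply: (ole_by h); abel.
split.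
- by move=> x /=; rewrite subKr.
- by [].
- by move=> y /= Dy; exists (a - y) => // x Dx h; apply: (ole_by h); abel.
- move=> x Dx; exists (a - x); first by rewrite /= subKr.
  by move=> y Dy h; apply: (ole_by h); abel.
Qed.

Lemma dense_fraction a k : mirror_free G -> 0 < a ->
  exists u, [/\ 0 < u, u *+ k <= a & dom a u].
Proof.
move=> mfG a0; suff [u [u0 ua au]] :
    exists u, [/\ 0 < u, u *+ 2 ^ k <= a & dom a u].
  exists u; split=> //; apply: le_trans ua; apply: oler_wpMn2l; first exact: ltW.
  by rewrite ltnW// ltn_expl.
elim: k => [|k [u [u0 ua au]]]; first by exists a; split => //; apply: dom_refl.
have [w [w0 wu uw]] := mirror_free_dense mfG u0.
exists w; split=> //; last exact: dom_trans au uw.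
by rewrite expnS mulrnA (le_trans _ ua)// oler_wMn2r.
Qed.

Lemma int_jump (Q : int -> Prop) (i j : int) : Q i -> ~ Q j -> i <= j ->
  exists2 k, Q k & ~ Q (k + 1).
Proof.
move=> Qi NQj ij; apply: contrapT => Nk; apply: NQj.
have {ij}-> : j = i + (`|j - i|%N : int) by lia.
elim: `|j - i|%N => [|n IH]; first by rewrite addr0.
apply: contrapT => NQ; apply: Nk; exists (i + n) => //.
by have -> : i + n%:Z + 1 = i + n.+1 by lia.
Qed.

Lemma ofloor u y : 0 < u -> dom y u -> exists k : int, u *~ k <= y < u *~ (k + 1).
Proof.
move=> u0 [n]; rewrite (ger0_oabs (ltW u0)) oabs_le => /andP[yn ny].
have [|||k Qk NQk] := @int_jump (fun k => u *~ k <= y) (- n%:Z) (n.+1).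
- by rewrite mulrNz -pmulrn.
- apply/negP; rewrite -ltNge -pmulrn mulrS.
  by apply: (le_lt_trans ny); rewrite -osubr_gt0 addrK.
- lia.
by exists k; rewrite Qk ltNge; apply/negP.
Qed.

(** For [u] with [N u <= a], the multiples of [N u] form a grid of mesh at most [a], so one of them
    falls into the given interval. *)
Lemma dense_approx a N (m : int) : mirror_free G -> (0 < N)%N -> 0 < a ->
  exists x, a *~ (m - 1) < x *+ N <= a *~ m.
Proof.
move=> mfG N0 a0; have [u [u0 ua au]] := dense_fraction N mfG a0.
have [||k /andP[ku uk]] := @ofloor (u *+ N) (a *~ m).
- by rewrite omulrn_gt0.
- by apply: dom_trans (domMz _ _) _; apply: dom_trans au _; apply: dom_divn.
exists (u *~ k); have -> : u *~ k *+ N = u *+ N *~ k by abel.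
rewrite ku andbT.
have h := oltr_D uk ua.
by apply: (olt_by h); abel.
Qed.

Lemma binary_expansionP m k j : binary_expansion m ->
  m k * (2 ^ j)%N <= m (j + k)%N < (m k + 1) * (2 ^ j)%N.
Proof.
move=> mP; elim: j => [|j]; first by rewrite !mulr1 lexx ltrDl.
by rewrite addSn; have := mP (j + k)%N; rewrite expnS; lia.
Qed.

Lemma mirror_free_components_complete :
  mirror_free G -> components_complete.
Proof.
move=> mfG a m a0 mP.
pose B k : set G := [set x | a *~ (m k - 1) <= x *+ 2 ^ k <= a *~ (m k + 2)].
have BE k j : B k = [set x | a *~ ((m k - 1) * (2 ^ j)%N) <= x *+ 2 ^ (j + k) <=
                             a *~ ((m k + 2) * (2 ^ j)%N)].
  apply/funext => x; rewrite /B /= !mulrzA -!pmulrn addnC expnD mulrnA.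
  by rewrite !oler_pMn2r// expn_gt0.
have Bmono k j : B (j + k)%N `<=` B k.
  move=> x; rewrite (BE k j) /B /= => /andP[ax xa].
  have := binary_expansionP k j mP => mkj; have : (0 < 2 ^ j)%N by rewrite expn_gt0.
  move=> j0; rewrite (le_trans _ ax) ?(le_trans xa)// oler_pMz2l//; nia.
have [||||z zF] := @mirror_free_nest _ G [set B k | k in [set: nat]] mfG.
- by exists (B 0%N), 0%N.
- move=> _ x y z [k _ <-] /andP[ax _] /andP[_ za] /andP[xy yz].
  by rewrite /B /= (le_trans ax) ?(le_trans _ za)// oler_wMn2r.
- move=> _ _ [k _ <-] [j _ <-].
  by have [/subnK <-|/ltnW/subnK <-] := leqP k j; [right|left].
(* In units of [a] divided by [2 ^ (3 + k)], and with [m = m k], the interval [B k] is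
   [[8m - 8, 8m + 16]], while [B (3 + k)] lies in [[8m - 1, 8m + 9]]. The points chosen near
   [8m - 3] and [8m + 11] fall into the gaps. *)
- move=> _ [k _ <-]; exists (B (3 + k)%N); split; first by exists (3 + k)%N.
  - have [||x /andP[ax xa]] := @dense_approx a (2 ^ (3 + k)) (m k * 8 - 3) mfG.
    + by rewrite expn_gt0.
    + by [].
    exists x.
      rewrite (BE k 3) /= (le_trans _ (ltW ax)) ?(le_trans xa)// oler_pMz2l//; lia.
    move=> y /andP[ay _]; rewrite -(@oltr_pMn2r _ (2 ^ (3 + k))) ?expn_gt0//.
    apply: le_lt_trans xa _; apply: lt_le_trans ay; rewrite oltr_pMz2l//.
    have := binary_expansionP k 3 mP; lia.
  - have [||x /andP[ax xa]] := @dense_approx a (2 ^ (3 + k)) (m k * 8 + 11) mfG.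
    + by rewrite expn_gt0.
    + by [].
    exists x.
      rewrite (BE k 3) /= (le_trans _ (ltW ax)) ?(le_trans xa)// oler_pMz2l//; lia.
    move=> y /andP[_ ya]; rewrite -(@oltr_pMn2r _ (2 ^ (3 + k))) ?expn_gt0//.
    apply: le_lt_trans ya _; apply: lt_trans ax; rewrite oltr_pMz2l//.
    have := binary_expansionP k 3 mP; lia.
by exists z => k; apply: (zF (B k)); exists k.
Qed.

(** [s] realizes the binary expansion of [1/n] times [y]. The error [e] of [s *+ n] satisfies
    [2 ^ K e <= 2 n y] for all [K], hence is infinitely smaller than [y]. *)
Lemma components_divisible n y : components_complete -> (0 < n)%N -> y != 0 ->
  exists s, ll (y - s *+ n) y.
Proof.
move=> cG n0; wlog y0 : y / 0 < y => [wlg|_].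
  have [y0 _|y0 _|//] := ltgtP y 0.
    have [||s sP] := wlg (- y); rewrite ?ooppr_gt0 ?oppr_eq0 ?(lt_eqF y0)//.
    exists (- s); apply/llN/llrN; suff -> : - (y - - s *+ n) = - y - s *+ n by [].
    abel.
  by apply: wlg => //; rewrite gt_eqF.
pose m k : int := (2 ^ k %/ n)%N.
have mP : binary_expansion m.
  move=> k; rewrite /m expnS.
  have := divn_eq (2 ^ k) n; have := ltn_pmod (2 ^ k) n0.
  have := divn_eq (2 * 2 ^ k) n; have := ltn_pmod (2 * 2 ^ k) n0.
  nia.
have [s sP] := cG _ _ y0 mP; exists s.
apply: ll_le => [|j]; first by rewrite gt_eqF.
rewrite (ger0_oabs (ltW y0)) -(@oler_pMn2r _ (2 * n)) ?muln_gt0//.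
(* As [2 ^ K] exceeds [K = 2nj], the estimate at [K] gives [2nj e <= 2n y], from which [2n]
   cancels. *)
set e := oabs _; pose K := (2 * n * j)%N.
have eK : e *+ 2 ^ K <= y *+ (2 * n).
  have mnK : (2 ^ K)%N%:Z - n%:Z <= m K * n%:Z <= (2 ^ K)%N%:Z.
    rewrite /m; have := divn_eq (2 ^ K) n; have := ltn_pmod (2 ^ K) n0; lia.
  have /andP[ys sy] := sP K.
  have {}ys : y *~ ((2 ^ K)%N%:Z - 2 * n%:Z) <= s *+ n *+ 2 ^ K.
    apply: le_trans (_ : y *~ ((m K - 1) * n) <= _); first by rewrite oler_pMz2l//; lia.
    by rewrite mulrzA -pmulrn mulrnAC oler_wMn2r.
  have {}sy : s *+ n *+ 2 ^ K <= y *~ ((2 ^ K)%N%:Z + 2 * n%:Z).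
    apply: le_trans (_ : _ <= y *~ ((m K + 2) * n)) _; last by rewrite oler_pMz2l//; lia.
    by rewrite mulrzA -pmulrn mulrnAC oler_wMn2r.
  rewrite -oabsMn oabs_le; apply/andP; split.
    by apply: (ole_by sy); rewrite !pmulrn; abel.
  by apply: (ole_by ys); rewrite !pmulrn; abel.
apply: le_trans eK; rewrite -mulrnA mulnC; apply: oler_wpMn2l; first exact: oabs_ge0.
by rewrite ltnW// ltn_expl.
Qed.

End Completeness.

(** Successive approximation: if [y] were not attained, the pairs of an [x] and a correction [s]
    that makes [y - f x] infinitely smaller would give a nest of balls without smallest member. *)
Lemma spherically_complete_surj (G H : orderedZmodType) (f : G -> H) :
  spherically_complete G -> {morph f : x y / x - y} ->
  (forall x y, dom (f x) (f y) <-> dom x y) ->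
  (forall y, y != 0 -> exists s, ll (y - f s) y) -> forall y, exists x, f x = y.
Proof.
move=> sG fB fdom fapprox y; apply: contrapT => Ny.
have fll s r : ll (f s) (f r) -> ll s r by move=> sr /fdom.
have fD x s : f (x + s) = f x + f s.
  have f0 : f 0 = 0 by rewrite -(subrr (0 : G)) fB subrr.
  have fN : f (- s) = - f s by rewrite -sub0r fB f0 sub0r.
  by rewrite -{1}[s]opprK fB fN opprK.
have step x : exists s, ll (y - f (x + s)) (y - f x).
  have [|s sP] := fapprox (y - f x).
    by rewrite subr_eq0; apply/eqP => e; apply: Ny; exists x.
  by exists s; rewrite fD opprD addrA.
have bal x s : ll (y - f (x + s)) (y - f x) ->
    dom (y - f x) (f s) /\ dom (f s) (y - f x).
  by rewrite fD opprD addrA => xs; split; [exact: dom_llB|exact: ll_domB].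
have [||z zP] := sG (fun x s => ll (y - f (x + s)) (y - f x)).
- move=> x s x' s' /bal[xs _] /bal[x's' _] /fdom ss'.
  apply/fdom; rewrite fB.
  have -> : f x - f x' = (y - f x') - (y - f x) by abel.
  by apply: domB => //; apply: dom_trans xs ss'.
- move=> x s xs; have [s' xs'] := step (x + s); exists (x + s), s'; split=> //.
  apply: fll; apply: (dom_llt (bal _ _ xs').2).
  exact: ll_domt xs (bal _ _ xs).1.
(* The common point [z] is corrected twice. It lies in the ball of [z + s] and [s'], which bounds
   [s] by a multiple of [s'], although the second correction is infinitely smaller than the
   first. *)
have [s zs] := step z; have [s' zs'] := step (z + s).
have := zP _ _ zs'; rewrite opprD addrA subrr sub0r => /domN /fdom ss'.
apply: (@ll_irr _ (y - f z)); apply: (dom_llt (bal _ _ zs).1).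
by apply: (dom_llt ss'); apply: (dom_llt (bal _ _ zs').2).
Qed.

Lemma complete_divisible (G : orderedZmodType) :
  spherically_complete G -> components_complete G -> divisible G.
Proof.
move=> sG cG n x n0; move: x; apply: spherically_complete_surj => //.
- by move=> x y; apply: mulrnBl.
- move=> x y; split=> xy.
    by apply: dom_trans (dom_divn x n0) _; apply: dom_trans xy (domMn _ _).
  by apply: dom_trans (domMn _ _) _; apply: dom_trans xy (dom_divn y n0).
- by move=> y y0; apply: components_divisible.
Qed.

(** * Order isomorphisms between subgroups *)

Section Matchings.
Variables (G H : orderedZmodType) (P : G -> H -> Prop).

(* P is the graph of an isomorphism between ordered subgroups of G and H. *)
Definition matching :=
  [/\ P 0 0, forall a b c d, P a b -> P c d -> P (a - c) (b - d) &
      forall a b, P a b -> (0 < a) = (0 < b)].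

Hypothesis mP : matching.

Lemma matching0 : P 0 0. Proof. by case: mP. Qed.

Lemma matchingB a b c d : P a b -> P c d -> P (a - c) (b - d).
Proof. by case: mP => _ + _; apply. Qed.

Lemma matching_sgn a b : P a b -> (0 < a) = (0 < b).
Proof. by case: mP => _ _; apply. Qed.

Lemma matchingN a b : P a b -> P (- a) (- b).
Proof. by move=> /(matchingB matching0); rewrite !sub0r. Qed.

Lemma matchingD a b c d : P a b -> P c d -> P (a + c) (b + d).
Proof. by move=> ab /matchingN /(matchingB ab); rewrite !opprK. Qed.

Lemma matchingMn a b n : P a b -> P (a *+ n) (b *+ n).
Proof.
move=> ab; elim: n => [|n IH]; first exact: matching0.
by rewrite !mulrS; apply: matchingD.
Qed.

Lemma matchingMz a b (n : int) : P a b -> P (a *~ n) (b *~ n).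
Proof.
case: n => n ab; rewrite ?NegzE ?mulrNz -?pmulrn; first exact: matchingMn.
exact/matchingN/matchingMn.
Qed.

Lemma matching_lt a b c d : P a b -> P c d -> (a < c) = (b < d).
Proof.
by move=> ab cd; rewrite -osubr_gt0 -[RHS]osubr_gt0; apply/matching_sgn/matchingB.
Qed.

Lemma matching_le a b c d : P a b -> P c d -> (a <= c) = (b <= d).
Proof. by move=> ab cd; rewrite !leNgt (matching_lt cd ab). Qed.

Lemma matching_eq a b c d : P a b -> P c d -> (a == c) = (b == d).
Proof. by move=> ab cd; rewrite !eq_le (matching_le ab cd) (matching_le cd ab). Qed.

Lemma matching_abs a b : P a b -> P (oabs a) (oabs b).
Proof.
move=> ab; have [a0|a0] := leP (0 : G) a.
  have b0 : 0 <= b by rewrite -(matching_le matching0 ab).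
  by rewrite !ger0_oabs.
have b0 : b < 0 by rewrite -(matching_lt ab matching0).
by rewrite !ler0_oabs ?(ltW a0) ?(ltW b0)//; apply: matchingN.
Qed.

Lemma matching_dom a b c d : P a b -> P c d -> dom a c <-> dom b d.
Proof.
move=> ab cd; split=> -[n h]; exists n; move: h;
  by rewrite (matching_le (matching_abs ab) (matchingMn n (matching_abs cd))).
Qed.

Lemma matching_ll a b c d : P a b -> P c d -> ll a c <-> ll b d.
Proof.
by move=> ab cd; split=> h /(matching_dom cd ab).
Qed.

(* The set D determines a cut of G with a formal element xi above D, whose
   distance to each a in the domain of P is measured by some t in that domain:
   t <= |xi - a| <= N t.  Either the values of these distances have no
   maximum, and the corresponding nest of balls of H has a common point, or xi - a
   has maximal value for some a and is approximated by the binary expansion of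
   (xi - a) / t. *)
Lemma matching_cut_fill (D : set G) :
  (forall x y, D y -> x <= y -> D x) ->
  (forall a b, P a b -> exists c d, P c d /\ c *+ 2 = a) ->
  (forall a b, P a b -> exists t h, [/\ P t h, 0 < t & exists N : nat,
     (D (a + t) /\ ~ D (a + t *+ N)) \/ (~ D (a - t) /\ D (a - t *+ N))]) ->
  spherically_complete H -> components_complete H ->
  exists z, forall a b, P a b -> (D a -> b < z) /\ (~ D a -> z < b).
Proof.
move=> Dlow half gap sH cH.
have DNlt x y : D x -> ~ D y -> x < y.
  by move=> Dx NDy; rewrite ltNge; apply/negP => /(Dlow _ _ Dx).
pose dist a t := [/\ 0 < t, D a -> D (a + t), ~ D a -> ~ D (a - t) &
  exists N : nat, D (a - t *+ N) /\ ~ D (a + t *+ N)].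
have {}gap a b : P a b -> exists t h, P t h /\ dist a t.
  move=> /gap[t [h [th t0 [N NP]]]]; exists t, h; split=> //.
  have tN : 0 <= t *+ N by rewrite omulrn_ge0 ?ltW.
  have xt x : x <= x + t by rewrite -osubr_ge0 addrC addKr ltW.
  have Dat x : D x -> D (x - t) by move=> /Dlow; apply; rewrite -osubr_ge0 subKr ltW.
  have DtN x : D (x + t *+ N) -> D x.
    by move=> /Dlow; apply; rewrite -osubr_ge0 addrC addKr.
  have DtN' x : D x -> D (x - t *+ N) by move=> /Dlow; apply; rewrite -osubr_ge0 subKr.
  case: NP => -[D1 D2]; split=> //.
  - by move=> NDa _; apply: NDa; apply: (Dlow _ (a + t)).
  - by exists N; split=> //; apply/DtN'/(Dlow _ (a + t)).
  - by move=> /Dat.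
  - by exists N; split=> // /DtN /Dat.
have [shrink|] := pselect (forall a b t h, P a b -> P t h -> dist a t ->
    exists a' b' t' h', [/\ P a' b', P t' h', dist a' t' & ll t' t]).
  have [||z zP] := sH (fun b h => exists a t, [/\ P a b, P t h & dist a t]).
  - move=> b h d u [a [t [ab th [t0 _ _ [N [N1 N2]]]]]].
    move=> [c [s [cd su [s0 _ _ [M [M1 M2]]]]]] /(matching_dom th su) ts.
    apply/(matching_dom (matchingB ab cd) su).
    have sM : dom (t *+ N + s *+ M) s.
      by apply: domD (domMn _ _); apply: dom_trans (domMn _ _) ts.
    apply: dom_trans sM; exists 1; rewrite mulr1n [leRHS]ger0_oabs; last first.
      rewrite -[0]addr0; apply: oler_D; exact/omulrn_ge0/ltW.
    rewrite oabs_le; apply/andP; split.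
      by apply: (ole_by (ltW (DNlt _ _ M1 N2))); abel.
    by apply: (ole_by (ltW (DNlt _ _ N1 M2))); abel.
  - move=> b h [a [t [ab th at_]]].
    have [a' [b' [t' [h' [ab' th' at' tt']]]]] := shrink _ _ _ _ ab th at_.
    by exists b', h'; split; [exists a', t'|apply/(matching_ll th' th)].
  exists z => a b ab; have [t [h [th at_]]] := gap _ _ ab.
  have [a' [b' [t' [h' [ab' th' at' tt']]]]] := shrink _ _ _ _ ab th at_.
  case: at_ (at') => t0 Dat NDat _ [t'0 _ _ [N [N1 N2]]].
  have h'0 : 0 < h' by rewrite -(matching_sgn th').
  have /zP[n] : exists a t, [/\ P a b', P t h' & dist a t].
    by exists a', t'.
  rewrite (ger0_oabs (ltW h'0)) oabs_le => /andP[zb' zb''].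
  (* The cut is within [N t'] of [a'] and [z] within [n h'] of [b']. Since [t] bounds the distance
     of [a] to the cut from below and [h] exceeds [(N + n) h'], the point [z] is on the correct side
     of [b]. *)
  have := ll_lt (N + n) ((matching_ll th' th).1 tt').
  rewrite (ger0_oabs (ltW h'0)) ger0_oabs -?(matching_le matching0 th) ?(ltW t0)// => hh.
  split=> Da.
    have := DNlt _ _ (Dat Da) N2.
    rewrite (matching_lt (matchingD ab th) (matchingD ab' (matchingMn N th'))) => lt1.
    by apply: (olt_by (oltr_D lt1 (oler_D zb' (ltW hh)))); abel.
  have := DNlt _ _ N1 (NDat Da).
  rewrite (matching_lt (matchingB ab' (matchingMn N th')) (matchingB ab th)) => lt1.
  by apply: (olt_by (oltr_D lt1 (oler_D zb'' (ltW hh)))); abel.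
move=> /existsNP[a /existsNP[b /existsNP[t /existsNP[h]]]].
move=> /not_implyP[ab /not_implyP[th /not_implyP[[t0 _ _ [N [N1 N2]]] Nshrink]]].
have {}Nshrink c s d u : P c d -> P s u -> dist c s -> dom t s.
  move=> cd su cs; have [//|st] := dom_ll t s.
  by case: Nshrink; exists c, d, s, u.
have tau k : exists s u, P s u /\ s *+ 2 ^ k = t.
  elim: k => [|k [s [u [su <-]]]]; first by exists t, h.
  have [s' [u' [su' <-]]] := half _ _ su.
  by exists s', u'; split=> //; rewrite expnS mulrnA.
have expand k : exists m : int, forall s u, P s u -> s *+ 2 ^ k = t ->
    D (a + s *~ m) /\ ~ D (a + s *~ (m + 1)).
  have [s [u [su sk]]] := tau k.
  have [|||m m1 m2] :=
      @int_jump (fun m => D (a + s *~ m)) (- (N * 2 ^ k)%N%:Z) (N * 2 ^ k)%N.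
  - by rewrite mulrNz -pmulrn mulnC mulrnA sk.
  - by rewrite -pmulrn mulnC mulrnA sk.
  - lia.
  exists m => s' u' su' sk'; suff -> : s' = s by [].
  apply/eqP; rewrite -subr_eq0 -(@omulrn_eq0 _ (2 ^ k)) ?expn_gt0//.
  by rewrite mulrnBl sk sk' subrr.
have [m mE] := choice expand.
have mB : binary_expansion m.
  move=> k; have [s [u [su sk]]] := tau k.+1.
  have sk2 : s *+ 2 *+ 2 ^ k = t by rewrite -mulrnA -expnS.
  have s0 : 0 < s by rewrite -(@oltr_pMn2r _ (2 ^ k.+1)) ?expn_gt0// sk mul0rn.
  have [D1 D2] := mE _ _ _ su sk; have [D3 D4] := mE _ _ _ (matchingMn 2 su) sk2.
  have := DNlt _ _ D1 D4; have := DNlt _ _ D3 D2.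
  rewrite !(addrC a) !oltr_D2r.
  have -> : s *+ 2 *~ m k = s *~ (m k * 2) by abel.
  have -> : s *+ 2 *~ (m k + 1) = s *~ (m k * 2 + 2) by abel.
  by rewrite !oltr_pMz2l//; lia.
have h0 : 0 < h by rewrite -(matching_sgn th).
have [z0 z0P] := cH _ _ h0 mB.
exists (b + z0) => c d cd; have [s [u [su cs]]] := gap _ _ cd.
have [M tM] := Nshrink _ _ _ _ cd su cs.
case: cs => s0 Dcs NDcs _.
move: tM; rewrite (ger0_oabs (ltW t0)) (ger0_oabs (ltW s0)) => tM.
(* [2 ^ k] exceeds [5M], so [t <= M s] gives [5 v <= s]. The cut and [b + z0] lie in corresponding
   intervals of the grid of step [v] up to two steps, which this margin absorbs. *)
pose k := (5 * M)%N; have [v [w [vw vk]]] := tau k.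
have wk : w *+ 2 ^ k = h.
  by apply/eqP; rewrite -(matching_eq (matchingMn _ vw) th) vk.
have v0 : 0 < v by rewrite -(@oltr_pMn2r _ (2 ^ k)) ?expn_gt0// vk mul0rn.
have w0 : 0 < w by rewrite -(matching_sgn vw).
have v5 : v *+ 5 <= s.
  rewrite -(@oler_pMn2r _ (2 ^ k)) ?expn_gt0// mulrnAC vk.
  apply: le_trans (oler_wMn2r 5 tM) _; rewrite -mulrnA.
  by apply: oler_wpMn2l; [exact: ltW|rewrite mulnC ltnW// ltn_expl].
have [D1 D2] := mE _ _ _ vw vk.
have /andP[] := z0P k; rewrite -wk.
have -> : w *+ 2 ^ k *~ (m k - 1) = w *~ (m k - 1) *+ 2 ^ k by abel.
have -> : w *+ 2 ^ k *~ (m k + 2) = w *~ (m k + 2) *+ 2 ^ k by abel.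
rewrite !oler_pMn2r ?expn_gt0// => wz0 z0w.
have avb n := matchingD ab (matchingMz n vw).
have c5d n := matchingD cd (matchingMz n vw).
have w4 n : 0 <= w *+ n by rewrite omulrn_ge0// ltW.
split=> Dc.
  have : c + v *~ 5 < a + v *~ (m k + 1).
    apply: le_lt_trans (DNlt _ _ (Dcs Dc) D2).
    by apply: (ole_by v5); abel.
  rewrite (matching_lt (c5d 5) (avb _)) => lt1.
  by apply: (olt_by (oltr_D lt1 (oler_D wz0 (w4 3)))); abel.
have : a + v *~ m k < c - v *~ 5.
  apply: lt_le_trans (DNlt _ _ D1 (NDcs Dc)) _.
  by apply: (ole_by v5); abel.
rewrite -mulrNz (matching_lt (avb _) (c5d _)) => lt1.
by apply: (olt_by (oltr_D lt1 (oler_D z0w (w4 3)))); abel.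
Qed.

End Matchings.

Lemma Zorn_above (T : Type) (Phi : set (set T)) (A0 : set T) : Phi A0 ->
  (forall F : set (set T), F !=set0 -> F `<=` Phi -> total_on F subset ->
     Phi (\bigcup_(X in F) X)) ->
  exists A, [/\ Phi A, A0 `<=` A & forall B, Phi B -> A `<=` B -> B `<=` A].
Proof.
move=> PhiA0 Phichain.
have [|A [PA Amax]] :=
    @Zorn_bigcup _ [set A | A = set0 \/ (Phi A /\ A0 `<=` A)].
  move=> F FP Ftot; pose F' := [set A | F A /\ (Phi A /\ A0 `<=` A)].
  have [[A F'A]|NF'] := pselect (F' !=set0).
    right; have -> : \bigcup_(X in F) X = \bigcup_(X in F') X.
      apply/seteqP; split=> x [B FB Bx]; last by exists B => //; case: FB.
      by have [B0|PB] := FP _ FB; [rewrite B0 in Bx|exists B].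
    split; last by move=> x A0x; exists A => //; case: F'A => _ [_]; apply.
    apply: Phichain; first by exists A.
      by move=> B [_ []].
    by move=> B C [FB _] [FC _]; apply: Ftot.
  left; apply/seteqP; split=> // x [B FB Bx]; case: NF'; exists B; split=> //.
  by have [B0|//] := FP _ FB; rewrite B0 in Bx.
have [PhiA A0A] : Phi A /\ A0 `<=` A.
  case: PA => // A_0; have [A00|NA0] := pselect (A0 `<=` set0).
    have -> : A = A0 by rewrite A_0; apply/seteqP; split.
    by split.
  case: (Amax A0); last by right; split.
  by rewrite A_0; split.
exists A; split=> // B PhiB AB; apply: contrapT => NBA.
apply: (Amax B); first by split.
by right; split=> // x /A0A /AB.
Qed.

Section MaximalMatchings.
Variables G H : orderedZmodType.
Implicit Types P Q : G -> H -> Prop.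

Definition matching_sub P Q := forall a b, P a b -> Q a b.

Lemma matching_bigcup (F : set (set (G * H))) : F !=set0 ->
  (forall X, F X -> matching (fun a b => X (a, b))) -> total_on F subset ->
  matching (fun a b => (\bigcup_(X in F) X) (a, b)).
Proof.
move=> [X0 FX0] FP Ftot; split.
- by exists X0 => //; apply: matching0 (FP _ FX0).
- move=> a b c d [X FX Xab] [Y FY Ycd].
  have [XY|YX] := Ftot _ _ FX FY.
    by exists Y => //; apply: (matchingB (FP _ FY)) => //; apply: XY.
  by exists X => //; apply: (matchingB (FP _ FX)) => //; apply: YX.
- by move=> a b [X FX Xab]; apply: matching_sgn (FP _ FX) _ _ Xab.
Qed.

Lemma matching_flip P : matching P -> matching (fun b a => P a b).
Proof.
move=> mP; split=> [|b a d c ab cd|b a ab]; first exact: matching0 mP.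
  exact: matchingB.
by rewrite (matching_sgn mP ab).
Qed.

Definition value_full P := forall x : G, x != 0 ->
  exists t h, [/\ P t h, dom x t & dom t x].

Lemma matching_point P y : matching P ->
  (forall a b, P a b -> exists c d, P c d /\ c *+ 2 = a) -> value_full P ->
  spherically_complete H -> components_complete H -> (forall b, ~ P y b) ->
  exists z, forall a b, P a b -> (a < y) = (b < z) /\ (y < a) = (z < b).
Proof.
move=> mP half fullP sH cH Ny.
have half_pow n a b : P a b -> exists c d, P c d /\ c *+ 2 ^ n = a.
  elim: n a b => [|n IH] a b ab; first by exists a, b.
  have [c [d [cd <-]]] := half _ _ ab; have [c' [d' [cd' <-]]] := IH _ _ cd.
  by exists c', d'; split=> //; rewrite expnSr mulrnA.
have yP a b : P a b -> a != y by move=> ab; apply/eqP => ay; apply: (Ny b); rewrite -ay.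
have [||z zP] := @matching_cut_fill _ _ _ mP [set a | a < y] _ half _ sH cH.
- by move=> u v /= vy uv; apply: le_lt_trans uv vy.
- move=> a b ab.
  have [|t [h [th yt ty]]] := fullP (oabs (y - a)).
    by rewrite gt_eqF// oabs_gt0 subr_eq0 eq_sym (yP _ _ ab).
  have {}ty : dom t (y - a) by apply/dom_absr.
  have {}yt : dom (y - a) t by apply/dom_abs.
  have [M tM] := ty; have [N yN] := yt.
  (* From [|t| <= M |y - a|], the fraction [s] of [|t|] by [2 ^ M] is strictly below [|y - a|],
     while a multiple of it is above. *)
  have [s [u [su st]]] := half_pow M _ _ (matching_abs mP th).
  have t0 : 0 < oabs t.
    rewrite oabs_gt0; apply/eqP => t0; move: yt; rewrite t0 => /dom_eq0/eqP.
    by rewrite subr_eq0 eq_sym (negbTE (yP _ _ ab)).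
  have s0 : 0 < s by rewrite -(@oltr_pMn2r _ (2 ^ M)) ?expn_gt0// mul0rn st.
  have sy : s < oabs (y - a).
    have y0 : 0 < oabs (y - a) by rewrite oabs_gt0 subr_eq0 eq_sym (yP _ _ ab).
    rewrite -(@oltr_pMn2r _ (2 ^ M)) ?expn_gt0// st.
    apply: (le_lt_trans tM).
    rewrite -(subnK (ltnW (ltn_expl M (isT : (1 < 2)%N)))) mulrnDr -{1}[_ *+ M]add0r.
    by rewrite oltr_D2r omulrn_gt0// subn_gt0 ltn_expl.
  have ys : oabs (y - a) <= s *+ (2 ^ M * N) by rewrite mulrnA st.
  exists s, u; split=> //; exists (2 ^ M * N).+1 => /=; rewrite mulrS.
  have [ay|ya|ay] := ltgtP a y; last by have := yP _ _ ab; rewrite ay eqxx.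
    left; rewrite ger0_oabs ?osubr_ge0 ?(ltW ay)// in sy ys.
    split; first by apply: (olt_by sy); abel.
    by apply/negP; rewrite -leNgt; apply: (ole_by (oler_D ys (ltW s0))); abel.
  right; rewrite ler0_oabs in sy ys; last by rewrite -ooppr_ge0 opprB osubr_ge0 ltW.
  split; first by apply/negP; rewrite -leNgt; apply: (ole_by (ltW sy)); abel.
  by apply: (olt_by (oltr_D s0 ys)); abel.
exists z => a b ab; have [az za] := zP _ _ ab.
have [/[dup] ay /az bz|ya|ay] := ltgtP a y.
- by rewrite bz ltNge (ltW bz).
- have zb : z < b by apply: za; rewrite /= ltNge (ltW ya).
  by rewrite zb ltNge (ltW zb).
- by have := yP _ _ ab; rewrite ay eqxx.
Qed.

Definition maximal_matching P :=
  matching P /\ forall Q, matching Q -> matching_sub P Q -> matching_sub Q P.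

Lemma maximal_matching_exists P0 : matching P0 ->
  exists2 P, maximal_matching P & matching_sub P0 P.
Proof.
move=> mP0.
have [||X [mX P0X Xmax]] := @Zorn_above _
    [set X : set (G * H) | matching (fun a b => X (a, b))] [set p | P0 p.1 p.2].
- by [].
- by move=> F F0 FP Ftot; apply: matching_bigcup.
exists (fun a b => X (a, b)); last by move=> a b ab; apply: (P0X (a, b)).
split=> // Q mQ XQ a b Qab; apply: (Xmax [set p | Q p.1 p.2]) => //.
by move=> [c d] /= /XQ.
Qed.

End MaximalMatchings.

Lemma maximal_matching_flip (G H : orderedZmodType) (P : G -> H -> Prop) :
  maximal_matching P -> maximal_matching (fun b a => P a b).
Proof.
move=> [mP Pmax]; split=> [|Q mQ PQ b a Qba]; first exact: matching_flip.
by apply: (Pmax (fun a b => Q b a)) Qba; [exact: matching_flip|move=> c d /PQ].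
Qed.

(** The pairs whose [n]-fold multiples are matched form a matching that extends [P], hence equals
    [P]. *)
Lemma maximal_matching_divisible (G H : orderedZmodType) (P : G -> H -> Prop) n a b :
  divisible G -> divisible H -> maximal_matching P -> (0 < n)%N -> P a b ->
  exists c d, [/\ P c d, c *+ n = a & d *+ n = b].
Proof.
move=> divG divH [mP Pmax] n0 ab.
have [[c ca] [d db]] := (divG _ a n0, divH _ b n0); exists c, d; split=> //.
apply: (Pmax (fun x w => P (x *+ n) (w *+ n))); last by rewrite ca db.
- split; first by rewrite !mul0rn; apply: matching0.
    by move=> x w x' w' xw xw'; rewrite !mulrnBl; apply: matchingB.
  move=> x w /(matching_sgn mP).
  by rewrite -{1}(mul0rn G n) -{1}(mul0rn H n) !oltr_pMn2r.
- by move=> x w; apply: matchingMn.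
Qed.

(** Choose [z] realizing the same cut as [y] and send [a + k y] to [b + k z]. After division of [a]
    by [k], the sign of such an element is a comparison of [y] with an element of the domain. *)
Lemma maximal_matching_total (G H : orderedZmodType) (P : G -> H -> Prop) y :
  divisible G -> divisible H -> spherically_complete H -> components_complete H ->
  maximal_matching P -> value_full P -> exists z, P y z.
Proof.
move=> divG divH sH cH maxP fullP; apply: contrapT => Ny.
have [mP Pmax] := maxP.
have div n a b := @maximal_matching_divisible _ _ P n a b divG divH maxP.
have [|||||z zP] := @matching_point _ _ P y mP => //.
- by move=> a b /(div 2 _ _ isT)[c [d [cd <- _]]]; exists c, d.
- by move=> b yb; apply: Ny; exists b.
pose Q x w := exists a b (k : int), [/\ P a b, x = a + y *~ k & w = b + z *~ k].
apply: Ny; exists z; apply: (Pmax Q).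
- split.
  + by exists 0, 0, 0; split; rewrite ?mulr0z ?addr0//; apply: matching0.
  + move=> _ _ _ _ [a [b [k [ab -> ->]]]] [c [d [j [cd -> ->]]]].
    exists (a - c), (b - d), (k - j); split; [exact: matchingB|abel|abel].
  have pos a b n : P a b ->
      ((0 < a + y *+ n.+1) = (0 < b + z *+ n.+1)) *
      ((a + y *+ n.+1 < 0) = (b + z *+ n.+1 < 0)).
    move=> /(div n.+1 _ _ isT)[c [d [cd <- <-]]]; rewrite -!mulrnDl.
    rewrite -(mul0rn G n.+1) -(mul0rn H n.+1) !oltr_pMn2r//.
    have [yz zy] := zP _ _ (matchingN mP cd).
    have sgnE (K : orderedZmodType) (u v : K) :
        ((0 < u + v) = (- u < v)) * ((u + v < 0) = (v < - u)).
      rewrite -[- u < v]osubr_gt0 opprK addrC -[v < - u]osubr_gt0 -ooppr_gt0.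
      by rewrite opprD [- v - u]addrC.
    by rewrite !(sgnE G) !(sgnE H) yz zy.
  move=> _ _ [a [b [[n|n] [ab -> ->]]]]; rewrite ?NegzE ?mulrNz -?pmulrn.
    case: n => [|n]; last by case: (pos _ _ n ab).
    by rewrite !mulr0n !addr0 (matching_sgn mP ab).
  have [_] := pos _ _ n (matchingN mP ab).
  by rewrite -[LHS]ooppr_gt0 -[RHS]ooppr_gt0 !opprD !opprK.
- by move=> a b ab; exists a, b, 0; rewrite !mulr0z !addr0.
by exists 0, 0, 1; rewrite !mulr1z !add0r; split=> //; apply: matching0.
Qed.

Lemma matching_iso (G H : orderedZmodType) (P : G -> H -> Prop) :
  matching P -> (forall a, exists b, P a b) -> (forall b, exists a, P a b) ->
  exists f : G -> H, [/\ forall a b, P a b <-> b = f a, bijective f &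
    {mono f : x y / x <= y}].
Proof.
move=> mP /choice[f fP] /choice[g gP].
have fE a b : P a b -> b = f a.
  by move=> ab; apply/eqP; rewrite -(matching_eq mP ab (fP a)).
exists f; split=> [a b||x y]; last by rewrite (matching_le mP (fP x) (fP y)).
  by split=> [/fE|->].
exists g => x; last by rewrite -(fE _ _ (gP x)).
by apply/eqP; rewrite (matching_eq mP (gP (f x)) (fP x)).
Qed.

Lemma ordered_group_iso (G H : orderedZmodType) (P0 : G -> H -> Prop) :
  divisible G -> divisible H ->
  spherically_complete G -> components_complete G ->
  spherically_complete H -> components_complete H ->
  matching P0 -> value_full P0 -> value_full (fun b a => P0 a b) ->
  exists f : {additive G -> H}, bijective f /\ {mono f : x y / x <= y}.
Proof.
move=> divG divH sG cG sH cH mP0 fullG fullH.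
have [P maxP P0P] := maximal_matching_exists mP0.
have [mP _] := maxP.
have [||f [fP fbij fmono]] := @matching_iso G H P mP.
- move=> a; apply: maximal_matching_total => //.
  by move=> x /fullG[t [h [/P0P th xt tx]]]; exists t, h.
- move=> b; apply: (@maximal_matching_total _ _ (fun b a => P a b)) => //.
    exact: maximal_matching_flip.
  by move=> x /fullH[t [h [/P0P th xt tx]]]; exists t, h.
have fadd : zmod_morphism f.
  by move=> x y; apply/esym/fP/(matchingB mP); apply/fP.
by exists (HB.pack_for {additive G -> H} f (GRing.isZmodMorphism.Build G H f fadd)).
Qed.

(** * Matchings spanned by families of elements with distinct values *)

Section Span.
Variables (G H : orderedZmodType) (I : eqType) (t : I -> G) (h : I -> H).

Definition span_matching (a : G) (b : H) := exists s : seq (int * I),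
  a = \sum_(p <- s) t p.2 *~ p.1 /\ b = \sum_(p <- s) h p.2 *~ p.1.

Hypothesis t_gt0 : forall i, 0 < t i.
Hypothesis h_gt0 : forall i, 0 < h i.
Hypothesis th_ll : forall i j, i != j ->
  (ll (t i) (t j) /\ ll (h i) (h j)) \/ (ll (t j) (t i) /\ ll (h j) (h i)).

Lemma llMz (K : orderedZmodType) (x y : K) (n : int) : ll x y -> ll (x *~ n) y.
Proof. exact/dom_llt/domMz. Qed.

Lemma dom_divz (K : orderedZmodType) (x : K) (n : int) : n != 0 -> dom x (x *~ n).
Proof.
case: n => n; rewrite ?NegzE ?mulrNz -pmulrn => n0; last exact/domrN/dom_divn.
by apply: dom_divn; rewrite lt0n.
Qed.

Lemma span_sum_sgn (K : orderedZmodType) (u : I -> K) (s : seq (int * I)) i :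
  0 < u i -> (forall p, p \in s -> p.2 != i -> ll (u p.2) (u i)) ->
  let k := \sum_(p <- s | p.2 == i) p.1 in
  k != 0 -> (0 < \sum_(p <- s) u p.2 *~ p.1) = (0 < k).
Proof.
move=> ui ull k k0; rewrite (bigID (fun p => p.2 == i)) /=.
have -> : \sum_(p <- s | p.2 == i) u p.2 *~ p.1 = u i *~ k.
  by rewrite /k mulrz_sumr; apply: eq_bigr => p /eqP ->.
set r := \sum_(p <- s | _) _.
have rk : ll r (u i *~ k).
  apply: (ll_domt _ (dom_divz _ k0)); rewrite /r big_seq_cond.
  apply: (big_ind (fun x => ll x (u i))) => [|x y|p /andP[ps pi]];
    [|exact: llD|exact/llMz/ull].
  by apply: ll0; rewrite gt_eqF.
have -> : (0 < u i *~ k + r) = (0 < u i *~ k).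
  by apply: ll_sgn; rewrite addrAC subrr add0r.
by rewrite -(mulr0z (u i)) oltr_pMz2l.
Qed.

(** Among the finitely many indices that occur, one dominates in both families, and its total
    coefficient decides both signs. If that coefficient vanishes, the terms of this index cancel on
    both sides and induction applies. *)
Lemma span_sgn (s : seq (int * I)) :
  (0 < \sum_(p <- s) t p.2 *~ p.1) = (0 < \sum_(p <- s) h p.2 *~ p.1).
Proof.
have [n] := ubnP (size s); elim: n s => // n IH s /ltnSE sn.
have [->|s0] := eqVneq s [::]; first by rewrite !big_nil !ltxx.
have [i [i_s imax]] : exists i, has (fun p => p.2 == i) s /\
    forall p, p \in s -> p.2 != i -> ll (t p.2) (t i) /\ ll (h p.2) (h i).
  elim: s s0 {sn} => // -[k j] s IHs _; have [->|/IHs[i [i_s imax]]] := eqVneq s [::].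
    exists j; rewrite /= eqxx; split=> // p; rewrite inE => /eqP -> /=.
    by rewrite eqxx.
  have [ij|ij] := eqVneq j i.
    exists i; rewrite /= ij eqxx; split=> // p; rewrite inE => /predU1P[->|/imax//].
    by rewrite eqxx.
  have [[ti hi]|[tj hj]] := th_ll ij.
    exists i; rewrite /= i_s orbT; split=> // p; rewrite inE => /predU1P[->|/imax//].
    by [].
  exists j; rewrite /= eqxx; split=> // p; rewrite inE => /predU1P[->|ps pj].
    by rewrite eqxx.
  have [->//|pi] := eqVneq p.2 i.
  by have [pt ph] := imax _ ps pi; split; [apply: ll_trans tj|apply: ll_trans hj].
pose k := \sum_(p <- s | p.2 == i) p.1.
have [k0|k0] := eqVneq k 0; last first.
  rewrite !(@span_sum_sgn _ _ _ i)// => p ps pi; by have [] := imax p ps pi.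
have drop (K : orderedZmodType) (u : I -> K) :
    \sum_(p <- s) u p.2 *~ p.1 = \sum_(p <- [seq p <- s | p.2 != i]) u p.2 *~ p.1.
  rewrite big_filter (bigID (fun p => p.2 == i)) /=.
  have -> : \sum_(p <- s | p.2 == i) u p.2 *~ p.1 = u i *~ k.
    by rewrite /k mulrz_sumr; apply: eq_bigr => p /eqP ->.
  by rewrite k0 mulr0z add0r.
rewrite !drop; apply: IH; apply: leq_trans sn.
rewrite size_filter ltn_neqAle count_size andbT -all_count.
by rewrite -has_predC; apply: sub_has i_s => p /=; rewrite negbK.
Qed.

Lemma span_matchingP : matching span_matching.
Proof.
split.
- by exists [::]; rewrite !big_nil.
- move=> _ _ _ _ [s [-> ->]] [s' [-> ->]].
  exists (s ++ [seq (- p.1, p.2) | p <- s']).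
  rewrite !big_cat !big_map /=; split; congr (_ + _); rewrite -sumrN;
    by apply: eq_bigr => p _; rewrite mulrNz.
- by move=> _ _ [s [-> ->]]; rewrite span_sgn.
Qed.

Lemma span_matching_gen i : span_matching (t i) (h i).
Proof. by exists [:: (1, i)]; rewrite !big_seq1 !mulr1z. Qed.

End Span.

(** * Hahn products *)

Section HahnValuation.
Context {d : Order.disp_t} {I : orderType d}.
Variable C : I -> orderedZmodType.
Implicit Types x y : hahn C.

Definition hahn_ev i x := x i.

Fact hahn_ev_additive i : zmod_morphism (hahn_ev i).
Proof. by []. Qed.

HB.instance Definition _ i :=
  GRing.isZmodMorphism.Build (hahn C) (C i) (hahn_ev i) (hahn_ev_additive i).

Lemma hahnMn x n i : (x *+ n) i = x i *+ n.
Proof. exact: (raddfMn (hahn_ev i)). Qed.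

Lemma hahnMz x (n : int) i : (x *~ n) i = x i *~ n.
Proof. exact: (raddfMz (hahn_ev i)). Qed.

Lemma hahn_lt_at x y i : x i < y i -> (forall j, (j < i)%O -> x j = y j) -> x < y.
Proof.
move=> xy xyj; rewrite -osubr_gt0; apply/hahn_gt0P; exists i.
by split=> [|j /xyj /= ->]; [rewrite /= osubr_gt0|rewrite subrr].
Qed.

Definition lead x i := x i != 0 /\ forall j, (j < i)%O -> x j = 0.

Lemma leadP x : x != 0 -> exists i, lead x i.
Proof.
move=> /hahn_pos_total[[i [xi xj]]|[i [xi xj]]]; exists i.
  by split=> //; rewrite gt_eqF.
split=> [|j /xj/eqP]; last by rewrite /= oppr_eq0 => /eqP.
by rewrite -oppr_eq0 gt_eqF.
Qed.

Lemma lead_neq0 x i : lead x i -> x != 0.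
Proof. by move=> [xi _]; apply: contra_neq xi => ->. Qed.

Lemma oabs_lead x i : lead x i -> 0 < oabs x i /\ forall j, (j < i)%O -> oabs x j = 0.
Proof.
move=> [xi xj]; have posP (y : hahn C) : 0 <= y -> y i != 0 ->
    (forall j, (j < i)%O -> y j = 0) -> 0 < y i.
  move=> y0 yi yj; rewrite lt_neqAle eq_sym yi leNgt; apply/negP => yi0.
  have : y < 0 by apply: (@hahn_lt_at _ _ i) => //= j /yj ->.
  by rewrite ltNge y0.
have [x0|/ltW x0] := leP (0 : hahn C) x.
  by rewrite ger0_oabs//; split=> //; apply: posP.
rewrite ler0_oabs//; split=> [|j /xj /= ->]; last by rewrite oppr0.
apply: posP => [|/=|j /xj /= ->]; rewrite ?ooppr_ge0 ?oppr_eq0 ?oppr0//.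
Qed.

Lemma lead_ll x y i : lead y i -> (forall j, (j <= i)%O -> x j = 0) -> ll x y.
Proof.
move=> yi xj; have [yi0 yj0] := oabs_lead yi.
have absj j : (j <= i)%O -> oabs x j = 0.
  by move=> ji; rewrite /oabs; case: ltP => _; rewrite /= xj ?oppr0.
apply/llP => n; apply: (@hahn_lt_at _ _ i); rewrite ?hahnMn ?absj ?mul0rn//.
by move=> j ji; rewrite hahnMn absj ?(ltW ji)// mul0rn yj0.
Qed.

Lemma dom_lead x y i : dom x y -> lead y i -> forall j, (j < i)%O -> x j = 0.
Proof.
move=> xy yi j ji; apply/eqP/negPn/negP => xj.
have [k [xk xk0]] : exists k, lead x k.
  by apply: leadP; apply: contra_neq xj => ->.
have [ik|ki] := leP i k.
  by rewrite xk0 ?eqxx ?(lt_le_trans ji ik) in xj.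
suff : ll y x by [].
apply: lead_ll (conj xk xk0) _ => l lk.
by case: yi => _; apply; apply: le_lt_trans ki.
Qed.

Hypothesis archC : forall i, archimedean (C i).

Lemma lead_dom x y i : lead y i -> (forall j, (j < i)%O -> x j = 0) -> dom x y.
Proof.
move=> yi xj; have [yi0 yj0] := oabs_lead yi.
have [n xn] := archC (oabs (x i)) yi0; exists n.+1; rewrite oabs_le.
have ni : oabs (x i) < oabs y i *+ n.+1.
  by apply: (le_lt_trans xn); rewrite -osubr_gt0 mulrS addrK.
apply/andP; split; apply/ltW/(@hahn_lt_at _ _ i).
- rewrite /= hahnMn -oltr_N2 opprK.
  exact: le_lt_trans (lerN_oabs _) ni.
- by move=> j ji; rewrite /= hahnMn yj0// mul0rn oppr0 xj.
- by rewrite hahnMn; apply: le_lt_trans (ler_oabs _) ni.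
- by move=> j ji; rewrite hahnMn yj0// mul0rn xj.
Qed.

End HahnValuation.

Section RealHahn.
Context {d : Order.disp_t} {I : orderType d} {R : realType}.
Local Notation H := (hahn (fun _ : I => (R : realFieldType) : orderedZmodType)).
Implicit Types x y : H.

Lemma archimedean_real : archimedean ((R : realFieldType) : orderedZmodType).
Proof.
move=> x y x0; exists (Num.bound (`|y| / x)).
have /ltW := archi_boundP (divr_ge0 (normr_ge0 y) (ltW x0)).
rewrite ler_pdivrMr// mulr_natl; apply: le_trans.
exact: ler_norm.
Qed.

(** The coefficient of the common point at [i] is that of any centre whose ball determines it, and 0
    if there is none. Up to any index of its support the point agrees with a centre, so the support
    is wellordered. *)
Lemma hahn_spherically_complete : spherically_complete H.
Proof.
move=> X Xcompat Xshrink.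
have Xlead a r : X a r -> exists i, lead r i.
  by move=> /Xshrink[b [s [_ /ll_neq0/leadP]]].
have valE i : exists v : R,
    (forall a r j, X a r -> lead r j -> (i < j)%O -> v = a i) /\
    (v != 0 -> exists a r j, [/\ X a r, lead r j, (i < j)%O & v = a i]).
  have [[a [r [j [Xar rj ij]]]]|NX] :=
      pselect (exists a r j, [/\ X a r, lead r j & (i < j)%O]); last first.
    exists 0; rewrite eqxx; split=> // a r j Xar rj ij.
    by case: NX; exists a, r, j.
  exists (a i); split; last by exists a, r, j.
  move=> b s k Xbs sk ik; apply/eqP; rewrite -subr_eq0; apply/eqP.
  have [rs|sr] := dom_total r s.
    exact: (dom_lead (Xcompat _ _ _ _ Xar Xbs rs) sk).
  apply/eqP; rewrite -oppr_eq0 opprB; apply/eqP.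
  exact: (dom_lead (Xcompat _ _ _ _ Xbs Xar sr) rj).
have [z zP] := choice valE.
have z_wo : wo_chain <=%O (fun i => (z i : ((R : realFieldType) : orderedZmodType)) != 0).
  apply/wo_chainP => A Az [i Ai].
  have /(zP i).2[a [r [j [Xar rj ij _]]]] : z i != 0 by exact: Az.
  have /wo_chainP/(_ [set k | A k /\ (k <= i)%O])[||m [Am mi] mA] := hahn_wo a.
  - move=> k [/Az zk ki]; rewrite /in_mem /=.
    by rewrite -((zP k).1 _ _ _ Xar rj (le_lt_trans ki ij)).
  - by exists i.
  exists m => // k Ak; have [ki|/ltW ik] := leP k i; first exact: mA.
  exact: le_trans mi ik.
exists (Hahn z_wo) => a r Xar; have [j rj] := Xlead _ _ Xar.
apply: (lead_dom (fun _ => archimedean_real) rj) => i ij /=.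
by rewrite ((zP i).1 _ _ _ Xar rj ij) subrr.
Qed.

Lemma binary_expansion_real (m : nat -> int) : binary_expansion m ->
  exists rho : R, forall k, (m k)%:~R <= 2 ^+ k * rho <= (m k)%:~R + 1.
Proof.
move=> mB; pose S := range (fun k => (m k)%:~R / 2 ^+ k : R).
have pow_gt0 k : 0 < 2 ^+ k :> R by rewrite exprn_gt0.
have Sub k : ubound S (((m k)%:~R + 1) / 2 ^+ k).
  move=> _ [j _ <-]; rewrite ler_pdivrMr// mulrAC ler_pdivlMr//.
  have powE n : 2 ^+ n = (2 ^ n)%N%:~R :> R by rewrite -pmulrn natrX.
  rewrite !powE -[1]/(1%:~R) -rmorphD -!rmorphM ler_int.
  have [/subnK <-|/ltnW/subnK <-] := leqP k j.
    by have := binary_expansionP k (j - k) mB; rewrite expnD; nia.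
  by have := binary_expansionP j (k - j) mB; rewrite expnD; nia.
have Ssup : has_sup S.
  by split; [exists ((m 0%N)%:~R / 2 ^+ 0), 0%N|exists (((m 0%N)%:~R + 1) / 2 ^+ 0)].
exists (sup S) => k; rewrite mulrC -ler_pdivrMr//; apply/andP; split.
  by apply: sup_upper_bound => //; exists k.
by rewrite -ler_pdivlMr//; apply: ge_sup; [case: Ssup|exact: Sub].
Qed.

(** Multiply all coefficients by the real number [rho]. The slack makes both inequalities strict at
    the leading index of [a], which decides the lexicographic order. *)
Lemma hahn_components_complete : components_complete H.
Proof.
move=> a m a0 mB; have [rho rhoP] := binary_expansion_real mB.
have wo : wo_chain <=%O (fun i => (rho * (a i : R) : ((R : realFieldType) : orderedZmodType)) != 0).
  apply: (wo_chain_sub _ (hahn_wo a)) => i; rewrite /in_mem /=.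
  by apply: contra => /eqP ->; rewrite mulr0.
have /hahn_gt0P[i [ai aj]] := a0.
exists (Hahn wo) => k; have /andP[mk km] := rhoP k.
apply/andP; split; apply/ltW/(@hahn_lt_at _ _ _ _ _ i).
- rewrite hahnMz hahnMn /= -[ltLHS]mulrzr -[ltRHS]mulr_natl natrX mulrA.
  by rewrite mulrC ltr_pM2r// intrB; lra.
- by move=> j ji; rewrite hahnMz hahnMn /= aj// mulr0 mul0rz mul0rn.
- rewrite hahnMz hahnMn /= -[ltRHS]mulrzr -[ltLHS]mulr_natl natrX mulrA.
  by rewrite [ltRHS]mulrC ltr_pM2r// intrD; lra.
- by move=> j ji; rewrite hahnMz hahnMn /= aj// mulr0 mul0rz mul0rn.
Qed.

Lemma hahn_divisible : divisible H.
Proof.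
move=> n x n0.
have wo : wo_chain <=%O (fun i => ((x i : R) / n%:R : ((R : realFieldType) : orderedZmodType)) != 0).
  apply: (wo_chain_sub _ (hahn_wo x)) => i; rewrite /in_mem /=.
  by apply: contra => /eqP ->; rewrite mul0r.
exists (Hahn wo); apply: hahnP => i; rewrite hahnMn /=.
by rewrite -[LHS]mulr_natr divfK// pnatr_eq0 -lt0n.
Qed.

End RealHahn.

(** * The value set of an ordered group *)

Section ValueClasses.
Variable G : orderedZmodType.
Implicit Types x y : G.

(** The set passed to [xget] depends only on the value of [x], so elements of equal value get the
    same representative. The default 0 is reached at [x = 0] only. *)
Definition value_repr x := xget 0 [set y | [/\ 0 < y, dom x y & dom y x]].

Lemma value_reprP x : x != 0 ->
  [/\ 0 < value_repr x, dom x (value_repr x) & dom (value_repr x) x].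
Proof.
move=> x0; rewrite /value_repr; case: xgetP => [y -> //|/(_ (oabs x)) []].
by rewrite /= oabs_gt0; split=> //; [apply/dom_absr/dom_refl|apply/dom_abs/dom_refl].
Qed.

Lemma eq_value_repr x y : x != 0 -> dom x y -> dom y x -> value_repr x = value_repr y.
Proof.
move=> x0 xy yx; rewrite /value_repr.
congr xget; apply/seteqP.
by split=> z [z0 h1 h2]; split=> //;
  [apply: dom_trans h1|apply: dom_trans xy|apply: dom_trans h1|apply: dom_trans yx].
Qed.

Definition is_value_repr : {pred G} := fun x => (0 < x) && (x == value_repr x).

(** The order inherited from [G] is opposite to the order of the values; the index set of the Hahn
    product is therefore the dual. *)
Definition value_class := {x : G | is_value_repr x}.

HB.instance Definition _ := SubChoice.on value_class.

HB.instance Definition _ := [SubChoice_isSubOrder of value_class by <: with ring_display].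

Lemma value_class_exists x : x != 0 ->
  exists i : value_class, dom x (val i) /\ dom (val i) x.
Proof.
move=> x0; have [r0 xr rx] := value_reprP x0.
have r_repr : is_value_repr (value_repr x).
  by rewrite /is_value_repr r0 -(eq_value_repr x0 xr rx) eqxx.
by exists (Sub (value_repr x) r_repr).
Qed.

Lemma value_class_gt0 (i : value_class) : 0 < val i.
Proof. by have /andP[] := valP i. Qed.

Lemma value_class_ll (i j : value_class) : (i < j)%O -> ll (val i) (val j).
Proof.
move=> ij ji; have [i0 j0] := (value_class_gt0 i, value_class_gt0 j).
have ij' : dom (val i) (val j).
  by apply: (@dom_pos _ _ _ 1); rewrite ?ltW// mulr1n.
have /andP[_ /eqP iE] := valP i; have /andP[_ /eqP jE] := valP j.
suff : val i = val j by move/val_inj => e; rewrite e ltxx in ij.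
by rewrite iE jE; apply: eq_value_repr => //; rewrite gt_eqF.
Qed.

End ValueClasses.

Section Monomials.
Context {d : Order.disp_t} {I : orderType d} {R : realType}.
Local Notation H := (hahn (fun _ : I => (R : realFieldType) : orderedZmodType)).

Fact hahn_mono_wo (i : I) (r : R) :
  wo_chain <=%O (fun j => ((if j == i then r else 0) : (R : realFieldType) : orderedZmodType) != 0).
Proof.
have := wo_chain_sub _ (@wo_chain1 _ I i); apply => j; rewrite /in_mem /=.
by case: (j =P i) => // _; rewrite eqxx.
Qed.

Definition hahn_mono i r : H := Hahn (@hahn_mono_wo i r).

Lemma lead_hahn_mono i r : r != 0 -> lead (hahn_mono i r) i.
Proof. by move=> r0; split=> [|j ji] /=; [rewrite eqxx|rewrite lt_eqF]. Qed.

Lemma hahn_mono_ll i j r s : (j < i)%O -> s != 0 ->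
  ll (hahn_mono i r) (hahn_mono j s).
Proof.
move=> ji s0; apply: (lead_ll (lead_hahn_mono j s0)) => k kj /=.
by rewrite lt_eqF// (le_lt_trans kj).
Qed.

Lemma hahn_mono_gt0 i r : 0 < r -> 0 < hahn_mono i r.
Proof.
by move=> r0; apply/hahn_gt0P; exists i; split=> [|j ji] /=; [rewrite eqxx|rewrite lt_eqF].
Qed.

Lemma dom_lead_mono (x : H) i r : r != 0 -> lead x i ->
  dom x (hahn_mono i r) /\ dom (hahn_mono i r) x.
Proof.
move=> r0 xi; have [ri rj] := lead_hahn_mono i r0.
by split; apply: (lead_dom (fun _ => archimedean_real)); first exact: lead_hahn_mono;
  [case: xi|exact: xi|].
Qed.

End Monomials.

Lemma symmetrically_complete_group (R : realType) (G : orderedZmodType) :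
  symmetrically_complete G ->
  exists f : {additive G ->
      hahn (fun _ : (value_class G)^d%type => (R : realFieldType) : orderedZmodType)},
    bijective f /\ {mono f : x y / x <= y}.
Proof.
move=> /symmetrically_complete_mirror_free mfG.
have sG := mirror_free_spherically_complete mfG.
have cG := mirror_free_components_complete mfG.
set I := (value_class G)^d%type.
pose t (i : I) : G := val (i : value_class G).
pose h (i : I) := hahn_mono i (1 : R).
have th i j : i != j ->
    (ll (t i) (t j) /\ ll (h i) (h j)) \/ (ll (t j) (t i) /\ ll (h j) (h i)).
  rewrite neq_lt => /orP[ij|ji]; [right|left].
    by split; [exact: (@value_class_ll G j i)|apply: hahn_mono_ll; rewrite ?oner_eq0].
  by split; [exact: (@value_class_ll G i j)|apply: hahn_mono_ll; rewrite ?oner_eq0].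
apply: (@ordered_group_iso G _ (span_matching t h)).
- exact: complete_divisible.
- exact: hahn_divisible.
- by [].
- by [].
- exact: hahn_spherically_complete.
- exact: hahn_components_complete.
- apply: span_matchingP => // i; first exact: value_class_gt0.
  exact: hahn_mono_gt0.
- move=> x /value_class_exists[i [xi ix]].
  by exists (t i), (h i); split=> //; apply: span_matching_gen.
- move=> y /leadP[i yi].
  have [yh hy] := dom_lead_mono (oner_neq0 R) yi.
  by exists (h i), (t i); split=> //; apply: span_matching_gen.
Qed.

(** * Real closedness *)

Section RealClosedness.
Variable K : realFieldType.
Implicit Types (p q : {poly K}) (x y z a b : K).

Lemma oabs_norm x : oabs (x : (K : orderedZmodType)) = `|x|.
Proof. exact: maxrN. Qed.

(** [p - p(z)] is [X - z] times a polynomial bounded near [z]; [e] keeps this product below half of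
    [|p(z)|]. *)
Lemma horner_near p z : p.[z] != 0 ->
  exists2 e, 0 < e & forall w, `|w - z| <= e -> 0 < p.[w] * p.[z].
Proof.
move=> pz; have /factor_theorem[s sE] : root (p - p.[z]%:P) z.
  by rewrite /root hornerD hornerN hornerC subrr.
have [M sM] := poly_itv_bound s (z - 1) (z + 1).
pose e := Num.min 1 (`|p.[z]| / (2 * (`|M| + 1))).
have M0 : 0 < 2 * (`|M| + 1) by rewrite mulr_gt0// ltr_wpDl.
have pz0 : 0 < `|p.[z]| by rewrite normr_gt0.
exists e => [|w]; first by rewrite lt_min ltr01 divr_gt0.
rewrite /e le_min ler_pdivlMr// => /andP[w1 we].
have pw : p.[w] = p.[z] + s.[w] * (w - z).
  have := congr1 (fun q => q.[w]) sE.
  by rewrite !hornerE => <-; rewrite addrC subrK.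
have sw : `|s.[w]| <= `|M| + 1.
  apply: le_trans (_ : M <= _); last by rewrite (le_trans (ler_norm M))// lerDl.
  by apply: sM; move: w1; rewrite ler_distl => /andP[-> ->].
have h : `|s.[w] * (w - z)| * 2 <= `|p.[z]|.
  have := ler_wpM2r (normr_ge0 (w - z)) sw; rewrite -normrM; lra.
rewrite pw; move: (s.[w] * _) p.[z] pz0 h => u v v0 uv {sM pz pw sw e}.
have : `|u| < `|v| by lra.
rewrite ltr_norml => /andP[]; have [v1|v1|->] := ltrgt0P v.
- by move=> *; rewrite mulr_gt0//; lra.
- by move=> *; rewrite nmulr_rgt0//; lra.
- by lra.
Qed.

(** Divisibility of the value group, in multiplicative terms. *)
Definition value_divisible := forall x n, 0 < x -> (0 < n)%N ->
  exists y, [/\ 0 < y, dom (x : (K : orderedZmodType)) (y ^+ n) &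
    dom (y ^+ n : (K : orderedZmodType)) x].

Hypothesis vdK : value_divisible.

Section ConstantSign.
(** On the positive elements [U] is the lower side of a cut stable under multiples, that is, a cut
    between values. An interval from [U] to its complement serves as a neighbourhood of the cut. *)
Variable U : set K.
Hypothesis Ulow : forall x y, 0 < x <= y -> U y -> U x.
Hypothesis Umul : forall x n, U x -> U (x *+ n.+1).

Lemma U_lt u v : 0 < v -> U u -> ~ U v -> u < v.
Proof. by move=> v0 Uu NUv; rewrite ltNge; apply/negP => vu; apply/NUv/Ulow/Uu/andP. Qed.

(** For positive [c] and [d], the terms balance where [w] has the value of [t], a root of order
    [j - i] of [c / d] up to value. If [t] is in [U], the term of higher degree prevails above a
    multiple of [t]; otherwise the other one prevails below a fraction of [t]. *)
Lemma monomial_compare (c d : K) (i j C : nat) u0 v0 : (i < j)%N ->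
  0 <= c -> 0 <= d -> 0 < u0 -> U u0 -> 0 < v0 -> ~ U v0 ->
  exists u v, [/\ 0 < u, U u, 0 < v, ~ U v &
    (forall w, u <= w <= v -> c * w ^+ i *+ C <= d * w ^+ j) \/
    (forall w, u <= w <= v -> d * w ^+ j *+ C <= c * w ^+ i)].
Proof.
move=> ij; rewrite !le_eqVlt => /predU1P[<- d0|c0] .
  move=> u00 Uu0 v00 Uv0; exists u0, v0; split=> //; left=> w /andP[uw _].
  rewrite mul0r mul0rn mulr_ge0 ?exprn_ge0 ?(le_trans _ uw) ?(ltW u00)//.
  by case/predU1P: d0 => [<-|/ltW].
move=> /predU1P[<-|d0] u00 Uu0 v00 Uv0.
  exists u0, v0; split=> //; right=> w /andP[uw _].
  by rewrite mul0r mul0rn mulr_ge0 ?exprn_ge0 ?(le_trans _ uw) ?(ltW u00) ?(ltW c0).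
have [|t [t0 [M ctM] [N tcN]]] := vdK (divr_gt0 c0 d0) (_ : 0 < j - i)%N.
  by rewrite subn_gt0.
have tn0 : 0 < t ^+ (j - i) by rewrite exprn_gt0.
rewrite !oabs_norm !gtr0_norm ?divr_gt0// in ctM tcN.
have {}ctM : c <= d * t ^+ (j - i) *+ M.
  by rewrite -mulrnAr mulrC -ler_pdivrMr.
have {}tcN : d * t ^+ (j - i) <= c *+ N.
  by move: tcN; rewrite -mulr_natr mulrAC ler_pdivlMr// mulr_natr mulrC.
have wE w : w ^+ j = w ^+ i * w ^+ (j - i) by rewrite -exprD subnKC// ltnW.
have [Ut|NUt] := pselect (U t).
  exists (t *+ (C * M).+1), v0; split=> //; first by rewrite pmulrn_lgt0.
    exact: Umul.
  left=> w /andP[tw _].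
  have w0 : 0 < w by apply: lt_le_trans tw; rewrite pmulrn_lgt0.
  rewrite wE [d * _]mulrCA [c * _]mulrC -mulrnAr ler_pM2l ?exprn_gt0//.
  apply: (@le_trans _ _ (d * t ^+ (j - i) *+ (C * M))).
    by rewrite mulnC mulrnA lerMn2r ctM orbT.
  rewrite -mulrnAr ler_pM2l//.
  apply: (@le_trans _ _ ((t *+ (C * M).+1) ^+ (j - i))); last first.
    by rewrite lerXn2r// nnegrE ?ltW// pmulrn_lgt0.
  rewrite exprMn_n -mulr_natr -[leRHS]mulr_natr ler_pM2l// ler_nat.
  rewrite (leq_trans (leqnSn _))// -{1}[(C * M).+1]expn1 leq_pexp2l// subn_gt0//.
exists u0, (t / ((C * N).+1)%:R); split=> //.
- by rewrite divr_gt0// ltr0n.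
- apply: contra_not NUt => /(Umul (C * N)).
  by rewrite -[X in U X]mulr_natr divfK// pnatr_eq0.
right=> w /andP[uw wt]; have w0 : 0 < w by apply: lt_le_trans uw.
rewrite wE [d * _]mulrCA [c * _]mulrC -mulrnAr ler_pM2l ?exprn_gt0//.
have : w *+ (C * N).+1 <= t by rewrite -mulr_natr -ler_pdivlMr// ltr0n.
move=> /(lerXn2r (j - i)); rewrite !nnegrE (ltW t0) pmulrn_lge0 ?(ltW w0)// => /(_ isT isT).
move=> wtn.
have dwN : d * w ^+ (j - i) *+ (C * N).+1 <= c *+ N.
  apply: le_trans tcN; rewrite -mulrnAr ler_pM2l//; apply: le_trans wtn.
  rewrite exprMn_n -mulr_natr -[leRHS]mulr_natr ler_pM2l ?exprn_gt0// ler_nat.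
  by rewrite -{1}[(C * N).+1]expn1 leq_pexp2l// subn_gt0.
have N0 : (0 < N)%N.
  rewrite lt0n; apply: contraTneq tcN => ->.
  by rewrite mulr0n -ltNge mulr_gt0.
rewrite -(@ler_pMn2r _ N)// -mulrnA; apply: le_trans dwN.
by rewrite ler_wpMn2l// mulr_ge0// ?exprn_ge0 ?ltW.
Qed.

Lemma common_interval (J : eqType) (s : seq J) (Q : J -> K -> K -> Prop) u0 v0 :
  (forall j u v u' v', Q j u v -> u <= u' -> v' <= v -> Q j u' v') ->
  0 < u0 -> U u0 -> 0 < v0 -> ~ U v0 ->
  (forall j, exists u v, [/\ 0 < u, U u, 0 < v, ~ U v & Q j u v]) ->
  exists u v, [/\ 0 < u, U u, 0 < v, ~ U v & forall j, j \in s -> Q j u v].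
Proof.
move=> Qle u00 Uu0 v00 NUv0 QE; elim: s => [|j s [u [v [u1 Uu v1 NUv Qs]]]].
  by exists u0, v0.
have [u' [v' [u1' Uu' v1' NUv' Qj]]] := QE j.
exists (Num.max u u'), (Num.min v v'); split.
- by rewrite lt_max u1.
- by case: leP.
- by rewrite lt_min v1.
- by case: leP.
- move=> k; rewrite inE => /predU1P[->|/Qs Qk].
    by apply: Qle Qj _ _; rewrite ?le_max ?ge_min lexx orbT.
  by apply: Qle Qk _ _; rewrite ?le_max ?ge_min lexx.
Qed.

(* Near the cut determined by U, the terms of q are pairwise comparable up to an
   arbitrarily large factor, hence one of them dominates. *)
Lemma constant_sign q u0 v0 : q != 0 -> 0 < u0 -> U u0 -> 0 < v0 -> ~ U v0 ->
  exists u v c, [/\ 0 < u, U u, 0 < v, ~ U v &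
    forall w, u <= w <= v -> 0 < q.[w] * c].
Proof.
move=> q0 u00 Uu0 v00 NUv0; set n := size q; have n0 : (0 < n)%N by rewrite size_poly_gt0.
pose term i w := `|q`_i| * w ^+ i.
pose Q (p : 'I_n * 'I_n) u v := p.1 != p.2 ->
  (forall w, u <= w <= v -> term p.1 w *+ n.+1 <= term p.2 w) \/
  (forall w, u <= w <= v -> term p.2 w *+ n.+1 <= term p.1 w).
have [||u [v [u1 Uu v1 NUv Quv]]] :=
    @common_interval _ (enum {: 'I_n * 'I_n}) Q u0 v0 _ u00 Uu0 v00 NUv0.
- move=> p u v u' v' Quv uu' vv' /Quv[h|h]; [left|right] => w /andP[uw wv];
    by apply: h; rewrite (le_trans uu') ?(le_trans wv).
- move=> [i j]; have [ij|ji|ij] := ltngtP i j.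
  + have [u [v [? ? ? ? h]]] := monomial_compare n.+1 ij (normr_ge0 q`_i)
      (normr_ge0 q`_j) u00 Uu0 v00 NUv0.
    by exists u, v; split.
  + have [u [v [? ? ? ? h]]] := monomial_compare n.+1 ji (normr_ge0 q`_j)
      (normr_ge0 q`_i) u00 Uu0 v00 NUv0.
    by exists u, v; split=> // _; case: h; [right|left].
  + by exists u0, v0; split=> // /eqP[]; apply: val_inj.
have uv := U_lt v1 Uu NUv.
pose i := [arg max_(i > Ordinal n0) term (i : 'I_n) u]%O.
have imax (j : 'I_n) : term j u <= term i u.
  by rewrite /i; case: arg_maxP => // k _ /(_ j); apply.
have iu0 : 0 < term i u.
  have lt_n : (n.-1 < n)%N by rewrite prednK.
  apply: lt_le_trans (imax (Ordinal lt_n)).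
  by rewrite mulr_gt0 ?exprn_gt0// normr_gt0 /= -lead_coefE lead_coef_eq0.
(* The opposite comparison, taken at [u], would make the maximal and positive term [i] smaller than
   itself. *)
have dom_i (j : 'I_n) w : j != i -> u <= w <= v -> term j w *+ n.+1 <= term i w.
  move=> ji; have [//|h|] := Quv (j, i) _ ji; first by rewrite mem_enum.
    exact: h.
  move=> h; have := h u; rewrite lexx ltW//= => /(_ isT) /le_trans /(_ (imax j)).
  by rewrite mulrS gerDl leNgt pmulrn_lgt0// iu0.
exists u, v, q`_i; split=> // w /[dup] uwv /andP[uw wv].
have w0 : 0 < w by apply: lt_le_trans uw.
have qi0 : 0 < `|q`_i| by move: iu0; rewrite pmulr_lgt0// exprn_gt0.
rewrite horner_coef (bigD1 i)//=; set r := \sum_(j < n | _) _.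
have rw : `|r| < term i w.
  have iw0 : 0 < term i w by rewrite mulr_gt0 ?exprn_gt0.
  rewrite -(@ltr_pMn2r _ n.+1)//.
  apply: (@le_lt_trans _ _ (term i w *+ n)); last by rewrite mulrS ltrDr.
  apply: (@le_trans _ _ (\sum_(j < n | j != i) term j w *+ n.+1)).
    rewrite sumrMnl lerMn2r; apply/orP; right; apply: (le_trans (ler_norm_sum _ _ _)).
    by apply: ler_sum => j _; rewrite normrM normrX (gtr0_norm w0).
  apply: (@le_trans _ _ (\sum_(j < n | j != i) term i w)).
    by apply: ler_sum => j ji; apply: dom_i.
  rewrite sumr_const ler_wpMn2l ?ltW//.
  by apply: leq_trans (max_card _) _; rewrite card_ord.
move: rw qi0; rewrite /term ltr_norml; move: q`_i (w ^+ i) => a t.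
have [a0|a0|->] := ltrgt0P a; last by rewrite ltxx.
  by move=> /andP[h1 h2] _; rewrite mulr_gt0//; lra.
by move=> /andP[h1 h2] _; rewrite nmulr_rgt0//; lra.
Qed.

End ConstantSign.

(* With no root in [a, b], the formal least upper bound of the points where p is
   negative is a cut whose distance to any element of K has a realized value:
   otherwise one term of a translate of p would dominate near that cut, and p
   would have constant sign there. *)
Lemma complete_real_closed :
  spherically_complete (K : orderedZmodType) ->
  components_complete (K : orderedZmodType) -> Num.real_closed_axiom K.
Proof.
move=> sK cK p a b ab /andP[pa pb].
have [[x xab px]|Nroot] := pselect (exists2 x, a <= x <= b & root p x); first by exists x.
exfalso; have rootN x : a <= x <= b -> p.[x] != 0.
  by move=> xab; apply/eqP => px; apply: Nroot; exists x => //; apply/rootP.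
have {}pa : p.[a] < 0 by rewrite lt_neqAle pa rootN ?lexx.
have {}pb : 0 < p.[b] by rewrite lt_neqAle eq_sym pb rootN ?lexx ?andbT.
pose D x := x < a \/ exists2 y, x <= y <= b & p.[y] < 0.
have Dlow x y : D y -> x <= y -> D x.
  move=> [ya|[w /andP[yw wb] pw]] xy; first by left; apply: le_lt_trans ya.
  by right; exists w; rewrite ?(le_trans xy).
have DNlt x y : D x -> ~ D y -> x < y.
  by move=> Dx NDy; rewrite ltNge; apply/negP => /(Dlow _ _ Dx).
have NDb : ~ D b.
  move=> [|[y /andP[by_ yb]]]; first by rewrite ltNge ab.
  by have -> : y = b; [apply/le_anti; rewrite yb|rewrite ltNge ltW].
have Da : D a by right; exists a; rewrite ?lexx.
(* No [z] in [K] fills the cut: [p] keeps the sign of [p.[z]] nearby, which puts a point above [z]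
   into [D] or keeps a point below [z] out of [D]. *)
have fill z : (forall x, D x -> x <= z) -> (forall x, ~ D x -> z <= x) -> False.
  move=> Dz zD; have az := Dz _ Da; have zb := zD _ NDb.
  have pz : p.[z] != 0 by apply: rootN; rewrite az.
  have [e e0 pe] := horner_near pz.
  have [pz0|pz0|pz0] := ltgtP p.[z] 0; last by rewrite pz0 eqxx in pz.
    have zb' : z < b.
      by rewrite lt_neqAle zb andbT; apply: contraTneq pz0 => ->; rewrite ltNge ltW.
    pose w := Num.min b (z + e).
    have zw : z < w by rewrite lt_min zb' ltrDl.
    suff /Dz : D w by rewrite leNgt zw.
    right; exists w; first by rewrite lexx ge_min lexx.
    rewrite -(nmulr_lgt0 _ pz0); apply: pe.
    by rewrite ger0_norm ?subr_ge0 ?(ltW zw)// lerBlDl ge_min lexx orbT.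
  have az' : a < z.
    by rewrite lt_neqAle az andbT; apply: contraTneq pz0 => <-; rewrite ltNge ltW.
  pose w := Num.max a (z - e).
  have wz : w < z by rewrite gt_max az' ltrBlDr ltrDl.
  have [Dw|/zD] := pselect (D w); last by rewrite leNgt wz.
  case: Dw => [|[y /andP[wy yb] py]]; first by rewrite ltNge le_max lexx.
  have yz : y <= z by apply: Dz; right; exists y; rewrite ?lexx.
  have : 0 < p.[y] * p.[z].
    apply: pe; rewrite ler0_norm ?subr_le0// opprB lerBlDl -lerBlDr.
    by apply: le_trans wy; rewrite le_max lexx orbT.
  by rewrite pmulr_lgt0// ltNge ltW.
have signs x y : D x -> ~ D y -> exists u v,
    [/\ x <= u <= y, x <= v <= y, p.[u] < 0 & 0 <= p.[v]].
  move=> Dx NDy; have [u xuy pu] : exists2 u, x <= u <= y & p.[u] < 0.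
    case: (Dx) => [xa|[w /andP[xw wb] pw]]; [exists a|exists w] => //.
      by rewrite (ltW xa) ltW// DNlt.
    by rewrite xw ltW// DNlt//; right; exists w; rewrite ?lexx.
  have [yb|by_] := leP y b; last first.
    exists u, b; split=> //; last exact: ltW.
    by rewrite (ltW by_) andbT ltW// DNlt.
  exists u, y; split=> //; first by rewrite lexx andbT ltW// DNlt.
  by rewrite leNgt; apply/negP => py; apply: NDy; right; exists y; rewrite ?lexx.
(* With the identity of [K] as matching, [matching_cut_fill] produces an element that fills the cut,
   against [fill]. *)
have eqM : matching (fun u v : (K : orderedZmodType) => u = v).
  by split=> [|? ? ? ? -> ->|? ? ->].
have no_sign (q : {poly K}) (U : set K) u0 v0 : q != 0 ->
    (forall u v, 0 < u <= v -> U v -> U u) ->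
    (forall u n, U u -> U (u *+ n.+1)) -> 0 < u0 -> U u0 -> 0 < v0 -> ~ U v0 ->
    (forall u v, 0 < u -> U u -> 0 < v -> ~ U v -> exists w1 w2,
      [/\ u <= w1 <= v, u <= w2 <= v, q.[w1] < 0 & 0 <= q.[w2]]) -> False.
  move=> q0 Ul Um u00 Uu0 v00 NUv0 sgn.
  have [u [v [c [u1 Uu v1 NUv cq]]]] := constant_sign Ul Um q0 u00 Uu0 v00 NUv0.
  have [w1 [w2 [/cq c1 /cq c2 qw1 qw2]]] := sgn _ _ u1 Uu v1 NUv.
  move: c1; rewrite nmulr_rgt0// => c0.
  by move: c2; rewrite nmulr_lgt0// ltNge qw2.
have q_neq0 (q : {poly K}) w : q.[w] = p.[b] -> q != 0.
  by move=> qw; apply: contraTneq pb => q0; rewrite -qw q0 horner0 ltxx.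
have [||z zP] := @matching_cut_fill _ _ _ eqM D Dlow _ _ sK cK; last first.
- apply: (fill z) => x; first by move=> /(zP x x erefl).1/ltW.
  by move=> /(zP x x erefl).2/ltW.
- move=> x _ _; apply: contrapT => Ngap.
  have gapN t (N : nat) : 0 < t ->
      ~ ((D (x + t) /\ ~ D (x + t *+ N)) \/ (~ D (x - t) /\ D (x - t *+ N))).
    by move=> t0 h; apply: Ngap; exists t, t; split=> //; exists N.
  have [Dx|NDx] := pselect (D x).
    have xb := DNlt _ _ Dx NDb.
    have [[u0 u00 Du0]|NU] := pselect (exists2 u, 0 < u & D (x + u)); last first.
      apply: (fill x) => y; last by move=> /(DNlt _ _ Dx)/ltW.
      move=> Dy; rewrite leNgt; apply/negP => xy; apply: NU; exists (y - x).
        by rewrite subr_gt0.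
      by rewrite addrC subrK.
    (* In the coordinate [u = w - x], the absence of a value for the distance of [x] to the cut
       makes the part below the cut stable under multiples, as [constant_sign] requires. *)
    have qE w : (p \Po ('X + x%:P)).[w] = p.[x + w].
      by rewrite horner_comp !hornerE addrC.
    apply: (no_sign (p \Po ('X + x%:P)) [set u | 0 < u /\ D (x + u)] u0 (b - x)).
    + by apply: (q_neq0 _ (b - x)); rewrite qE addrC subrK.
    + move=> u v /andP[u1 uv] [v1 Dv]; split=> //; apply: Dlow Dv _.
      by rewrite lerD2l.
    + move=> u n [u1 Du]; split; first by rewrite pmulrn_lgt0.
      by apply: contrapT => NDn; apply: (gapN u n.+1 u1); left.
    + by [].
    + by [].
    + by rewrite subr_gt0.
    + by move=> [_]; rewrite addrC subrK.
    move=> u v u1 [_ Du] v1 NDv.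
    have {}NDv : ~ D (x + v) by move=> Dv; apply: NDv.
    have [y1 [y2 [y1uv y2uv py1 py2]]] := signs _ _ Du NDv.
    exists (y1 - x), (y2 - x); rewrite !qE ![x + (_ - x)]addrC !subrK.
    by rewrite !lerBrDl !lerBlDl.
  have ax := DNlt _ _ Da NDx.
  have [[u0 u00 Du0]|NU] := pselect (exists2 u, 0 < u & ~ D (x - u)); last first.
    apply: (fill x) => y; first by move=> /DNlt/(_ NDx)/ltW.
    move=> NDy; rewrite leNgt; apply/negP => yx; apply: NU; exists (x - y).
      by rewrite subr_gt0.
    by rewrite subKr.
  have qE w : (p \Po (x%:P - 'X)).[w] = p.[x - w] by rewrite horner_comp !hornerE.
  apply: (no_sign (p \Po (x%:P - 'X)) [set u | 0 < u /\ ~ D (x - u)] u0 (x - a)).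
  + by apply: (q_neq0 _ (x - b)); rewrite qE subKr.
  + move=> u v /andP[u1 uv] [v1 NDv]; split=> // Du; apply: NDv; apply: Dlow Du _.
    by rewrite lerD2l lerN2.
  + move=> u n [u1 NDu]; split; first by rewrite pmulrn_lgt0.
    by move=> Dn; apply: (gapN u n.+1 u1); right.
  + by [].
  + by [].
  + by rewrite subr_gt0.
  + by move=> [_]; rewrite subKr.
  move=> u v u1 [_ NDu] v1 Dv.
  have {}Dv : D (x - v) by apply: contrapT => NDv; apply: Dv.
  have [y1 [y2 [y1uv y2uv py1 py2]]] := signs _ _ Dv NDu.
  exists (x - y1), (x - y2); rewrite !qE !subKr; split=> //; lra.
- move=> x _ _; exists (x / 2), (x / 2); split=> //.
  by rewrite -[LHS]mulr_natr divfK// pnatr_eq0.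
Qed.

End RealClosedness.

(** * The multiplicative group of positive elements *)

Section PositiveGroup.
Variable K : realFieldType.

(* The multiplicative group of positive elements of K, in additive notation. *)
Definition pos := {x : K | 0 < x}.

HB.instance Definition _ := SubChoice.on pos.
HB.instance Definition _ := [SubChoice_isSubOrder of pos by <: with ring_display].

Implicit Types x y : pos.

Definition pos_zero : pos := exist _ 1 (@ltr01 K).
Definition pos_opp x : pos := exist _ (val x)^-1 (etrans (invr_gt0 (val x)) (valP x)).
Definition pos_add x y : pos := exist _ (val x * val y) (mulr_gt0 (valP x) (valP y)).

Fact pos_addA : associative pos_add.
Proof. by move=> x y z; apply/val_inj/mulrA. Qed.
Fact pos_addC : commutative pos_add.
Proof. by move=> x y; apply/val_inj/mulrC. Qed.
Fact pos_add0 : left_id pos_zero pos_add.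
Proof. by move=> x; apply/val_inj/mul1r. Qed.
Fact pos_addN : left_inverse pos_zero pos_opp pos_add.
Proof. by move=> x; apply/val_inj/mulVf; rewrite gt_eqF// (valP x). Qed.

HB.instance Definition _ :=
  GRing.isZmodule.Build pos pos_addA pos_addC pos_add0 pos_addN.

Fact pos_lerD2r (z x y : pos) : x <= y -> x + z <= y + z.
Proof.
by rewrite -!Order.le_val /= => xy; rewrite ler_pM2r// (valP z).
Qed.

HB.instance Definition _ :=
  POrderedZmodule_isOrdered.Build pos pos_lerD2r (@le_total _ pos).

Lemma val_posMn x n : val (x *+ n) = val x ^+ n.
Proof. by elim: n => [|n IH] //; rewrite mulrS exprS -IH. Qed.

(** Adding the nonpositive elements to the lower side turns a cut of [pos] into a cut of [K].
    Reflections extend to them by constants, since only behaviour near the cut matters. *)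
Lemma pos_mirror_free : mirror_free K -> mirror_free (pos : orderedZmodType).
Proof.
move=> mfK D E [[d0 Dd0] [e0 Ee0] DE DltE] f g [fE gD fle gle].
pose lift (c : pos) (h : pos -> pos) (x : K) : K :=
  if insub x is Some u then val (h u) else val c.
have liftE c h (x : pos) : lift c h (val x) = val (h x) by rewrite /lift valK.
have liftN c h (x : K) : x <= 0 -> lift c h x = val c.
  by move=> x0; rewrite /lift insubF// ltNge x0.
apply: (mfK [set x | x <= 0 \/ exists2 u, D u & val u = x]
  [set x | exists2 u, E u & val u = x] _ (lift e0 f) (lift d0 g)).
  split.
  - by exists (val d0); right; exists d0.
  - by exists (val e0), e0.
  - apply/seteqP; split=> // x _; have [x0|x0] := leP x 0; first by left; left.
    have : (D `|` E) (exist _ x x0) by rewrite DE.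
    by case=> h; [left; right|right]; exists (exist _ x x0).
  - move=> x _ [x0|[u Du <-]] [v Ev <-]; first exact: le_lt_trans (valP v).
    by rewrite lt_val; apply: DltE.
split.
- move=> x [x0|[u Du <-]]; first by rewrite liftN//; exists e0.
  by rewrite liftE; exists (f u) => //; apply: fE.
- by move=> _ [u Eu <-]; right; rewrite liftE; exists (g u) => //; apply: gD.
- move=> _ [u Eu <-]; have [v Dv fv] := fle _ Eu.
  exists (val v); first by right; exists v.
  move=> x [x0|[w Dw <-]] vx.
    by have := lt_le_trans (valP v) (le_trans vx x0); rewrite ltxx.
  by rewrite liftE Order.le_val; apply: fv => //; rewrite -Order.le_val.
- move=> x [x0|[u Du <-]].
    exists (val e0); first by exists e0.
    move=> _ [u Eu <-] _; rewrite liftE; apply: le_trans x0 _; exact/ltW/(valP (g u)).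
  have [v Ev gv] := gle _ Du; exists (val v); first by exists v.
  by move=> _ [w Ew <-] wv; rewrite liftE Order.le_val; apply: gv.
Qed.

Lemma pos_divisible : mirror_free K -> divisible pos.
Proof.
move=> /pos_mirror_free mf.
by apply: complete_divisible;
  [exact: mirror_free_spherically_complete|exact: mirror_free_components_complete].
Qed.

Lemma pos_divisible_value : divisible pos -> value_divisible K.
Proof.
move=> div x n x0 n0; have [y yx] := div _ (exist _ x x0 : pos) n0.
exists (val y); rewrite -val_posMn yx /=; split; first exact: (valP y).
  exact: dom_refl.
exact: dom_refl.
Qed.

End PositiveGroup.

(** * Complements of subgroups closed under division *)

Section Complement.
Variables (E : orderedZmodType) (U : set E).

(** Take [T] maximal with trivial intersection with [U]. If [n x = t + u] with [n > 0], subtracting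
    an [n]-th part of [u] from [x] leaves an element that maximality puts into [T]; if no positive
    multiple of [x] decomposes, [x] itself can be added to [T]. *)
Lemma subgroup_complement : divisible E -> U 0 ->
  (forall x y, U x -> U y -> U (x - y)) ->
  (forall x n, (0 < n)%N -> U (x *+ n) -> U x) ->
  exists T : set E, [/\ T 0, forall x y, T x -> T y -> T (x - y),
    forall x, T x -> U x -> x = 0 &
    forall x, exists t u, [/\ T t, U u & x = t + u]].
Proof.
move=> divE U0 UB Uiso.
pose Phi (T : set E) := [/\ T 0, forall x y, T x -> T y -> T (x - y) &
  forall x, T x -> U x -> x = 0].
have [||T [[T0 TB TU] _ Tmax]] := @Zorn_above E Phi [set 0].
- by split=> // x y -> ->; rewrite /= subrr.
- move=> F [X FX] FP Ftot; split.
  + by exists X => //; have [] := FP _ FX.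
  + move=> x y [Y FY Yx] [Z FZ Zy]; have [YZ|ZY] := Ftot _ _ FY FZ.
      by exists Z => //; have [_ h _] := FP _ FZ; apply: h => //; apply: YZ.
    by exists Y => //; have [_ h _] := FP _ FY; apply: h => //; apply: ZY.
  + by move=> x [Y FY Yx] Ux; have [_ _ h] := FP _ FY; apply: h.
exists T; split=> // x; apply: contrapT => NTU.
have TN y : T y -> T (- y) by move=> Ty; rewrite -sub0r; apply: TB.
have UN y : U y -> U (- y) by move=> Uy; rewrite -sub0r; apply: UB.
have TD y z : T y -> T z -> T (y + z).
  by move=> Ty /TN /(TB _ _ Ty); rewrite opprK.
have TMn y n : T y -> T (y *+ n).
  by by move=> Ty; elim: n => // n IH; rewrite mulrS; apply: TD.
have TMz y (n : int) : T y -> T (y *~ n).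
  by case: n => n Ty; rewrite ?NegzE ?mulrNz -pmulrn; [|apply: TN]; apply: TMn.
have UMn y n : U y -> U (y *+ n).
  move=> Uy; elim: n => // n IH; rewrite mulrS -[y *+ n]opprK.
  by apply: UB => //; apply: UN.
have extend y : (forall s (k : int), T s -> U (s + y *~ k) -> s + y *~ k = 0) -> T y.
  move=> yU; apply: (Tmax [set z | exists s (k : int), T s /\ z = s + y *~ k]).
  - split.
    + by exists 0, 0; rewrite addr0.
    + move=> _ _ [s [k [Ts ->]]] [s' [k' [Ts' ->]]].
      by exists (s - s'), (k - k'); split; [apply: TB|abel].
    + by move=> _ [s [k [Ts ->]]]; apply: yU.
  - by move=> s Ts; exists s, 0; rewrite addr0.
  - by exists 0, 1; rewrite add0r.
have [[n [t [u [n0 Tt Uu xtu]]]]|Nn] := pselect (exists n t u,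
    [/\ (0 < n)%N, T t, U u & x *+ n = t + u]).
  have [w wu] := divE _ u n0.
  have Uw : U w by apply: (Uiso _ n n0); rewrite wu.
  have yt : (x - w) *+ n = t by rewrite mulrnBl wu xtu addrK.
  apply: NTU; exists (x - w), w; split=> //; last by rewrite subrK.
  apply: extend => s k Ts Uz; apply/eqP; rewrite -(@omulrn_eq0 _ n)//; apply/eqP.
  apply: TU; last exact: UMn.
  rewrite mulrnDl; apply: TD; first exact: TMn.
  have -> : (x - w) *~ k *+ n = (x - w) *+ n *~ k by abel.
  by rewrite yt; apply: TMz.
apply: NTU; exists x, 0; split=> //; last by rewrite addr0.
apply: extend => s [[|n]|n] Ts; rewrite ?NegzE ?mulrNz -?pmulrn => Uz.
- by rewrite mulr0n addr0 in Uz *; apply: TU.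
- case: Nn; exists n.+1, (- s), (s + x *+ n.+1); split=> //; first exact: TN.
  by rewrite addKr.
- case: Nn; exists n.+1, s, (- (s - x *+ n.+1)); split=> //; first exact: UN.
  by rewrite opprB addrC subrK.
Qed.

End Complement.

Section OrderedSubgroup.
Variable E : orderedZmodType.

Record osubgroup := OSubgroup {
  osub_set : set E;
  osub_set0 : osub_set 0;
  osub_setB : forall x y, osub_set x -> osub_set y -> osub_set (x - y)
}.

Variable T : osubgroup.

Definition osub := {x : E | `[< osub_set T x >]}.

HB.instance Definition _ := SubChoice.on osub.
HB.instance Definition _ := [SubChoice_isSubOrder of osub by <: with ring_display].

Implicit Types x y : osub.

Lemma osub_setP x : osub_set T (val x).
Proof. exact/asboolP/(valP x). Qed.

Fact osub_setN (x : E) : osub_set T x -> osub_set T (- x).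
Proof. by move=> /(osub_setB (osub_set0 T)); rewrite sub0r. Qed.

Fact osub_setD (x y : E) : osub_set T x -> osub_set T y -> osub_set T (x + y).
Proof. by move=> Tx /osub_setN /(osub_setB Tx); rewrite opprK. Qed.

Definition osub_zero : osub := exist _ 0 (asboolT (osub_set0 T)).
Definition osub_opp x : osub := exist _ (- val x) (asboolT (osub_setN (osub_setP x))).
Definition osub_add x y : osub :=
  exist _ (val x + val y) (asboolT (osub_setD (osub_setP x) (osub_setP y))).

Fact osub_addA : associative osub_add.
Proof. by move=> x y z; apply/val_inj/addrA. Qed.
Fact osub_addC : commutative osub_add.
Proof. by move=> x y; apply/val_inj/addrC. Qed.
Fact osub_add0 : left_id osub_zero osub_add.
Proof. by move=> x; apply/val_inj/add0r. Qed.
Fact osub_addN : left_inverse osub_zero osub_opp osub_add.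
Proof. by move=> x; apply/val_inj/addNr. Qed.

HB.instance Definition _ :=
  GRing.isZmodule.Build osub osub_addA osub_addC osub_add0 osub_addN.

Fact osub_lerD2r (z x y : osub) : x <= y -> x + z <= y + z.
Proof. by rewrite -!Order.le_val /= oler_D2r. Qed.

HB.instance Definition _ :=
  POrderedZmodule_isOrdered.Build osub osub_lerD2r (@le_total _ osub).

Lemma val_osubMn x n : val (x *+ n) = val x *+ n.
Proof. by elim: n => [|n IH] //; rewrite !mulrS -IH. Qed.

End OrderedSubgroup.

(** * Power series fields *)

Section PowerSeriesField.
Variables (R : realType) (G : orderedZmodType).
Local Notation PS := (power_series (R : realFieldType) G).
Implicit Types (c e f : PS) (g h k : G).

Lemma ps_coefM c e k : (c * e) k = \sum_(a \in [set: G]) c a * e (k - a).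
Proof. by []. Qed.

Lemma ps_coefM_single c e k g : (forall a, a != g -> c a * e (k - a) = 0) ->
  (c * e) k = c g * e (k - g).
Proof.
move=> H; rewrite ps_coefM -(@fsbig_widen _ _ _ _ [set g])// ?fsbig_set1//.
by move=> a [_ /= /eqP]; apply: H.
Qed.

Lemma lead_mul c e g h : lead c g -> lead e h ->
  lead (c * e) (g + h) /\ (c * e) (g + h) = c g * e h.
Proof.
move=> [cg cg0] [eh eh0].
have zero k a : k <= g + h -> (k != g + h) || (a != g) -> c a * e (k - a) = 0 :> R.
  move=> kgh ne; have [ag|ga] := ltP a g; first by rewrite cg0// mul0r.
  rewrite eh0 ?mulr0//.
  have [ka|] := eqVneq k (g + h).
    move: ne; rewrite ka eqxx/= => ag.
    have {}ga : g < a by rewrite lt_neqAle eq_sym ag.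
    by apply: (olt_by ga); abel.
  move=> kne; have {}kgh : k < g + h by rewrite lt_neqAle kne.
  by apply: (olt_by (oltr_D kgh ga)); abel.
have E : (c * e) (g + h) = c g * e h.
  rewrite (@ps_coefM_single _ _ _ g); first by congr (_ * e _); abel.
  by move=> a ag; apply: zero; rewrite ?lexx ?ag ?orbT.
split=> //; split; first by rewrite E mulf_neq0.
move=> k kgh; rewrite (@ps_coefM_single _ _ _ g); last first.
  by move=> a ag; apply: zero; rewrite ?(ltW kgh) ?ag ?orbT.
by apply: zero; rewrite ?(ltW kgh) ?(lt_eqF kgh).
Qed.

Lemma ps_dom_mul c e f : c != 0 -> dom (c * e) (c * f) <-> dom e f.
Proof.
move=> /leadP[i ci]; have [->|e0] := eqVneq e 0.
  by rewrite mulr0; split=> _; apply: dom0.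
have [->|f0] := eqVneq f 0.
  rewrite mulr0; split=> /dom_eq0.
    have [j ej] := leadP e0; have [/lead_neq0 ce _] := lead_mul ci ej.
    by move=> /eqP; rewrite (negbTE ce).
  by move=> ->; rewrite mulr0; apply: dom_refl.
have [[j ej] [k fk]] := (leadP e0, leadP f0).
have [ce _] := lead_mul ci ej; have [cf _] := lead_mul ci fk.
split=> ef.
  apply: (lead_dom (fun _ => archimedean_real) fk) => l lk.
  have := dom_lead ef cf; case: ej => ej ejl; case: ce => ce _.
  have [jk|kj] := ltP j k; last by move=> _; apply: ejl; apply: lt_le_trans lk kj.
  move=> /(_ (i + j)); rewrite ![i + _]addrC oltr_D2r => /(_ jk) /eqP.
  by rewrite addrC (negbTE ce).
apply: (lead_dom (fun _ => archimedean_real) cf) => l lk.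
case: ce => _; apply; apply: (lt_le_trans lk).
rewrite ![i + _]addrC oler_D2r leNgt; apply/negP => jk.
by have := dom_lead ef fk jk; apply/eqP; case: ej.
Qed.

Definition ps_mono g (r : R) : PS := hahn_mono g r.

Lemma ps_monoM g h (r s : R) : ps_mono g r * ps_mono h s = ps_mono (g + h) (r * s).
Proof.
apply: hahnP => k; rewrite (@ps_coefM_single _ _ _ g) /=; last first.
  by move=> a /negbTE ->; rewrite mul0r.
rewrite eqxx subr_eq addrC; case: eqP => // _; exact: mulr0.
Qed.

(** Multiplication by [c] shifts all values by that of [c], and a monomial times [c] can match the
    leading term of any [y]; successive approximation then makes it onto. *)
Lemma ps_inverse c : c != 0 -> exists e, c * e = 1.
Proof.
move=> c0; have [g cg] := leadP c0; have [cg0 _] := cg.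
apply: (@spherically_complete_surj PS PS (fun e => c * e)).
- exact: hahn_spherically_complete.
- by move=> x y; apply: mulrBr.
- by move=> x y; apply: ps_dom_mul.
move=> y /leadP[i yi]; have [yi0 yj0] := yi.
have yc0 : y i / c g != 0 by rewrite mulf_neq0// invr_eq0.
exists (ps_mono (i - g) (y i / c g)).
have [[_ cl] cE] := lead_mul cg (lead_hahn_mono (i - g) yc0).
have gi : g + (i - g) = i by abel.
rewrite gi in cl cE; apply: (lead_ll yi) => j; rewrite le_eqVlt => /predU1P[->|ji].
  by rewrite /= [X in _ - X]cE /= eqxx mulrC divfK// subrr.
by rewrite /= yj0// [X in _ - X]cl// subrr.
Qed.

(** The field structure lives on an alias whose ring operations and order are convertible with those
    of [power_series]. *)
Definition ps_field := PS.

HB.instance Definition _ := GRing.ComNzRing.on ps_field.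

Definition ps_inv (c : ps_field) : ps_field :=
  xget 0 [set e : ps_field | c != 0 /\ c * e = 1].

Fact ps_mulVf (c : ps_field) : c != 0 -> ps_inv c * c = 1.
Proof.
move=> c0; have [e ce] := ps_inverse c0.
rewrite /ps_inv; case: xgetP => [x _ [_ cx]|/(_ e)[]//].
by rewrite mulrC.
Qed.

Fact ps_invr0 : ps_inv 0 = 0.
Proof. by rewrite /ps_inv; case: xgetP => // x _ [/eqP]. Qed.

HB.instance Definition _ := GRing.ComNzRing_isField.Build ps_field ps_mulVf ps_invr0.

Lemma ps_mul_ge0 c e : 0 <= c -> 0 <= e -> 0 <= c * e.
Proof.
rewrite !le_eqVlt => /predU1P[<-|c0]; first by rewrite mul0r eqxx.
move=> /predU1P[<-|e0]; first by rewrite mulr0 eqxx.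
apply/orP; right; apply/hahn_gt0P.
have /hahn_gt0P[i [ci ci0]] := c0; have /hahn_gt0P[j [ej ej0]] := e0.
have lc : lead c i by split=> //; rewrite gt_eqF.
have le : lead e j by split=> //; rewrite gt_eqF.
have [[_ ce0] ceE] := lead_mul lc le.
by exists (i + j); split=> //; rewrite ceE mulr_gt0.
Qed.

Fact ps_le0_add c e : 0 <= c -> 0 <= e -> 0 <= c + e.
Proof. by move=> c0 e0; rewrite -[0]addr0; apply: oler_D. Qed.

Fact ps_le0_anti c : 0 <= c -> c <= 0 -> c = 0.
Proof. by move=> c0 c0'; apply/le_anti; rewrite c0 c0'. Qed.

Fact ps_le0_total c : (0 <= c) || (c <= 0).
Proof. exact: le_total. Qed.

Fact ps_lt_def c e : (c < e) = (e != c) && (c <= e).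
Proof. exact: lt_def. Qed.

HB.instance Definition _ := Num.IntegralDomain_isLeReal.Build ps_field
  ps_le0_add ps_mul_ge0 ps_le0_anti (@osubr_ge0 PS) ps_le0_total (@oabsN PS)
  (@ger0_oabs PS) ps_lt_def.

Lemma ps_field_spherically_complete : spherically_complete (ps_field : orderedZmodType).
Proof. exact: (@hahn_spherically_complete _ G R). Qed.

Lemma ps_field_components_complete : components_complete (ps_field : orderedZmodType).
Proof. exact: (@hahn_components_complete _ G R). Qed.

Lemma ps_field_value_divisible : divisible G -> value_divisible ps_field.
Proof.
move=> divG x n x0 n0.
have [i xi] : exists i, lead (x : PS) i by apply: leadP; rewrite gt_eqF.
have [j ji] := divG _ i n0.
have powE m : (ps_mono j 1 : ps_field) ^+ m = ps_mono (j *+ m) 1.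
  elim: m => [|m IH]; first by rewrite expr0; apply: hahnP => k; rewrite /= mulr0n.
  by rewrite exprS IH mulrS [LHS]ps_monoM mulr1.
exists (ps_mono j 1); split; first exact: hahn_mono_gt0.
  by rewrite powE ji; have [] := dom_lead_mono (oner_neq0 R) xi.
by rewrite powE ji; have [] := dom_lead_mono (oner_neq0 R) xi.
Qed.

Lemma ps_field_real_closed : divisible G -> Num.real_closed_axiom ps_field.
Proof.
move=> /ps_field_value_divisible vd; apply: complete_real_closed => //.
  exact: ps_field_spherically_complete.
exact: ps_field_components_complete.
Qed.

End PowerSeriesField.

(** * Order isomorphisms between subfields *)

Section RootIsolation.
Variable K : rcfType.
Implicit Types (q : {poly K}) (x y : K).

Lemma root_isolation q y lo hi : q.[y] != 0 -> lo < y < hi ->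
  exists r s, [/\ r < y < s, r = lo \/ root q r, s = hi \/ root q s &
    forall x, r < x < s -> ~~ root q x].
Proof.
move=> qy /andP[loy yhi].
have q0 : q != 0 by apply: contraNneq qy => ->; rewrite horner0.
have [r [ry rP Nr]] : exists r, [/\ r < y, r = lo \/ root q r &
    forall x, r < x < y -> ~~ root q x].
  have h : prev_root_spec q lo y _ _ := prev_rootP q lo y.
  case: h => [/eqP|r _ qr|c _ _]; first by rewrite (negbTE q0).
    rewrite in_itv /= => /andP[_ ry] Nr; exists r; split=> //.
    by right; apply/rootP.
  by move=> Nr; exists lo; split=> //; left.
have [s [ys sP Ns]] : exists s, [/\ y < s, s = hi \/ root q s &
    forall x, y < x < s -> ~~ root q x].
  have h : next_root_spec q y hi _ _ := next_rootP q y hi.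
  case: h => [/eqP|s _ qs|c _ _]; first by rewrite (negbTE q0).
    rewrite in_itv /= => /andP[ys _] Ns; exists s; split=> //.
    by right; apply/rootP.
  by move=> Ns; exists hi; split=> //; left.
exists r, s; split=> //; first by rewrite ry.
move=> x /andP[rx xs]; have [xy|yx|->//] := ltgtP x y.
  by apply: Nr; rewrite rx.
by apply: Ns; rewrite yx.
Qed.

Lemma noroot_same_sign q a b x y : (forall x, a < x < b -> ~~ root q x) ->
  a < x < b -> a < y < b -> (0 < q.[x]) = (0 < q.[y]).
Proof.
move=> Nq; wlog xy : x y / x <= y => [wlg|].
  by move=> ax ay; have [/wlg|/ltW /wlg ->] := leP x y => //; apply.
move=> /[dup] axb /andP[ax xb] /[dup] ayb /andP[ay yb].
have := Nq _ axb; have := Nq _ ayb; rewrite /root => qy qx.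
have [qxy|] := leP 0 (q.[x] * q.[y]).
  have {}qxy : 0 < q.[x] * q.[y] by rewrite lt_neqAle eq_sym mulf_neq0.
  have [x0|x0|x0] := ltgtP q.[x] 0; last by rewrite x0 eqxx in qx.
    by move: qxy; rewrite nmulr_rgt0// => /ltW; rewrite leNgt => /negbTE ->.
  by move: qxy; rewrite pmulr_rgt0// => ->.
move=> /(poly_ivtoo xy)[z]; rewrite in_itv => /= /andP[xz zy].
by apply: contraTeq => _; apply: Nq; rewrite (lt_trans ax) ?(lt_trans zy).
Qed.

Lemma deriv_gt0_mono q a b : (forall x, a < x < b -> 0 < q^`().[x]) ->
  {in [pred x | a <= x <= b] &, {mono horner q : x y / x < y}}.
Proof.
by move=> q'; apply: ltr_horner => x; rewrite in_itv => /q'.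
Qed.

End RootIsolation.

Section RealClosedField.
Variable K : realFieldType.
Hypothesis closedK : Num.real_closed_axiom K.
Implicit Types (q : {poly K}) (x y : K).

Let F : rcfType := HB.pack_for rcfType K (Num.RealField_isClosed.Build K closedK).

Lemma closed_root_isolation q y lo hi : q.[y] != 0 -> lo < y < hi ->
  exists r s, [/\ r < y < s, r = lo \/ root q r, s = hi \/ root q s &
    forall x, r < x < s -> ~~ root q x].
Proof. exact: (@root_isolation F). Qed.

Lemma closed_same_sign q a b x y : (forall x, a < x < b -> ~~ root q x) ->
  a < x < b -> a < y < b -> (0 < q.[x]) = (0 < q.[y]).
Proof. exact: (@noroot_same_sign F). Qed.

Lemma closed_deriv_mono q a b : (forall x, a < x < b -> 0 < q^`().[x]) ->
  {in [pred x | a <= x <= b] &, {mono horner q : x y / x < y}}.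
Proof. exact: (@deriv_gt0_mono F). Qed.

End RealClosedField.

(** * Isomorphisms between ordered subrings *)

Section RingMatchings.
Variables K L : realFieldType.
Implicit Types (P Q : K -> L -> Prop).

Definition ring_matching P :=
  [/\ matching P, P 1 1 & forall a b c d, P a b -> P c d -> P (a * c) (b * d)].

Definition maximal_ring_matching P :=
  ring_matching P /\ forall Q, ring_matching Q -> matching_sub P Q -> matching_sub Q P.

Lemma maximal_ring_matching_exists P0 : ring_matching P0 ->
  exists2 P, maximal_ring_matching P & matching_sub P0 P.
Proof.
move=> mP0.
have [||X [mX P0X Xmax]] := @Zorn_above _
    [set X : set (K * L) | ring_matching (fun a b => X (a, b))] [set p | P0 p.1 p.2].
- by [].
- move=> F [X0 FX0] FP Ftot; split.
  + by apply: matching_bigcup => // [|X /FP[]]; first by exists X0.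
  + by exists X0 => //; have [] := FP _ FX0.
  + move=> a b c d [X FX Xab] [Y FY Ycd].
    have [XY|YX] := Ftot _ _ FX FY.
      by exists Y => //; have [_ _ h] := FP _ FY; apply: h => //; apply: XY.
    by exists X => //; have [_ _ h] := FP _ FX; apply: h => //; apply: YX.
exists (fun a b => X (a, b)); last by move=> a b ab; apply: (P0X (a, b)).
split=> // Q mQ XQ a b Qab; apply: (Xmax [set p | Q p.1 p.2]) => //.
by move=> [c d] /= /XQ.
Qed.

End RingMatchings.

Lemma ring_matching_flip (K L : realFieldType) (P : K -> L -> Prop) :
  ring_matching P -> ring_matching (fun b a => P a b).
Proof.
move=> [mP P1 PM]; split=> //; first exact: matching_flip.
by move=> b a d c; apply: PM.
Qed.

Lemma maximal_ring_matching_flip (K L : realFieldType) (P : K -> L -> Prop) :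
  maximal_ring_matching P -> maximal_ring_matching (fun b a => P a b).
Proof.
move=> [mP Pmax]; split=> [|Q mQ PQ b a Qba]; first exact: ring_matching_flip.
apply: (Pmax (fun a b => Q b a)) Qba; first exact: ring_matching_flip.
by move=> c d /PQ.
Qed.

Section MaximalRingMatchings.
Variables (K L : realFieldType) (P : K -> L -> Prop).
Hypothesis maxP : maximal_ring_matching P.

Let rP : ring_matching P. Proof. by case: maxP. Qed.
Let mP : matching P. Proof. by case: rP. Qed.
Let P0 : P 0 0. Proof. exact: matching0. Qed.
Let P1 : P 1 1. Proof. by case: rP. Qed.
Let PM a b c d : P a b -> P c d -> P (a * c) (b * d).
Proof. by case: rP => _ _; apply. Qed.

Lemma matching_eq0 a b : P a b -> (a == 0) = (b == 0).
Proof. by move=> ab; rewrite (matching_eq mP ab P0). Qed.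

(** The quotients of matched pairs form a ring matching that extends [P]. By maximality the domain
    of [P] is thus a subfield. *)
Lemma max_ring_matchingV a b : P a b -> P a^-1 b^-1.
Proof.
move=> ab; have [a0|a0] := eqVneq a 0.
  have /eqP b0 : b == 0 by rewrite -(matching_eq0 ab) a0.
  by rewrite a0 b0 !invr0.
pose Q x w := exists a b c d, [/\ P a b, P c d, c != 0, x = a / c & w = b / d].
have [_ Pmax] := maxP; apply: (Pmax Q).
- split.
  + split.
    * by exists 0, 0, 1, 1; split; rewrite ?oner_neq0 ?mul0r.
    * move=> _ _ _ _ [x [w [c [d [xw cd c0 -> ->]]]]] [x' [w' [c' [d' [xw' cd' c0' -> ->]]]]].
      have d0 : d != 0 by rewrite -(matching_eq0 cd).
      have d0' : d' != 0 by rewrite -(matching_eq0 cd').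
      exists (x * c' - x' * c), (w * d' - w' * d), (c * c'), (d * d').
      split; [|exact: PM|by rewrite mulf_neq0| |].
      - by apply: (matchingB mP); apply: PM.
      - by field; rewrite c0 c0'.
      - by field; rewrite d0 d0'.
    * move=> _ _ [x [w [c [d [xw cd c0 -> ->]]]]].
      have d0 : d != 0 by rewrite -(matching_eq0 cd).
      have divE (F : realFieldType) (u v : F) : v != 0 -> (0 < u / v) = (0 < u * v).
        move=> v0; have -> : u / v = u * v * v^-1 ^+ 2 by field.
        by rewrite pmulr_lgt0// exprn_even_gt0// invr_eq0 v0.
      by rewrite !divE//; apply: (matching_sgn mP); apply: PM.
  + by exists 1, 1, 1, 1; rewrite !divr1 oner_neq0.
  + move=> _ _ _ _ [x [w [c [d [xw cd c0 -> ->]]]]] [x' [w' [c' [d' [xw' cd' c0' -> ->]]]]].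
    exists (x * x'), (w * w'), (c * c'), (d * d').
    by split; [exact: PM|exact: PM|exact: mulf_neq0|rewrite invfM mulrACA|rewrite invfM mulrACA].
- by move=> x w xw; exists x, w, 1, 1; split; rewrite ?oner_neq0 ?divr1.
- by exists 1, 1, a, b; split=> //; rewrite mul1r.
Qed.

Let PV := max_ring_matchingV.
Let P_div a b c d : P a b -> P c d -> P (a / c) (b / d).
Proof. by move=> ab /PV; apply: PM. Qed.

Lemma max_ring_matching_half a b : P a b -> exists c d, P c d /\ c *+ 2 = a.
Proof.
move=> ab; exists (a / 2), (b / 2); split; last first.
  by rewrite -[LHS]mulr_natr divfK// pnatr_eq0.
by apply: P_div => //; apply: (matchingMn mP 2 P1).
Qed.

Definition poly_matching (q1 : {poly K}) (q2 : {poly L}) := forall i, P q1`_i q2`_i.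
Local Notation PP := poly_matching.

Lemma poly_matchingB p1 p2 q1 q2 : PP p1 p2 -> PP q1 q2 -> PP (p1 - q1) (p2 - q2).
Proof. by move=> p q i; rewrite !coefB; apply: matchingB. Qed.

Lemma poly_matchingM p1 p2 q1 q2 : PP p1 p2 -> PP q1 q2 -> PP (p1 * q1) (p2 * q2).
Proof.
move=> p q i; rewrite !coefM; elim/big_ind2: _ => // [a b c d|j _].
  exact: matchingD.
exact: PM.
Qed.

Lemma poly_matchingC a b : P a b -> PP a%:P b%:P.
Proof. by move=> ab i; rewrite !coefC; case: eqP. Qed.

Lemma poly_matchingX : PP 'X 'X.
Proof. by move=> i; rewrite !coefX; case: eqP. Qed.

Lemma poly_matchingD p1 p2 q1 q2 : PP p1 p2 -> PP q1 q2 -> PP (p1 + q1) (p2 + q2).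
Proof. by move=> p q i; rewrite !coefD; apply: matchingD. Qed.

Lemma poly_matching_deriv q1 q2 : PP q1 q2 -> PP q1^`() q2^`().
Proof. by move=> q i; rewrite !coef_deriv; apply: matchingMn. Qed.

Lemma poly_matching_drop n q1 q2 : PP q1 q2 -> PP (drop_poly n q1) (drop_poly n q2).
Proof. by move=> q i; rewrite !coef_drop_poly. Qed.

Lemma poly_matching_size q1 q2 n : PP q1 q2 -> (size q1 <= n)%N = (size q2 <= n)%N.
Proof.
move=> q; apply/leq_sizeP/leq_sizeP => h j /h /eqP; have := matching_eq0 (q j).
  by move=> -> /eqP.
by move=> <- /eqP.
Qed.

Lemma poly_matching_eq0 q1 q2 : PP q1 q2 -> (q1 == 0) = (q2 == 0).
Proof. by move=> q; rewrite -!size_poly_leq0 (poly_matching_size _ q). Qed.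

Lemma poly_matching_horner q1 q2 a b : PP q1 q2 -> P a b -> P q1.[a] q2.[b].
Proof.
move=> q ab; have sq : size q2 = size q1.
  apply/eqP; rewrite eqn_leq (poly_matching_size _ q) leqnn andbT.
  by rewrite -(poly_matching_size _ q).
rewrite !horner_coef sq; elim/big_ind2: _ => // [x w y z|j _].
  exact: matchingD.
apply: PM => //; elim: (j : nat) => [|n IH]; first by rewrite !expr0.
by rewrite !exprS; apply: PM.
Qed.

(** Sending [q1.[y]] to [q2.[z]] extends [P]; agreement of signs makes this well defined as well as
    monotone. *)
Lemma max_ring_matching_adjoin y z :
  (forall q1 q2, PP q1 q2 -> (0 < q1.[y]) = (0 < q2.[z])) -> P y z.
Proof.
move=> sgn; have [_ Pmax] := maxP.
apply: (Pmax (fun x w => exists q1 q2, [/\ PP q1 q2, x = q1.[y] & w = q2.[z]])).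
- split.
  + split.
    * by exists 0, 0; rewrite !horner0; split=> // i; rewrite !coef0.
    * move=> _ _ _ _ [q1 [q2 [q -> ->]]] [r1 [r2 [r -> ->]]].
      by exists (q1 - r1), (q2 - r2); rewrite !hornerE; split=> //; apply: poly_matchingB.
    * by move=> _ _ [q1 [q2 [q -> ->]]]; apply: sgn.
  + exists 1%:P, 1%:P; rewrite !hornerC; split=> //; exact: poly_matchingC.
  + move=> _ _ _ _ [q1 [q2 [q -> ->]]] [r1 [r2 [r -> ->]]].
    by exists (q1 * r1), (q2 * r2); rewrite !hornerM; split=> //; apply: poly_matchingM.
- by move=> a b ab; exists a%:P, b%:P; rewrite !hornerC; split=> //; apply: poly_matchingC.
- by exists 'X, 'X; rewrite !hornerX; split=> //; apply: poly_matchingX.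
Qed.

End MaximalRingMatchings.

(** * Matching of roots by induction on the degree *)

Definition roots_matched (K L : realFieldType) (P : K -> L -> Prop) n :=
  forall q1 q2, poly_matching P q1 q2 -> q1 != 0 -> (size q1 <= n)%N ->
  forall x, root q1 x -> exists w, P x w.

Section RootsMatched.
Variables (K L : realFieldType) (P : K -> L -> Prop).
Hypothesis closedK : Num.real_closed_axiom K.
Hypothesis closedL : Num.real_closed_axiom L.
Hypothesis maxP : maximal_ring_matching P.
Hypothesis fullP : value_full P.

Let mP : matching P. Proof. by case: maxP => -[]. Qed.
Let P0 : P 0 0. Proof. exact: matching0. Qed.
Let PM a b c d : P a b -> P c d -> P (a * c) (b * d).
Proof. by case: maxP => -[_ _ h] _; apply: h. Qed.
Local Notation PP := (poly_matching P).

Lemma domain_bounds y : (forall b, ~ P y b) -> exists lo hi lo' hi',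
  [/\ P lo lo', P hi hi' & lo < y < hi].
Proof.
move=> Ny; have [|t [h [th yt ty]]] := fullP (_ : y != 0).
  by apply/eqP => y0; apply: (Ny 0); rewrite y0.
have [N yN] := yt; rewrite !oabs_norm in yN.
have PN := matchingMn mP N.+1 (matching_abs mP th); rewrite oabs_norm in PN.
have yN1 : `|y| < `|t| *+ N.+1.
  apply: (le_lt_trans yN); rewrite mulrS ltrDr normr_gt0.
  apply/eqP => t0; move: yt; rewrite t0 => /dom_eq0 y0; apply: (Ny 0).
  by rewrite [y]y0.
exists (- (`|t| *+ N.+1)), (`|t| *+ N.+1).
exists (- (oabs h *+ N.+1)), (oabs h *+ N.+1); split=> //; first exact: matchingN.
by rewrite -ltr_norml.
Qed.

Lemma domain_isolation n q1 q2 y : roots_matched P n -> PP q1 q2 -> q1 != 0 ->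
  (size q1 <= n)%N -> (forall b, ~ P y b) -> exists r r' s s',
  [/\ P r r', P s s', r < y < s & forall x, r < x < s -> ~~ root q1 x].
Proof.
move=> Rn q q0 sq Ny; have [lo [hi [lo' [hi' [lolo' hihi' lyh]]]]] := domain_bounds Ny.
have qy : q1.[y] != 0.
  by apply/eqP => qy; have [|w /Ny//] := Rn _ _ q q0 sq y; apply/rootP.
have [r [s [rys rP sP Nrs]]] := closed_root_isolation closedK qy lyh.
have [r' rr'] : exists r', P r r'.
  by case: rP => [->|/(Rn _ _ q q0 sq)//]; exists lo'.
have [s' ss'] : exists s', P s s'.
  by case: sP => [->|/(Rn _ _ q q0 sq)//]; exists hi'.
by exists r, r', s, s'.
Qed.

Lemma noroot_matched n q1 q2 r r' s s' : roots_matched (fun b a => P a b) n ->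
  PP q1 q2 -> q1 != 0 -> (size q1 <= n)%N -> P r r' -> P s s' ->
  (forall x, r < x < s -> ~~ root q1 x) -> forall w, r' < w < s' -> ~~ root q2 w.
Proof.
move=> Rn q q0 sq rr' ss' Nrs w w_in; apply/negP => qw.
have [|||x xw] := Rn q2 q1 _ _ _ w qw.
- by move=> i; apply: q.
- by rewrite -(poly_matching_eq0 maxP q).
- by rewrite -(poly_matching_size maxP _ q).
have /Nrs : r < x < s by rewrite (matching_lt mP rr' xw) (matching_lt mP xw ss').
rewrite /root (matching_eq0 maxP (poly_matching_horner maxP q xw)).
by move: qw; rewrite /root => ->.
Qed.

(** [y] lies between elements of the domain that enclose no root of [q1], so [q1] has the same sign
    at [y] as at their midpoint, which is matched. The same holds for [z] in the matching
    interval. *)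
Lemma matched_sign n q1 q2 y z : roots_matched P n ->
  roots_matched (fun b a => P a b) n -> (forall b, ~ P y b) ->
  (forall a b, P a b -> (a < y) = (b < z) /\ (y < a) = (z < b)) ->
  PP q1 q2 -> (size q1 <= n)%N -> (0 < q1.[y]) = (0 < q2.[z]).
Proof.
move=> Rn Rn' Ny yz q sq; have [q0|q0] := eqVneq q1 0.
  have /eqP -> : q2 == 0 by rewrite -(poly_matching_eq0 maxP q) q0.
  by rewrite q0 !horner0 !ltxx.
have [r [r' [s [s' [rr' ss' /[dup] rys /andP[ry ys] Nrs]]]]] :=
  domain_isolation Rn q q0 sq Ny.
have [c [d [cd c2]]] := max_ring_matching_half maxP (matchingD mP rr' ss').
have rcs : r < c < s by move: (lt_trans ry ys) c2; rewrite mulr2n; lra.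
rewrite (closed_same_sign closedK Nrs rys rcs).
have Nrs' := noroot_matched Rn' q q0 sq rr' ss' Nrs.
rewrite (@closed_same_sign _ closedL q2 r' s' z d Nrs').
- exact: (matching_sgn mP (poly_matching_horner maxP q cd)).
- by rewrite -(yz _ _ rr').1 -(yz _ _ ss').2 ry.
- by rewrite -(matching_lt mP rr' cd) -(matching_lt mP cd ss').
Qed.

(* A root y in K of minimal degree corresponds to the root in L which lies in the
   matching interval, free of critical points, and realizes the same cut. *)
Lemma roots_matchedS n : roots_matched P n -> roots_matched (fun b a => P a b) n ->
  roots_matched P n.+1.
Proof.
move=> Rn Rn' p1 p2 pp p0 sp y py; apply: contrapT => Ny_.
have Ny b : ~ P y b by move=> yb; apply: Ny_; exists b.
have {}sp : size p1 = n.+1.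
  apply/eqP; rewrite eqn_leq sp ltnNge; apply/negP => sn.
  exact: Ny_ (Rn _ _ pp p0 sn _ py).
have n0 : n != 0%N.
  apply/eqP => n0; move: sp; rewrite n0 => /eqP/size_poly1P[c c0 pc].
  by move: py; rewrite pc rootC (negbTE c0).
have p'p' := poly_matching_deriv maxP pp.
have sp' : size p1^`() = n by rewrite size_deriv sp.
have p'0 : p1^`() != 0 by rewrite -size_poly_eq0 sp'.
(* [y] is not a root of the derivative, since roots of that degree are matched already; a change of
   sign of [p1] and [p2] makes the derivative positive. *)
wlog p'y : p1 p2 pp p0 py sp p'p' sp' p'0 / 0 < p1^`().[y] => [wlg|].
  have [|p'y|p'y] := ltgtP p1^`().[y] 0; first 1 last.
  - exact: (wlg p1 p2).
  - have [w yw] := Rn _ _ p'p' p'0 (eq_leq sp') y (introT rootP p'y).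
    exact: (Ny w).
  move=> p'y; apply: (wlg (- p1) (- p2)); rewrite ?derivN ?size_polyN ?oppr_eq0 ?rootN//.
  - by move=> i; rewrite !coefN; apply: matchingN.
  - by move=> i; rewrite !coefN; apply: matchingN.
  - by rewrite hornerN oppr_gt0.
have [r [r' [s [s' [rr' ss' /[dup] rys /andP[ry ys] Nrs]]]]] :=
  domain_isolation Rn p'p' p'0 (eq_leq sp') Ny.
have [c [d [cd c2]]] := max_ring_matching_half maxP (matchingD mP rr' ss').
have rcs : r < c < s by move: (lt_trans ry ys) c2; rewrite mulr2n; lra.
have Nrs' := noroot_matched Rn' p'p' p'0 (eq_leq sp') rr' ss' Nrs.
have p'1 x : r < x < s -> 0 < p1^`().[x].
  by move=> xrs; rewrite (closed_same_sign closedK Nrs xrs rys).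
have rds : r' < d < s'.
  by rewrite -(matching_lt mP rr' cd) -(matching_lt mP cd ss').
have p'2 w : r' < w < s' -> 0 < p2^`().[w].
  move=> wrs; rewrite (closed_same_sign closedL Nrs' wrs rds).
  rewrite -(matching_sgn mP (poly_matching_horner maxP p'p' cd)).
  exact: p'1.
have mono1 := closed_deriv_mono closedK p'1.
have mono2 := closed_deriv_mono closedL p'2.
have rs := lt_trans ry ys.
have rs' : r' < s' by rewrite -(matching_lt mP rr' ss').
have PPh a b : P a b -> P p1.[a] p2.[b] by apply: poly_matching_horner.
have [r'in s'in] : r' \in [pred x | r' <= x <= s'] /\ s' \in [pred x | r' <= x <= s'].
  by rewrite !inE !lexx !ltW.
have [rin sin] : r \in [pred x | r <= x <= s] /\ s \in [pred x | r <= x <= s].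
  by rewrite !inE !lexx !ltW.
have yin : y \in [pred x | r <= x <= s] by rewrite inE !ltW.
have py0 : p1.[y] = 0 by apply/rootP.
have pr : p2.[r'] < 0.
  by rewrite -(matching_lt mP (PPh _ _ rr') P0) -py0 mono1.
have ps : 0 < p2.[s'].
  by rewrite -(matching_sgn mP (PPh _ _ ss')) -py0 mono1.
have [|z /andP[r'z zs'] /rootP pz] := closedL (ltW rs') (_ : p2.[r'] <= 0 <= p2.[s']).
  by rewrite !ltW.
have {}r'z : r' < z.
  by rewrite lt_neqAle r'z andbT; apply: contraTneq pr => ->; rewrite pz ltxx.
have {}zs' : z < s'.
  by rewrite lt_neqAle zs' andbT; apply: contraTneq ps => <-; rewrite pz ltxx.
have zin : z \in [pred x | r' <= x <= s'] by rewrite inE !ltW.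
(* Inside the interval [p1] and [p2] are increasing, so the position of [a] relative to [y] is read
   off from the sign of [p1.[a]], which is that of [p2.[b]]. *)
have yz a b : P a b -> (a < y) = (b < z) /\ (y < a) = (z < b).
  move=> ab; have [ra|ar] := leP r a; last first.
    have br : b < r' by rewrite -(matching_lt mP ab rr').
    have [ay bz] := (lt_trans ar ry, lt_trans br r'z).
    by rewrite ay bz !ltNge !ltW.
  have [as_|sa] := leP a s; last first.
    have sb : s' < b by rewrite -(matching_lt mP ss' ab).
    have [ya zb] := (lt_trans ys sa, lt_trans zs' sb).
    by rewrite ya zb !ltNge !ltW.
  have ain : a \in [pred x | r <= x <= s] by rewrite inE ra.
  have bin : b \in [pred x | r' <= x <= s'].
    by rewrite inE -(matching_le mP rr' ab) ra -(matching_le mP ab ss').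
  rewrite -(mono1 a y)// -(mono1 y a)// -(mono2 b z)// -(mono2 z b)// py0 pz.
  by rewrite (matching_lt mP (PPh _ _ ab) P0) (matching_lt mP P0 (PPh _ _ ab)).
apply: (Ny z); apply: (max_ring_matching_adjoin maxP) => q1 q2 qq.
(* As [y] and [z] are roots of [p1] and [p2], values of polynomials reduce to those of degree less
   than [n], the degree of [p1]. The reduction follows the Horner scheme. *)
have [t1 [t2 [tt st -> ->]]] : exists t1 t2,
    [/\ PP t1 t2, (size t1 <= n)%N, q1.[y] = t1.[y] & q2.[z] = t2.[z]].
  have [m] := ubnP (size q1); elim: m q1 q2 qq => // m IH q1 q2 qq /ltnSE sqm.
  have [s1|s1] := leqP (size q1) n; first by exists q1, q2.
  have qd := poly_matching_drop 1 qq.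
  have [|t1 [t2 [tt st e1 e2]]] := IH _ _ qd.
    by rewrite size_drop_poly (leq_trans _ sqm)// ltn_subrL (leq_ltn_trans _ s1).
  have horner_split (F : realFieldType) (q : {poly F}) x :
      q.[x] = q`_0 + (drop_poly 1 q).[x] * x.
    rewrite -{1}(poly_take_drop 1 q) hornerD hornerM hornerXn expr1; congr (_ + _).
    by rewrite [take_poly 1 q]size1_polyC ?size_take_poly// coef_take_poly hornerC.
  pose u1 := t1 * 'X + (q1`_0)%:P; pose u2 := t2 * 'X + (q2`_0)%:P.
  have uu : PP u1 u2.
    apply: (poly_matchingD maxP); last exact: poly_matchingC.
    by apply: (poly_matchingM maxP) => //; apply: poly_matchingX.
  have su : (size u1 <= n.+1)%N.
    apply: leq_trans (size_polyD _ _) _; rewrite geq_max; apply/andP; split.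
      by apply: leq_trans (size_polyMleq _ _) _; rewrite size_polyX addn2.
    by apply: leq_trans (size_polyC_leq1 _) _.
  have pp0 : p1`_n != 0.
    by have := lead_coef_eq0 p1; rewrite lead_coefE sp /= => ->.
  (* [u1] has degree at most [n]; subtracting a multiple of [p1] removes the coefficient of degree
     [n] without changing the value at [y]. *)
  pose v1 := u1 - (u1`_n / p1`_n)%:P * p1; pose v2 := u2 - (u2`_n / p2`_n)%:P * p2.
  exists v1, v2; split.
  - apply: (poly_matchingB maxP) => //; apply: (poly_matchingM maxP) => //.
    apply: poly_matchingC => //; apply: PM => //; exact: (max_ring_matchingV maxP).
  - apply/leq_sizeP => j; rewrite leq_eqVlt => /predU1P[<-|nj].
      by rewrite coefB coefCM divfK// subrr.
    rewrite coefB coefCM [u1`_j]nth_default ?(leq_trans su)//.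
    by rewrite [p1`_j]nth_default ?sp// mulr0 subrr.
  - by rewrite /v1 /u1 !hornerE py0 mulr0 subr0 horner_split e1 addrC.
  - by rewrite /v2 /u2 !hornerE pz mulr0 subr0 horner_split e2 addrC.
exact: matched_sign Rn Rn' Ny yz tt st.
Qed.

End RootsMatched.

Lemma all_roots_matched (K L : realFieldType) (P : K -> L -> Prop) :
  Num.real_closed_axiom K -> Num.real_closed_axiom L -> maximal_ring_matching P ->
  value_full P -> value_full (fun b a => P a b) ->
  forall n, roots_matched P n /\ roots_matched (fun b a => P a b) n.
Proof.
move=> closedK closedL maxP fullK fullL; elim=> [|n [Rn Rn']].
  by split=> q1 q2 _ q0; rewrite leqn0 size_poly_eq0 (negbTE q0).
split; first exact: (roots_matchedS closedK closedL maxP fullK Rn Rn').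
exact: (roots_matchedS closedL closedK (maximal_ring_matching_flip maxP) fullL Rn' Rn).
Qed.

Lemma maximal_ring_matching_total (K L : realFieldType) (P : K -> L -> Prop) y :
  Num.real_closed_axiom K -> Num.real_closed_axiom L ->
  spherically_complete (L : orderedZmodType) ->
  components_complete (L : orderedZmodType) -> maximal_ring_matching P ->
  value_full P -> value_full (fun b a => P a b) -> exists z, P y z.
Proof.
move=> closedK closedL sL cL maxP fullK fullL; apply: contrapT => Ny_.
have Ny b : ~ P y b by move=> yb; apply: Ny_; exists b.
have [[mP _ _] _] := maxP.
have half := max_ring_matching_half maxP.
have [z yz] := matching_point mP half fullK sL cL Ny.
apply: (Ny z); apply: (max_ring_matching_adjoin maxP) => q1 q2 q.
have [Rn Rn'] := all_roots_matched closedK closedL maxP fullK fullL (size q1).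
exact: matched_sign Rn Rn' Ny yz q (leqnn _).
Qed.

Lemma ordered_field_iso (K L : realFieldType) (P0 : K -> L -> Prop) :
  Num.real_closed_axiom K -> Num.real_closed_axiom L ->
  spherically_complete (K : orderedZmodType) ->
  components_complete (K : orderedZmodType) ->
  spherically_complete (L : orderedZmodType) ->
  components_complete (L : orderedZmodType) ->
  ring_matching P0 -> value_full P0 -> value_full (fun b a => P0 a b) ->
  exists f : K -> L, [/\ zmod_morphism f, monoid_morphism f, bijective f &
    {mono f : x y / x <= y}].
Proof.
move=> closedK closedL sK cK sL cL rP0 full0 full0'.
have [P maxP P0P] := maximal_ring_matching_exists rP0.
have [[mP P1 PM] _] := maxP.
have fullK : value_full P.
  by move=> x /full0[t [h [/P0P th xt tx]]]; exists t, h.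
have fullL : value_full (fun b a => P a b).
  by move=> x /full0'[t [h [/P0P th xt tx]]]; exists t, h.
have [||f [fP fbij fmono]] := matching_iso mP.
- by move=> y; apply: maximal_ring_matching_total.
- move=> y; apply: (@maximal_ring_matching_total _ _ (fun b a => P a b)) => //.
  exact: maximal_ring_matching_flip.
exists f; split=> // [x y|].
  by apply/esym/fP/(matchingB mP); apply/fP.
by split=> [|x y]; apply/esym/fP => //; apply: PM; apply/fP.
Qed.

(** * A multiplicative copy of the value group and the embedding of power series monomials *)

Section MonomialGroup.
Variable K : realFieldType.
Hypothesis mfK : mirror_free K.

(** The positive units of the natural valuation ring. *)
Definition unit_values : set (pos K) :=
  [set x | exists n : nat, val x <= n%:R /\ (val x)^-1 <= n%:R].

Lemma unit_values_complement : exists T : set (pos K),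
  [/\ T 0, forall x y, T x -> T y -> T (x - y),
    forall x, T x -> unit_values x -> x = 0 &
    forall x, exists t u, [/\ T t, unit_values u & x = t + u]].
Proof.
apply: subgroup_complement; first exact: pos_divisible.
- by exists 1%N; rewrite /= invr1.
- move=> x y [m [xm xm']] [n [yn yn']]; exists (m * n)%N => /=.
  have [x0 y0] := (valP x, valP y).
  rewrite invfM invrK natrM; split; apply: ler_pM => //; by rewrite ?invr_ge0 ltW.
- move=> x n n0 [m []]; rewrite val_posMn => xm xm'.
  (* The larger of [x] and its inverse is at most its own [n]-th power, hence at most [m]; the
     smaller is at most 1. *)
  have x0 := valP x; exists m.+1; rewrite -addn1 natrD.
  have [x1|x1] := leP 1 (val x).
    have xV : (val x)^-1 <= 1 by rewrite invf_le1.
    split; last by rewrite (le_trans xV)// lerDr.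
    by rewrite (le_trans (ler_eXnr n0 x1))// (le_trans xm)// lerDl.
  split; first by rewrite (le_trans (ltW x1))// lerDr.
  have xV : 1 <= (val x)^-1 by rewrite invf_ge1// ltW.
  by rewrite (le_trans (ler_eXnr n0 xV))// exprVn (le_trans xm')// lerDl.
Qed.

Lemma unit_valuesMn x n : unit_values x -> unit_values (x *+ n).
Proof.
move=> [m [xm xm']]; exists (m ^ n)%N; rewrite val_posMn natrX -exprVn.
by split; rewrite lerXn2r// ?nnegrE ?invr_ge0 ?ler0n// ltW// (valP x).
Qed.

End MonomialGroup.

Lemma span_ring_matching (K L : realFieldType) (I : zmodType) (t : I -> K) (h : I -> L) :
  matching (span_matching t h) -> t 0 = 1 -> h 0 = 1 ->
  {morph t : i j / i + j >-> i * j} -> {morph h : i j / i + j >-> i * j} ->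
  ring_matching (span_matching t h).
Proof.
move=> mP t0 h0 tD hD; split=> //.
  by exists [:: (1, 0)]; rewrite !big_seq1 !mulr1z t0 h0.
move=> _ _ _ _ [s [-> ->]] [s' [-> ->]].
have prodE (F : realFieldType) (u : I -> F) : {morph u : i j / i + j >-> i * j} ->
    (\sum_(p <- s) u p.2 *~ p.1) * (\sum_(p <- s') u p.2 *~ p.1) =
    \sum_(p <- [seq (p.1 * q.1, p.2 + q.2) | p <- s, q <- s']) u p.2 *~ p.1.
  move=> uD; rewrite big_allpairs_dep big_distrlr /=; apply: eq_bigr => p _.
  by apply: eq_bigr => q _; rewrite uD; ring.
by exists [seq (p.1 * q.1, p.2 + q.2) | p <- s, q <- s']; rewrite !prodE.
Qed.

Lemma symmetrically_complete_field (R : realType) (K : realFieldType) :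
  symmetrically_complete K ->
  Num.real_closed_axiom K /\ exists G : orderedZmodType, divisible G /\
    exists f : {rmorphism K -> power_series (R : realFieldType) G},
      bijective f /\ {mono f : x y / x <= y}.
Proof.
move=> /symmetrically_complete_mirror_free mfK.
have sK := @mirror_free_spherically_complete (K : orderedZmodType) mfK.
have cK := @mirror_free_components_complete (K : orderedZmodType) mfK.
have closedK : Num.real_closed_axiom K.
  by apply: complete_real_closed => //; apply/pos_divisible_value/pos_divisible.
split=> //; have [T [T0 TB TU TUsum]] := unit_values_complement mfK.
pose G : orderedZmodType := osub (OSubgroup T0 TB); exists G.
(* Split an [n]-th root of [x] into [t] in [T] and a unit [u]. The discrepancy between [x] and
   [t *+ n] is [u *+ n], which lies in [T] and among the units, so it vanishes. *)
have divG : divisible G.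
  move=> n x n0; have [y yx] := pos_divisible mfK (val x) n0.
  have [t [u [Tt Uu ytu]]] := TUsum y.
  pose g : G := exist _ t (asboolT Tt); exists g; apply: val_inj.
  have gn : val (g *+ n) = t *+ n by rewrite val_osubMn.
  apply/eqP; rewrite eq_sym -subr_eq0 gn; apply/eqP.
  have un : val x - t *+ n = u *+ n by rewrite -yx ytu mulrnDl addrC addKr.
  apply: TU; last by rewrite un; apply: unit_valuesMn.
  by rewrite -gn; exact: (TB _ _ (osub_setP x) (osub_setP (g *+ n))).
split=> //; pose L : realFieldType := ps_field R G.
(* The inverse reverses the order: as for monomials, a larger exponent must give an infinitely
   smaller element. *)
pose t (g : G) : K := (val (val g))^-1.
pose h (g : G) : L := ps_mono g 1.
have val_gt0 (g : G) : 0 < val (val g) by exact: valP (val g).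
have t_gt0 g : 0 < t g by rewrite invr_gt0.
have h_gt0 (g : G) : 0 < h g by apply: (@hahn_mono_gt0 _ G R g 1).
have t_ll (i j : G) : i < j -> ll (t j : (K : orderedZmodType)) (t i).
  move=> ij [n]; rewrite !oabs_norm !gtr0_norm// => le_n.
  (* The element of [K] behind [j - i] is at most [n] and its inverse at most 1, so it is a unit in
     [T]. *)
  have ij0 : val (j - i) = 0 :> pos K.
    apply: TU; first exact: osub_setP (j - i).
    exists n.+1; have lt_ij : val (val i) < val (val j) by rewrite !lt_val.
    have vE : val (val (j - i)) = val (val j) / val (val i) by [].
    rewrite vE; split.
      have {}le_n : t i <= n%:R / val (val j) by rewrite mulr_natl; exact: le_n.
      rewrite ler_pdivlMr// mulrC in le_n.
      by apply: (le_trans le_n); rewrite ler_nat.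
    rewrite invfM invrK mulrC ler_pdivrMr//. apply: (le_trans (ltW lt_ij)).
    by rewrite ler_peMl ?ler1n// ltW.
  move: ij; rewrite -osubr_gt0; suff -> : j - i = 0 by rewrite ltxx.
  exact: val_inj.
have th_ll i j : i != j -> (ll (t i : (K : orderedZmodType)) (t j) /\
      ll (h i : (L : orderedZmodType)) (h j)) \/
    (ll (t j : (K : orderedZmodType)) (t i) /\ ll (h j : (L : orderedZmodType)) (h i)).
  rewrite neq_lt => /orP[ij|ji]; [right|left].
    by split; [exact: t_ll|exact: (@hahn_mono_ll _ G R j i 1 1 ij (oner_neq0 R))].
  by split; [exact: t_ll|exact: (@hahn_mono_ll _ G R i j 1 1 ji (oner_neq0 R))].
have mP := span_matchingP t_gt0 h_gt0 th_ll.
have rP : ring_matching (@span_matching K L G t h).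
  apply: (span_ring_matching mP).
  - exact: invr1.
  - by apply: hahnP.
  - by move=> i j; rewrite /t -invfM.
  - by move=> i j; rewrite /h [RHS]ps_monoM mulr1.
have [||f [fB fM fbij fmono]] := ordered_field_iso closedK (ps_field_real_closed divG)
    sK cK (@ps_field_spherically_complete R G) (@ps_field_components_complete R G) rP.
- move=> x x0; have ax : 0 < `|x| by rewrite normr_gt0.
  (* Writing the inverse of [|x|] as the product of [s] in [T] and a unit [u] gives [t g = |x| u],
     of the same value as [x]. *)
  have [s [u [Ts [n [un un']] xsu]]] := TUsum (- (exist _ `|x| ax : pos K)).
  pose g : G := exist _ s (asboolT Ts).
  have u0 := valP u; have tg : t g = `|x| * val u.
    have sE : `|x|^-1 = val s * val u by exact: (congr1 val xsu).
    have s0 : val s != 0 by rewrite gt_eqF// (valP s).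
    rewrite -[t g]/((val s)^-1); apply: (mulIf s0).
    by rewrite mulVf// -mulrA [val u * _]mulrC -sE divff// gt_eqF.
  exists (t g), (h g); split; first exact: span_matching_gen.
    exists n; rewrite !oabs_norm (gtr0_norm (t_gt0 g)) tg -mulrnAr.
    by rewrite -[leLHS]mulr1 ler_pM2l// -mulr_natl -ler_pdivrMr// mul1r.
  by exists n; rewrite !oabs_norm (gtr0_norm (t_gt0 g)) tg -mulr_natr ler_pM2l.
- move=> y y0; have [i yi] : exists i, lead (y : hahn _) i by apply: leadP.
  have [yh hy] := dom_lead_mono (oner_neq0 R) yi.
  by exists (h i), (t i); split=> //; apply: span_matching_gen.
pose fA := GRing.isZmodMorphism.Build K (power_series (R : realFieldType) G) f fB.
pose fR := GRing.isMonoidMorphism.Build K (power_series (R : realFieldType) G) f fM.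
by exists (HB.pack_for {rmorphism K -> power_series (R : realFieldType) G} f fA fR).
Qed.

Theorem corollary6 :
  (forall G : orderedZmodType, symmetrically_complete G ->
     divisible G /\
     exists (d : Order.disp_t) (I : orderType d) (C : I -> orderedZmodType),
       (forall i : I, archimedean (C i)) /\
       exists f : {additive G -> hahn C},
         bijective f /\ {mono f : x y / x <= y}) /\
  (forall (R : realType) (K : realFieldType), symmetrically_complete K ->
     Num.real_closed_axiom K /\
     exists G : orderedZmodType,
       divisible G /\
       exists f : {rmorphism K -> power_series R G},
         bijective f /\ {mono f : x y / x <= y}).
Proof.
split=> [G symG|R K]; last exact: symmetrically_complete_field.
have mfG := symmetrically_complete_mirror_free symG.
split.
  apply: complete_divisible; first exact: mirror_free_spherically_complete.
  exact: mirror_free_components_complete.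
have [f fP] := symmetrically_complete_group Rdefinitions.R symG.
pose R : realType := Rdefinitions.R.
exists _, ((value_class G)^d)%type, (fun _ => (R : realFieldType) : orderedZmodType).
split; last by exists f.
by move=> _; exact: archimedean_real.
Qed.
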